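(* Let $T\colon R^{p,0}_\omega\to R^{p,0}_\omega$ be a bounded linear operator. For every $\epsilon>0$ there exists $\lambda_0$ in the convex hull of $\mathcal D(T)$ such that $T$ is an orthogonal factor of $\lambda_0I\colon R^{p,0}_\omega\to R^{p,0}_\omega$ with error $\epsilon$, where $I$ is the identity on $R^{p,0}_\omega$.
   Context: Fix $1<p<\infty$, $q=p/(p-1)$, $p^*=\max\{p,q\}$. All $L_r$ spaces are over $[0,1]$ with Lebesgue measure and $\langle g,f\rangle=\int_0^1gf$. A dyadic interval is $[(i-1)2^{-n},i2^{-n})$, $n\ge0$, $1\le i\le2^n$; $\mathcal D^n$ is the set of those of length $2^{-n}$ and $\mathcal D_n=\bigcup_{k=0}^n\mathcal D^k$. For a dyadic interval $I$, $I^+,I^-$ are its left and right halves and $h_I=\chi_{I^+}-\chi_{I^-}$. For each $n\in\mathbb N$ a family $(h^n_I)_{I\in\mathcal D_{n-1}}$ in $L_p$ is fixed with the same joint distribution as $(h_I)_{I\in\mathcal D_{n-1}}$, such that the $\sigma$-algebras $\sigma(h^n_I:I\in\mathcal D_{n-1})$, $n\in\mathbb N$, are independent. Let $\mathcal D_\omega=\{(n,I):n\in\mathbb N,I\in\mathcal D_{n-1}\}$. $R^{p,0}_\omega$ is the closed linear span of $\{h^n_I:(n,I)\in\mathcal D_\omega\}$ in $L_p$ (a distributional copy of the mean-zero hyperplane of the Bourgain–Rosenthal–Schechtman space $R^p_\omega$); $(h^n_I)$ is an unconditional basis of it. For an operator $T$ on $R^{p,0}_\omega$, $\mathcal D(T)=\{|I|^{-1}\langle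 h^n_I,Th^n_I\rangle:(n,I)\in\mathcal D_\omega\}$. Orthogonal factors: an orthogonal projection $P$ on $L_2(\Omega)$ (probability space $\Omega$) is $p$-$C$-bounded if $\|Pf\|_p\le C\|f\|_p$ for $f\in L_2\cap L_p$; a subspace $X\subseteq L_p(\Omega)$ is $C$-orthogonally complemented if it is the $\|\cdot\|_p$-closure of $P(L_2\cap L_p)$ for such a $P$, and $P_X$ denotes the extension of $P|_{L_2\cap L_p}$ to $L_p(\Omega)$. $R^{p,0}_\omega$ is $C$-orthogonally complemented in $L_p$ for some $C$. A distributional embedding $j\colon Y\to X$ is a linear map with $j(y)$ and $y$ equidistributed for all $y$; distributional images of $C$-orthogonally complemented spaces are $C$-orthogonally complemented. $T\colon X\to X$ is an orthogonal factor of $S\colon Y\to Y$ with error $\epsilon$ if there is a distributional embedding $j\colon Y\to X$ with $\|j^{-1}P_{j(Y)}Tj-S\|<\epsilon$. *)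

(* Defs.v *)
(* All L_r spaces are over [0,1] with
   Lebesgue measure; elements are represented by functions R -> R, measurable
   on [0,1], and all identities between elements are a.e. on [0,1]. *)
From HB Require Import structures.
From mathcomp Require Import all_boot all_order all_algebra.
From mathcomp Require Import all_classical all_reals all_analysis.
Set Implicit Arguments. Unset Strict Implicit. Unset Printing Implicit Defensive.
Import Order.TTheory GRing.Theory Num.Theory.
Local Open Scope classical_set_scope.
Local Open Scope ring_scope.

Section Defs.
Context {R : realType}.
Local Notation lam := (@lebesgue_measure R).

Definition I01 : set R := `[0%R, 1%R].

Definition pnorm (p : R) (f : R -> R) : \bar R :=
  ((\int[lam]_(x in I01) (`|f x| `^ p)%:E) `^ p^-1)%E.

Definition inLp (p : R) (f : R -> R) : Prop :=
  measurable_fun I01 f /\ (\int[lam]_(x in I01) (`|f x| `^ p)%:E < +oo)%E.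

Definition ae01 (f g : R -> R) : Prop := {ae lam, forall x, I01 x -> f x = g x}.

Definition ip (g f : R -> R) : R := fine (\int[lam]_(x in I01) (g x * f x)%:E).

(* the Haar function h_I of the dyadic interval I = [i 2^-k, (i+1) 2^-k), i < 2^k
   (0-based index i; I^+ left half, I^- right half) *)
Definition haar (k i : nat) (x : R) : R :=
  let a := i%:R / (2 ^ k)%:R in
  let m := (i.*2.+1)%:R / (2 ^ k.+1)%:R in
  let b := i.+1%:R / (2 ^ k)%:R in
  if (a <= x) && (x < m) then 1 else if (m <= x) && (x < b) then -1 else 0.

(* Families are indexed by (n, k, i): h n k i = h^n_I for I the i-th dyadic
   interval of length 2^-k; (n,I) in D_omega iff 1 <= n, k <= n-1, i < 2^k. *)

Definition same_joint_law (n : nat) (g g' : nat -> nat -> R -> R) : Prop :=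
  forall B : nat -> nat -> set R, (forall k i, measurable (B k i)) ->
  lam (I01 `&` \bigcap_(k in [set k | (k < n)%N])
                \bigcap_(i in [set i | (i < 2 ^ k)%N]) (g k i @^-1` B k i))
  = lam (I01 `&` \bigcap_(k in [set k | (k < n)%N])
                \bigcap_(i in [set i | (i < 2 ^ k)%N]) (g' k i @^-1` B k i)).

Definition block_gen (h : nat -> nat -> nat -> R -> R) (n : nat) : set (set R) :=
  [set A | exists k i (B : set R), [/\ (k < n)%N, (i < 2 ^ k)%N, measurable B &
                                     A = I01 `&` h n k i @^-1` B]].
Definition block_sigma (h : nat -> nat -> nat -> R -> R) (n : nat) : set (set R) :=
  <<s I01, block_gen h n >>.

Definition blocks_independent (h : nat -> nat -> nat -> R -> R) : Prop :=
  forall (F : seq nat), uniq F -> (forall n, n \in F -> (0 < n)%N) ->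
  forall A : nat -> set R, (forall n, n \in F -> block_sigma h n (A n)) ->
  lam (I01 `&` \bigcap_(n in [set n | n \in F]) A n) = (\prod_(n <- F) lam (A n))%E.

Definition RX (p : R) (h : nat -> nat -> nat -> R -> R) : set (R -> R) :=
  [set f | inLp p f /\ forall e : R, 0 < e -> exists (N : nat) (c : nat -> nat -> nat -> R),
     (pnorm p (fun x => (f x - \sum_(n < N) \sum_(k < n) \sum_(i < 2 ^ k)
                                c n k i * h n k i x)%R) < e%:E)%E].

Definition linear_on (X : set (R -> R)) (A : (R -> R) -> (R -> R)) : Prop :=
  forall (a : R) f g, X f -> X g ->
    ae01 (A (fun x => a * f x + g x)) (fun x => a * A f x + A g x).

Definition bounded_op (p : R) (X : set (R -> R)) (T : (R -> R) -> (R -> R)) : Prop :=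
  [/\ forall f, X f -> X (T f), linear_on X T &
      exists C : R, forall f, X f -> (pnorm p (T f) <= C%:E * pnorm p f)%E].

(* D(T) : (n,I) |-> |I|^-1 <h^n_I, T h^n_I>, |I| = 2^-k *)
Definition diagT (h : nat -> nat -> nat -> R -> R) (T : (R -> R) -> (R -> R))
  (n k i : nat) : R := (2 ^ k)%:R * ip (h n k i) (T (h n k i)).

Definition in_conv_diag (h : nat -> nat -> nat -> R -> R) (T : (R -> R) -> (R -> R))
  (lam0 : R) : Prop :=
  exists (N : nat) (w : nat -> nat -> nat -> R),
  [/\ forall n k i, 0 <= w n k i,
      \sum_(n < N) \sum_(k < n) \sum_(i < 2 ^ k) w n k i = 1 &
      lam0 = \sum_(n < N) \sum_(k < n) \sum_(i < 2 ^ k) w n k i * diagT h T n k i].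

Definition equidist (f g : R -> R) : Prop :=
  forall B : set R, measurable B -> lam (I01 `&` f @^-1` B) = lam (I01 `&` g @^-1` B).

Definition dist_emb (Y X : set (R -> R)) (j : (R -> R) -> (R -> R)) : Prop :=
  [/\ forall y, Y y -> X (j y), linear_on Y j & forall y, Y y -> equidist (j y) y].

Definition orth_proj (P : (R -> R) -> (R -> R)) : Prop :=
  [/\ forall f, inLp 2 f -> inLp 2 (P f),
      linear_on (inLp 2) P,
      forall f, inLp 2 f -> ae01 (P (P f)) (P f) &
      forall f g, inLp 2 f -> inLp 2 g -> ip (P f) g = ip f (P g)].

Definition p_bounded (p C : R) (P : (R -> R) -> (R -> R)) : Prop :=
  forall f, inLp 2 f -> inLp p f ->
    inLp p (P f) /\ (pnorm p (P f) <= C%:E * pnorm p f)%E.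

Definition orth_compl_by (p C : R) (P : (R -> R) -> (R -> R)) (Z : set (R -> R)) : Prop :=
  [/\ orth_proj P, p_bounded p C P &
      Z = [set f | inLp p f /\ forall e : R, 0 < e -> exists g, [/\ inLp 2 g, inLp p g &
                     (pnorm p (fun x => (f x - P g x)%R) < e%:E)%E]]].

Definition proj_ext (p C : R) (P Q : (R -> R) -> (R -> R)) : Prop :=
  [/\ forall f, inLp p f -> inLp p (Q f),
      linear_on (inLp p) Q,
      forall f, inLp p f -> (pnorm p (Q f) <= C%:E * pnorm p f)%E &
      forall g, inLp 2 g -> inLp p g -> ae01 (Q g) (P g)].

Definition image_ae (p : R) (j : (R -> R) -> (R -> R)) (Y : set (R -> R)) : set (R -> R) :=
  [set z | inLp p z /\ exists y, Y y /\ ae01 (j y) z].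

Definition inv_on (p : R) (j : (R -> R) -> (R -> R)) (Y : set (R -> R))
  (k : (R -> R) -> (R -> R)) : Prop :=
  forall z, image_ae p j Y z -> Y (k z) /\ ae01 (j (k z)) z.

Definition opnorm_lt (p : R) (Y : set (R -> R)) (A : (R -> R) -> (R -> R)) (e : R) : Prop :=
  exists d : R, d < e /\ forall y, Y y -> (pnorm p (A y) <= d%:E * pnorm p y)%E.

Definition orth_factor (p : R) (X Y : set (R -> R)) (T S : (R -> R) -> (R -> R))
  (e : R) : Prop :=
  exists j, dist_emb Y X j /\
  exists (P : (R -> R) -> (R -> R)) (C : R) (Q k : (R -> R) -> (R -> R)),
  [/\ orth_compl_by p C P (image_ae p j Y), proj_ext p C P Q, inv_on p j Y k &
      opnorm_lt p Y (fun y x => k (Q (T (j y))) x - S y x) e].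

End Defs.

(* Main.v *)
(* The n-th block of Haar functions is the Haar system of a uniform label X_n with 2^n
   values; the labels are independent, and R^{p,0}_omega is the closed span of the mean
   zero functions of single labels. The conditional expectations E[f | X_n] - E f sum up
   to an L_p bounded projection onto this span (moment inequalities of von Bahr-Esseen
   and Rosenthal for independent sums, and duality). Replacing X_n by any other
   independent system Y_n of uniform labels is a distributional embedding, and its image
   is complemented by the corresponding projection.

   Take Y_n = pi_n(X_{m_n}) with m_n increasing and pi_n : {0..2^m_n - 1} -> {0..2^n - 1}
   having fibres of equal size. If m_n grows fast, the bilinear form <u(Y_n), T v(Y_n')>
   is negligible for n <> n': elements of the span have small components in late blocks,
   and T maps late blocks to almost weakly null functions, since many independent bounded
   summands have a norm of smaller order than their number. For n = n', cut the labels of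
   block m = k + N into 2^k groups of 2^N consecutive ones, permute each group by an
   independent random permutation, and let pi_n read off the leading n binary digits
   inside the group. The expectation of the form <u(Y_n), T v(Y_n)> is then lambda <u, v>,
   where lambda is an average of diagonal entries of T in block m, and its variance is
   O(2^{-k/p}). Hence some choice of permutations makes T almost lambda times the identity
   on Y_n. A cluster point of these lambda serves all n simultaneously, and the errors are
   summable, so that the compression of T to the span of the Y_n is close to a multiple
   of the identity. *)
Require Import Defs.
From HB Require Import structures.
From mathcomp Require Import all_boot all_order all_algebra fingroup perm.
From mathcomp Require Import all_classical all_reals all_analysis.
From mathcomp Require Import measurable_realfun.
From mathcomp Require Import ring lra zify.
Set Implicit Arguments. Unset Strict Implicit. Unset Printing Implicit Defensive.
Import Order.TTheory GRing.Theory Num.Theory.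
Import numFieldNormedType.Exports.
Local Open Scope classical_set_scope.
Local Open Scope ring_scope.

Opaque powR expR integral.

(** * Expectations and L_p norms on [0,1] *)

Section Lp.
Context {R : realType}.
Local Notation lam := (@lebesgue_measure R).
Local Notation I01 := (@I01 R).
Implicit Types (f g : R -> R) (p q r s : R).

(** The random relabelling is shaped by two demands. The mean of the form has to be a multiple of
    the inner product: a uniform permutation of a group retains, from the matrix of T, only the
    trace and the total sum of the diagonal block of that group, and these are exactly what the Haar
    functions living inside the groups see. This is why lambda is an average of diagonal entries and
    not merely some scalar. The fluctuation has to vanish: with a single group the variance estimate
    is only a constant. With 2^k independent permutations the form splits into 4^k centred terms
    that are orthogonal up to exchanging the two groups, each of size at most C 2^-k, with column
    sums at most C 2^(-k/p); size times column sum times the number of columns gives the decay. A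
    cluster point of averages need not lie in the convex hull itself. The final scalar is therefore
    one of the averages close to the cluster point, and half of the error bound is spent on this
    replacement and on the off-diagonal terms together. *)

Fact Ex_key : unit. Proof. exact: tt. Qed.
(** Locked, so that unification never unfolds the Lebesgue integral. [fine] sends infinite values to
    0, so linearity and monotonicity are stated under [L1]. *)
Definition Ex f : R := locked_with Ex_key (fun f => fine (\int[lam]_(x in I01) (f x)%:E)) f.
Definition L1 f : Prop := lam.-integrable I01 (EFin \o f).
Definition nrm p f : R := locked_with Ex_key (fun p f => Ex (fun x => `|f x| `^ p) `^ p^-1) p f.

Lemma ExE f : Ex f = fine (\int[lam]_(x in I01) (f x)%:E).
Proof. by rewrite /Ex unlock. Qed.

Lemma nrmE p f : nrm p f = Ex (fun x => `|f x| `^ p) `^ p^-1.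
Proof. by rewrite /nrm unlock. Qed.

Lemma ipE f g : ip f g = Ex (fun x => f x * g x).
Proof. by rewrite ExE. Qed.

Lemma measurable_I01 : measurable I01.
Proof. exact: measurable_itv. Qed.

(* The Lebesgue measure lives on [measurableTypeR R], whose display differs from
   that of the canonical measurable structure of [R]. *)
Lemma mI01 : @measurable _ (measurableTypeR R) I01.
Proof. exact: measurable_itv. Qed.

Lemma ae_imp (P Q : R -> Prop) : (forall x, P x -> Q x) ->
  {ae lam, forall x, P x} -> {ae lam, forall x, Q x}.
Proof. by move=> PQ; apply: (@filterS _ _ (ae_filter_ringOfSetsType lam)). Qed.

Lemma ae_imp2 (P1 P2 Q : R -> Prop) : (forall x, P1 x -> P2 x -> Q x) ->
  {ae lam, forall x, P1 x} -> {ae lam, forall x, P2 x} -> {ae lam, forall x, Q x}.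
Proof. by move=> PQ; apply: (@filterS2 _ _ (ae_filter_ringOfSetsType lam)). Qed.

Lemma lamI01 : lam I01 = 1%E.
Proof. by rewrite /I01 lebesgue_measure_itv/= lte_fin ltr01 oppr0 adde0. Qed.

Lemma I01_finite : (lam I01 < +oo)%E.
Proof. by rewrite lamI01 ltry. Qed.

Lemma eq_Ex f g : (forall x, I01 x -> f x = g x) -> Ex f = Ex g.
Proof.
by move=> fg; rewrite !ExE; congr fine; apply: eq_integral => x /set_mem/fg ->.
Qed.

Lemma L1_meas f : L1 f -> measurable_fun I01 f.
Proof. by move=> /integrableP[/measurable_EFinP]. Qed.

Lemma eq_L1 f g : (forall x, I01 x -> f x = g x) -> L1 f -> L1 g.
Proof.
move=> fg; apply: eq_integrable; first exact: mI01.
by move=> x /set_mem/fg/= ->.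
Qed.

Lemma L1_le f g : measurable_fun I01 f -> (forall x, I01 x -> `|f x| <= g x) ->
  L1 g -> L1 f.
Proof.
move=> mf fg; apply: le_integrable => //.
- exact: mI01.
- exact/measurable_EFinP.
- move=> x Dx /=; rewrite lee_fin (le_trans (fg _ Dx))//; exact: ler_norm.
Qed.

Lemma integral_cst01 (c : R) : (\int[lam]_(x in I01) c%:E = c%:E)%E.
Proof.
have := integral_cst lam mI01 c%:E; rewrite /cst => ->.
by rewrite -[RHS]mule1; congr (_ * _)%E; exact: lamI01.
Qed.

Lemma L1_cst (c : R) : L1 (fun=> c).
Proof.
apply/integrableP; split; first exact/measurable_EFinP.
under eq_integral do rewrite /=.
by rewrite (integral_cst01 `|c|) ltry.
Qed.

Lemma L1_bounded f (M : R) : measurable_fun I01 f ->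
  (forall x, I01 x -> `|f x| <= M) -> L1 f.
Proof. by move=> mf fM; apply: (L1_le mf fM); exact: L1_cst. Qed.

Lemma L1D f g : L1 f -> L1 g -> L1 (fun x => f x + g x).
Proof.
move=> f1 g1; have := integrableD mI01 f1 g1.
by apply: eq_integrable => [|x _ /=]; [exact: mI01|rewrite EFinD].
Qed.

Lemma L1Z (c : R) f : L1 f -> L1 (fun x => c * f x).
Proof.
move=> f1; have := integrableZl mI01 c f1.
by apply: eq_integrable => [|x _ /=]; [exact: mI01|rewrite EFinM].
Qed.

Lemma L1N f : L1 f -> L1 (fun x => - f x).
Proof.
by move=> /(L1Z (-1)); apply: eq_L1 => x _; rewrite mulN1r.
Qed.

Lemma L1B f g : L1 f -> L1 g -> L1 (fun x => f x - g x).
Proof. by move=> f1 /L1N; exact: L1D. Qed.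

Lemma L1_norm f : L1 f -> L1 (fun x => `|f x|).
Proof. by move=> /integrable_norm; exact. Qed.

Lemma L1_sum (I : Type) (s : seq I) (P : pred I) (F : I -> R -> R) :
  (forall i, P i -> L1 (F i)) -> L1 (fun x => \sum_(i <- s | P i) F i x).
Proof.
move=> F1; elim: s => [|i s IH].
  by apply: eq_L1 (L1_cst 0) => x _; rewrite big_nil.
have [Pi|Pi] := boolP (P i).
  apply: eq_L1 (L1D (F1 _ Pi) IH) => x _; by rewrite big_cons Pi.
by apply: eq_L1 IH => x _; rewrite big_cons (negbTE Pi).
Qed.

Lemma ExD f g : L1 f -> L1 g -> Ex (fun x => f x + g x) = Ex f + Ex g.
Proof. by move=> f1 g1; rewrite !ExE; exact: (RintegralD mI01 f1 g1). Qed.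

Lemma ExZ (c : R) f : L1 f -> Ex (fun x => c * f x) = c * Ex f.
Proof. by move=> f1; rewrite !ExE; exact: (RintegralZl _ mI01 f1). Qed.

Lemma ExB f g : L1 f -> L1 g -> Ex (fun x => f x - g x) = Ex f - Ex g.
Proof. by move=> f1 g1; rewrite !ExE; exact: (RintegralB mI01 f1 g1). Qed.

Lemma Ex_cst (c : R) : Ex (fun=> c) = c.
Proof. by rewrite ExE integral_cst01. Qed.

Lemma Ex_sum (I : Type) (s : seq I) (P : pred I) (F : I -> R -> R) :
  (forall i, P i -> L1 (F i)) ->
  Ex (fun x => \sum_(i <- s | P i) F i x) = \sum_(i <- s | P i) Ex (F i).
Proof.
move=> F1; elim: s => [|i s IH].
  rewrite big_nil -[RHS](Ex_cst 0); apply: eq_Ex => x _; by rewrite big_nil.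
rewrite big_cons; case: ifPn => Pi.
  rewrite -IH -ExD//; [|exact: F1|exact: L1_sum].
  by apply: eq_Ex => x _; rewrite big_cons Pi.
by rewrite -IH; apply: eq_Ex => x _; rewrite big_cons (negbTE Pi).
Qed.

Lemma Ex_ge0 f : (forall x, I01 x -> 0 <= f x) -> 0 <= Ex f.
Proof. by move=> f0; rewrite ExE; apply: Rintegral_ge0. Qed.

Lemma le_Ex f g : L1 f -> L1 g -> (forall x, I01 x -> f x <= g x) -> Ex f <= Ex g.
Proof. by move=> f1 g1; rewrite !ExE; exact: (le_Rintegral mI01 f1 g1). Qed.

Lemma le_norm_Ex f : L1 f -> `|Ex f| <= Ex (fun x => `|f x|).
Proof. by move=> f1; rewrite !ExE; exact: (le_normr_Rintegral mI01 f1). Qed.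

Lemma EFin_Ex f : L1 f -> (Ex f)%:E = (\int[lam]_(x in I01) (f x)%:E)%E.
Proof. by move=> f1; rewrite ExE fineK//; exact: (integrable_fin_num mI01 f1). Qed.

Lemma ae01_refl f : ae01 f f.
Proof. exact: aeW. Qed.

Lemma ae01_sym f g : ae01 f g -> ae01 g f.
Proof. exact: ae_eq_sym. Qed.

Lemma ae01_trans f g (h : R -> R) : ae01 f g -> ae01 g h -> ae01 f h.
Proof. exact: ae_eq_trans. Qed.

Lemma ae01_comp2 (F : R -> R -> R -> R) f g (f' g' : R -> R) : ae01 f f' -> ae01 g g' ->
  ae01 (fun x => F x (f x) (g x)) (fun x => F x (f' x) (g' x)).
Proof.
by apply: ae_imp2 => x H1 H2 xI; rewrite H1// H2.
Qed.

Lemma ae01_comp (F : R -> R -> R) f g : ae01 f g ->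
  ae01 (fun x => F x (f x)) (fun x => F x (g x)).
Proof. by apply: ae_imp => x H1 xI; rewrite H1. Qed.

Lemma ae_Ex f g : measurable_fun I01 f -> measurable_fun I01 g -> ae01 f g -> Ex f = Ex g.
Proof.
move=> mf mg fg; rewrite !ExE; congr fine; apply: ae_eq_integral => //.
- exact: mI01.
- exact/measurable_EFinP.
- exact/measurable_EFinP.
- by apply: ae_imp fg => x H Dx; rewrite H.
Qed.

Lemma measurable_powabs p f : measurable_fun I01 f ->
  measurable_fun I01 (fun x => `|f x| `^ p).
Proof.
move=> mf; apply: (measurableT_comp (measurable_powR p)).
exact: measurableT_comp.
Qed.

Lemma ae_L1 f g : measurable_fun I01 g -> ae01 f g -> L1 f -> L1 g.
Proof.
move=> mg fg f1; have mf := L1_meas f1.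
case/integrableP: f1 => _ fi; apply/integrableP; split; first exact/measurable_EFinP.
rewrite (_ : (\int[_]_(x in _) _)%E = (\int[lam]_(x in I01) `|(EFin \o f) x|)%E) //.
apply: ae_eq_integral => //.
- exact: mI01.
- by apply/measurable_EFinP; exact: measurableT_comp.
- by apply/measurable_EFinP; exact: measurableT_comp.
- by apply: ae_imp fg => x H Dx; rewrite /= H.
Qed.

Lemma inLpP p f : inLp p f <-> measurable_fun I01 f /\ L1 (fun x => `|f x| `^ p).
Proof.
split=> -[mf H]; split=> //.
  apply/integrableP; split.
    by apply/measurable_EFinP; exact: measurable_powabs.
  under eq_integral do rewrite /= ger0_norm ?powR_ge0//.
  exact: H.
case/integrableP: H => _.
by under eq_integral do rewrite /= ger0_norm ?powR_ge0//.
Qed.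

Lemma inLp_meas p f : inLp p f -> measurable_fun I01 f.
Proof. by case. Qed.

Lemma inLp_L1 p f : inLp p f -> L1 (fun x => `|f x| `^ p).
Proof. by move/inLpP => []. Qed.

Lemma Expow_ge0 p f : 0 <= Ex (fun x => `|f x| `^ p).
Proof. by apply: Ex_ge0 => x _; exact: powR_ge0. Qed.

Lemma pnormE p f : inLp p f -> pnorm p f = (nrm p f)%:E.
Proof.
by move=> fp; rewrite nrmE /pnorm -(EFin_Ex (inLp_L1 fp)) poweR_EFin.
Qed.

Lemma nrm_ge0 p f : 0 <= nrm p f.
Proof. by rewrite nrmE; exact: powR_ge0. Qed.

Lemma nrm_powR p f : 0 < p -> nrm p f `^ p = Ex (fun x => `|f x| `^ p).
Proof.
move=> p0; rewrite !nrmE -powRrM mulVf ?gt_eqF// powRr1//; exact: Expow_ge0.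
Qed.

Lemma eq_nrm p f g : (forall x, I01 x -> f x = g x) -> nrm p f = nrm p g.
Proof. by move=> fg; rewrite !nrmE; congr (_ `^ _); apply: eq_Ex => x xI; rewrite fg. Qed.

Lemma ae_nrm p f g : measurable_fun I01 f -> measurable_fun I01 g -> ae01 f g ->
  nrm p f = nrm p g.
Proof.
move=> mf mg fg; rewrite !nrmE; congr (_ `^ _).
apply: ae_Ex; [exact: measurable_powabs..|exact: (ae01_comp (fun _ y => `|y| `^ p))].
Qed.

Lemma ae_inLp p f g : measurable_fun I01 g -> ae01 f g -> inLp p f -> inLp p g.
Proof.
move=> mg fg /inLpP[mf f1]; apply/inLpP; split=> //.
apply: ae_L1 f1; first exact: measurable_powabs.
exact: (ae01_comp (fun _ y => `|y| `^ p)).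
Qed.

Lemma eq_inLp p f g : (forall x, I01 x -> f x = g x) -> inLp p f -> inLp p g.
Proof.
move=> fg fp; apply: ae_inLp (fp); last exact: aeW.
apply: eq_measurable_fun (inLp_meas fp) => x /set_mem; exact: fg.
Qed.

Lemma inLp_bounded p f (M : R) : 0 <= p -> measurable_fun I01 f ->
  (forall x, I01 x -> `|f x| <= M) -> inLp p f.
Proof.
move=> p0 mf fM; apply/inLpP; split => //.
apply: (@L1_bounded _ (M `^ p)); first exact: measurable_powabs.
move=> x Ix; rewrite ger0_norm ?powR_ge0//; apply: ge0_ler_powR => //.
- by rewrite nnegrE (le_trans _ (fM _ Ix)).
- exact: fM.
Qed.

Lemma nrm_bounded p f (M : R) : 0 < p -> measurable_fun I01 f ->
  (forall x, I01 x -> `|f x| <= M) -> 0 <= M -> nrm p f <= M.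
Proof.
move=> p0 mf fM M0; rewrite !nrmE -[leRHS]powRr1// -(mulfV (lt0r_neq0 p0)) powRrM.
apply: ge0_ler_powR; rewrite ?invr_ge0 ?(ltW p0)// ?nnegrE ?powR_ge0//; first exact: Expow_ge0.
rewrite -[leRHS]Ex_cst; apply: le_Ex; [|exact: L1_cst|].
  by apply/inLp_L1/(inLp_bounded (ltW p0) mf fM).
move=> x Ix; apply: ge0_ler_powR; rewrite ?(ltW p0) ?nnegrE//; exact: fM.
Qed.

Lemma measurable_restr f : measurable_fun I01 f -> measurable_fun setT (f \_ I01).
Proof. by move=> mf; have [+ _] := measurable_restrictT f measurable_I01; exact. Qed.

(** Extension by 0 moves functions on [0,1] to the whole line, where Minkowski and Hoelder are
    applied. For [p = 0] the outside would contribute, since a zeroth power is 1 even at 0. *)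
Lemma Lnorm_restr p f : p != 0 -> Lnorm lam p%:E (EFin \o (f \_ I01)) = pnorm p f.
Proof.
move=> p0; rewrite unlock /pnorm.
suff -> : (\int[lam]_x `|(EFin \o f \_ I01) x| `^ p = \int[lam]_(x in I01) (`|f x| `^ p)%:E)%E by [].
rewrite [RHS]integral_mkcond; apply: eq_integral => x _ /=.
rewrite /patch; case: ifP => xI //=.
by rewrite normr0 powR0.
Qed.

Lemma inLp_pnorm p f : 0 < p -> measurable_fun I01 f -> (pnorm p f < +oo)%E -> inLp p f.
Proof.
move=> p0 mf H; split=> //; rewrite ltNge leye_eq; apply/negP => /eqP E.
move: H; rewrite /pnorm E poweRyr ?ltxx//; apply: invr_neq0; exact: lt0r_neq0.
Qed.

Lemma inLpD p f g : 1 <= p -> inLp p f -> inLp p g -> inLp p (fun x => f x + g x) /\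
  nrm p (fun x => f x + g x) <= nrm p f + nrm p g.
Proof.
move=> p1 fp gp; have p0 : 0 < p by exact: lt_le_trans p1.
have [mf mg] := (inLp_meas fp, inLp_meas gp).
have mfg : measurable_fun I01 (fun x => f x + g x) by exact: measurable_funD.
have := minkowski_EFin lam (measurable_restr mf) (measurable_restr mg) p1.
have pn0 := lt0r_neq0 p0; rewrite !(Lnorm_restr _ pn0).
have -> : (f \_ I01 \+ g \_ I01) = (fun x => f x + g x) \_ I01.
  apply/funext => x /=; rewrite /patch; case: ifP => //; by rewrite addr0.
rewrite (Lnorm_restr _ pn0) (pnormE fp) (pnormE gp) => H.
have fgp : inLp p (fun x => f x + g x).
  by apply: inLp_pnorm => //; apply: le_lt_trans H _; rewrite -EFinD ltry.
by split=> //; move: H; rewrite pnormE// -EFinD lee_fin.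
Qed.

Lemma inLpZ p (c : R) f : inLp p f -> inLp p (fun x => c * f x).
Proof.
move=> /inLpP[mf f1]; apply/inLpP; split; first exact: measurable_funM.
by apply: eq_L1 (L1Z (`|c| `^ p) f1) => x _; rewrite normrM powRM.
Qed.

Lemma nrmZ p (c : R) f : 0 < p -> inLp p f -> nrm p (fun x => c * f x) = `|c| * nrm p f.
Proof.
move=> p0 fp; rewrite !nrmE.
rewrite (@eq_Ex _ (fun x => `|c| `^ p * `|f x| `^ p)); last first.
  by move=> x _; rewrite normrM powRM.
rewrite ExZ; last exact: inLp_L1.
rewrite powRM ?powR_ge0 ?Expow_ge0// -powRrM mulfV ?gt_eqF// powRr1//.
Qed.

Lemma nrmN p f : nrm p (fun x => - f x) = nrm p f.
Proof. by rewrite !nrmE; congr (_ `^ _); apply: eq_Ex => x _; rewrite normrN. Qed.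

Lemma inLpN p f : inLp p f -> inLp p (fun x => - f x).
Proof. by move=> /(inLpZ (-1)); apply: eq_inLp => x _; rewrite mulN1r. Qed.

Lemma inLpB p f g : 1 <= p -> inLp p f -> inLp p g -> inLp p (fun x => f x - g x) /\
  nrm p (fun x => f x - g x) <= nrm p f + nrm p g.
Proof.
by move=> p1 fp /inLpN gp; rewrite -(nrmN p g); exact: inLpD.
Qed.

Lemma nrmC p f g : nrm p (fun x => f x - g x) = nrm p (fun x => g x - f x).
Proof. by rewrite -nrmN; apply: eq_nrm => x _; rewrite opprB. Qed.

Lemma nrm_dist p f g (k : R -> R) : 1 <= p -> inLp p f -> inLp p g -> inLp p k ->
  nrm p (fun x => f x - g x) <= nrm p (fun x => f x - k x) + nrm p (fun x => k x - g x).
Proof.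
move=> p1 fp gp kp; have := (inLpD p1 (inLpB p1 fp kp).1 (inLpB p1 kp gp).1).2.
by apply: le_trans; rewrite le_eqVlt; apply/orP; left; apply/eqP; apply: eq_nrm => x _; lra.
Qed.

Lemma nrm_le_dist p f g : 1 <= p -> inLp p f -> inLp p g ->
  nrm p f <= nrm p g + nrm p (fun x => f x - g x).
Proof.
move=> p1 fp gp; have := (inLpD p1 gp (inLpB p1 fp gp).1).2.
by apply: le_trans; rewrite le_eqVlt; apply/orP; left; apply/eqP; apply: eq_nrm => x _; lra.
Qed.

Lemma hoelderE p q f g : 0 < p -> 0 < q -> p^-1 + q^-1 = 1 -> inLp p f -> inLp q g ->
  L1 (fun x => f x * g x) /\ Ex (fun x => `|f x * g x|) <= nrm p f * nrm q g.
Proof.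
move=> p0 q0 pq fp gp.
have [mf mg] := (inLp_meas fp, inLp_meas gp).
have := hoelder lam (measurable_restr mf) (measurable_restr mg) p0 q0 pq.
rewrite (Lnorm_restr _ (lt0r_neq0 p0)) (Lnorm_restr _ (lt0r_neq0 q0)) (pnormE fp) (pnormE gp) Lnorm1 => H.
have mfg : measurable_fun I01 (fun x => f x * g x) by exact: measurable_funM.
have E : (\int[lam]_x `|((f \_ I01 \* g \_ I01) x)%:E| =
          \int[lam]_(x in I01) (`|f x * g x|)%:E)%E.
  rewrite [RHS]integral_mkcond; apply: eq_integral => x _ /=.
  by rewrite /patch; case: ifP => //= _; rewrite mulr0 normr0.
rewrite E in H.
have fg1 : L1 (fun x => f x * g x).
  apply/integrableP; split; first exact/measurable_EFinP.
  by apply: le_lt_trans H _; rewrite -EFinM ltry.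
split=> //; move: H; rewrite -EFin_Ex ?lee_fin//; exact: L1_norm.
Qed.

Lemma Ex_jensen s r f : 0 < s -> s <= r -> inLp r f ->
  inLp s f /\ Ex (fun x => `|f x| `^ s) <= Ex (fun x => `|f x| `^ r) `^ (s / r).
Proof.
move=> s0; rewrite le_eqVlt => /orP[/eqP <- fp|sr fr].
  by split => //; rewrite mulfV ?gt_eqF// powRr1// Expow_ge0.
have r0 : 0 < r by exact: lt_trans sr.
have mf := inLp_meas fr.
pose P := r / s; pose Q := (1 - P^-1)^-1.
have P1 : 1 < P by rewrite /P ltr_pdivlMr// mul1r.
have P0 : 0 < P by exact: lt_trans P1.
have Q0 : 0 < Q by rewrite invr_gt0 subr_gt0 invf_lt1.
have PQ : P^-1 + Q^-1 = 1 by rewrite /Q invrK addrC subrK.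
have mfs : measurable_fun I01 (fun x => `|f x| `^ s) by exact: measurable_powabs.
have E x : `| (`|f x| `^ s) | `^ P = `|f x| `^ r.
  by rewrite ger0_norm ?powR_ge0// -powRrM /P mulrC divfK ?gt_eqF.
have fsP : inLp P (fun x => `|f x| `^ s).
  by apply/inLpP; split=> //; apply: eq_L1 (inLp_L1 fr) => x _; rewrite E.
have oneQ : inLp Q (fun=> 1).
  by apply: (@inLp_bounded _ _ 1) => //; [exact: ltW|move=> x _; rewrite normr1].
have [H1 H2] := hoelderE P0 Q0 PQ fsP oneQ.
have fs : inLp s f.
  by apply/inLpP; split=> //; apply: eq_L1 H1 => x _; rewrite mulr1.
split=> //.
have -> : Ex (fun x => `|f x| `^ s) = Ex (fun x => `| (`|f x| `^ s * 1) |).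
  by apply: eq_Ex => x _; rewrite mulr1 [RHS]ger0_norm ?powR_ge0.
apply: le_trans H2 _.
have -> : nrm P (fun x => `|f x| `^ s) = Ex (fun x => `|f x| `^ r) `^ (s / r).
  by rewrite nrmE (eq_Ex (fun x _ => E x)) /P invf_div.
rewrite ler_piMr ?powR_ge0// nrm_bounded// => x _; by rewrite normr1.
Qed.

Lemma nrm_mono s r f : 1 <= s -> s <= r -> inLp r f -> inLp s f /\ nrm s f <= nrm r f.
Proof.
move=> s1 sr fr; have s0 : 0 < s by exact: lt_le_trans s1.
have [fs H] := Ex_jensen s0 sr fr; split=> //.
rewrite !nrmE (_ : r^-1 = (s / r) * s^-1); last first.
  by rewrite mulrAC mulfV ?mul1r// gt_eqF.
rewrite [leRHS]powRrM; apply: ge0_ler_powR => //.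
- by rewrite invr_ge0 ltW.
- by rewrite nnegrE Expow_ge0.
- by rewrite nnegrE powR_ge0.
Qed.

Lemma inL1 p f : 1 <= p -> inLp p f -> L1 f.
Proof.
move=> p1 fp; have [f1 _] := nrm_mono (lexx 1) p1 fp.
apply: (L1_le (inLp_meas fp)) (inLp_L1 f1) => x _.
by rewrite powRr1.
Qed.

Lemma Ex_le_nrm p f : 1 <= p -> inLp p f -> Ex (fun x => `|f x|) <= nrm p f.
Proof.
move=> p1 fp; apply: le_trans (nrm_mono (lexx 1) p1 fp).2.
rewrite !nrmE invr1 powRr1 ?Expow_ge0// le_eqVlt; apply/orP; left; apply/eqP.
by apply: eq_Ex => x _; rewrite powRr1.
Qed.

Lemma nrm0_ae p f : 0 < p -> inLp p f -> nrm p f = 0 -> ae01 f (fun=> 0).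
Proof.
move=> p0 fp f0.
have mfp : measurable_fun I01 (fun x => (`|f x| `^ p)%:E).
  by apply/measurable_EFinP; exact: measurable_powabs (inLp_meas fp).
have [+ _] := ae_eq_integral_abs lam mI01 mfp.
have -> : (\int[lam]_(x in I01) `|(`|f x| `^ p)%:E| = 0)%E.
  under eq_integral do rewrite /= ger0_norm ?powR_ge0//.
  rewrite -EFin_Ex; last exact: inLp_L1.
  by rewrite -(nrm_powR f p0) f0 powR0// gt_eqF.
move=> /(_ erefl); apply: ae_imp => x H xI.
by move: (H xI) => /= [] /eqP; rewrite powR_eq0 normr_eq0 => /andP[/eqP].
Qed.

End Lp.

(** * Completeness of L_p and density of bounded functions *)

Section LpLim.
Context {R : realType}.
Local Notation lam := (@lebesgue_measure R).
Local Notation I01 := (@I01 R).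
Implicit Types (f g : R -> R) (p q r s : R).

Definition cvgN r (u : nat -> R -> R) f : Prop := forall e, 0 < e ->
  exists N, forall n, (N <= n)%N -> nrm r (fun x => u n x - f x) <= e.

Lemma powR_cvg (u : nat -> R) (l r : R) : 1 <= r -> (forall n, 0 <= u n) -> 0 <= l ->
  u n @[n --> \oo] --> l -> u n `^ r @[n --> \oo] --> l `^ r.
Proof.
move=> r1 u0; rewrite le_eqVlt => /orP[/eqP <-|l0] ul.
  rewrite powR0; last by rewrite gt_eqF// (lt_le_trans ltr01).
  (* At the limit 0 the power is squeezed below [u] itself, because [r >= 1] and eventually
     [u n < 1]. *)
  apply: (@squeeze_cvgr _ _ _ _ (fun=> 0) u) => //; last exact: cvg_cst.
  near=> n; have un : u n < 1 by near: n; exact: (cvgr_lt 0 ul 1 ltr01).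
  rewrite powR_ge0/=; have := u0 n; rewrite le_eqVlt => /orP[/eqP <-|un0].
    by rewrite powR0// gt_eqF// (lt_le_trans ltr01).
  by apply: ge1r_powR => //; rewrite un0 ltW.
suff H : {for l, continuous (fun x : R => x `^ r)} by exact: (cvg_comp _ _ ul H).
apply/differentiable_continuous/derivable1_diffP.
by apply: derivable_powR; rewrite in_itv/= l0.
Unshelve. all: by end_near. Qed.

Lemma inLp_measB r f g : measurable_fun I01 f -> measurable_fun I01 g ->
  measurable_fun I01 (fun x => `|f x - g x| `^ r).
Proof. by move=> mf mg; apply: measurable_powabs; exact: measurable_funB. Qed.

Lemma nrm_le_int r f (e : R) : 0 < r -> 0 <= e -> measurable_fun I01 f ->
  (\int[lam]_(x in I01) (`|f x| `^ r)%:E <= (e `^ r)%:E)%E -> inLp r f /\ nrm r f <= e.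
Proof.
move=> r0 e0 mf H.
have fr : inLp r f by split=> //; apply: le_lt_trans H _; rewrite ltry.
split=> //; rewrite -(@EFin_Ex R (fun x => `|f x| `^ r)) in H; last exact: inLp_L1.
rewrite nrmE -[leRHS]powRr1// -(mulfV (lt0r_neq0 r0)) powRrM.
apply: ge0_ler_powR => //; first by rewrite invr_ge0 ltW.
- by rewrite nnegrE Expow_ge0.
- by rewrite nnegrE powR_ge0.
Qed.

Lemma int_le_nrm r f (e : R) : 0 < r -> inLp r f -> nrm r f <= e ->
  (\int[lam]_(x in I01) (`|f x| `^ r)%:E <= (e `^ r)%:E)%E.
Proof.
move=> r0 fr H; rewrite -(@EFin_Ex R (fun x => `|f x| `^ r)); last exact: inLp_L1.
rewrite lee_fin -(nrm_powR f r0); apply: ge0_ler_powR => //; first exact: ltW.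
- by rewrite nnegrE nrm_ge0.
- by rewrite nnegrE (le_trans (nrm_ge0 r f)).
Qed.

Lemma abs_summable_cvg (u : nat -> R) :
  (\sum_(l <oo) (`|u l.+1 - u l|)%:E < +oo)%E -> cvgn u.
Proof.
move=> S; pose v l := u l.+1 - u l.
have vE n : [normed series v] n = \sum_(0 <= k < n) `|v k| by [].
have vc : cvgn [normed series v].
  apply: nondecreasing_is_cvgn.
    by apply/nondecreasing_seqP => n; rewrite !vE big_nat_recr//= lerDl normr_ge0.
  exists (fine (\sum_(l <oo) (`|u l.+1 - u l|)%:E)%E) => _ [n _ <-].
  rewrite -lee_fin fineK; last first.
    by rewrite ge0_fin_numE// nneseries_ge0.
  rewrite vE -sumEFin; apply: nneseries_lim_ge => //.
have := normed_cvg vc => vs.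
have -> : u = (fun n => u 0%N + series v n).
  by apply/funext => n; rewrite seriesEnat/= telescope_sumr//; lra.
by apply: is_cvgD => //; exact: is_cvg_cst.
Qed.

(** Riesz-Fischer: the increments have an integrable sum, hence the sequence converges almost
    everywhere, and Fatou's lemma turns the pairwise bounds into bounds on the distance to the
    limit. *)
Lemma rapid_limit r (g : nat -> R -> R) : 1 <= r -> (forall l, inLp r (g l)) ->
  (forall l k, (l <= k)%N -> nrm r (fun x => g k x - g l x) <= 1 / (2 ^ l.+1)%:R) ->
  exists f, inLp r f /\
    forall l, nrm r (fun x => f x - g l x) <= 1 / (2 ^ l.+1)%:R.
Proof.
move=> r1 gr H; have r0 : 0 < r by exact: lt_le_trans r1.
have mg l : measurable_fun I01 (g l) := inLp_meas (gr l).
pose d l x : \bar R := (`|g l.+1 x - g l x|)%:E.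
pose S x : \bar R := (\sum_(l <oo) d l x)%E.
have md l : measurable_fun I01 (d l).
  by apply/measurable_EFinP; apply: measurableT_comp => //; exact: measurable_funB.
have d0 l x : (0 <= d l x)%E by rewrite lee_fin.
have mS : measurable_fun I01 S.
  by apply: ge0_emeasurable_sum => // l x _ _.
have intS : (\int[lam]_(x in I01) S x < +oo)%E.
  rewrite (integral_nneseries lam mI01)//.
  apply: le_lt_trans (ltry 1).
  apply: le_trans (@epsilon_trick0 R 1 xpredT ler01).
  apply: lee_nneseries => [l _ _|l _]; first exact: integral_ge0.
  have gg := (inLpB r1 (gr l.+1) (gr l)).1.
  rewrite -(@EFin_Ex R (fun x => `|g l.+1 x - g l x|)); last exact/L1_norm/(inL1 r1).
  by rewrite lee_fin; apply: le_trans (Ex_le_nrm r1 gg) _; exact: H.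
have Sae : {ae lam, forall x, I01 x -> (S x < +oo)%E}.
  have : lam.-integrable I01 S.
    apply/integrableP; split=> //; apply: le_lt_trans intS.
    rewrite le_eqVlt; apply/orP; left; apply/eqP; apply: eq_integral => x _.
    by rewrite gee0_abs// nneseries_ge0.
  move=> /(integrable_ae mI01); apply: ae_imp => x Hx xI.
  by have := Hx xI; rewrite ge0_fin_numE// nneseries_ge0.
(* Setting the sequence to 0 on the null set of divergence makes it converge everywhere, so that the
   limit is measurable. *)
pose G l x := if (S x < +oo)%E then g l x else 0.
pose f x := limn (G ^~ x).
have GC x : G ^~ x @ \oo --> f x.
  rewrite /f; have [Sx|Sx] := boolP (S x < +oo)%E.
    have -> : G ^~ x = g ^~ x by apply/funext => l; rewrite /G Sx.
    exact: (abs_summable_cvg (u := g ^~ x)).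
  have -> : G ^~ x = cst 0 by apply/funext => l; rewrite /G (negbTE Sx).
  exact: is_cvg_cst.
have mSb : measurable_fun I01 (fun x => (S x < +oo)%E).
  apply: (measurable_fun_bool true).
  exact: (emeasurable_fun_infty_o measurable_I01 mS +oo%E).
have mG l : measurable_fun I01 (G l).
  apply: measurable_fun_if => //; first exact: measurable_I01.
  by apply: measurable_funS (mg l) => //; exact: measurable_I01.
have mf : measurable_fun I01 f by apply: (measurable_fun_cvg mG) => x _; exact: GC.
have Ggae l : ae01 (G l) (g l) by apply: ae_imp Sae => x Sx xI; rewrite /G Sx.
have key l : (\int[lam]_(x in I01) (`|f x - g l x| `^ r)%:E <= ((1 / (2 ^ l.+1)%:R) `^ r)%:E)%E.
  pose F k x := (`|G k x - g l x| `^ r)%:E.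
  have mF k : measurable_fun I01 (F k) by apply/measurable_EFinP; exact: inLp_measB.
  have F0 k x : I01 x -> (0 <= F k x)%E by rewrite lee_fin powR_ge0.
  have := fatou lam mI01 mF F0.
  have -> : (\int[lam]_(x in I01) limn_einf (F ^~ x) = \int[lam]_(x in I01) (`|f x - g l x| `^ r)%:E)%E.
    apply: eq_integral => x _.
    have FC : F ^~ x @ \oo --> (`|f x - g l x| `^ r)%:E.
      apply: cvg_EFin; first exact: nearW.
      apply: powR_cvg => //; apply: cvg_norm; apply: cvgB; [exact: GC|exact: cvg_cst].
    by rewrite is_cvg_limn_einfE; [exact/cvg_lim|apply/cvg_ex; eexists; exact: FC].
  move=> /le_trans; apply.
  rewrite limn_einf_lim; apply: lime_le; first exact: is_cvg_einfs.
  near=> n; apply: ereal_inf_le; exists (\int[lam]_(x in I01) F n x)%E; first by exists n => /=.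
  have -> : (\int[lam]_(x in I01) F n x = \int[lam]_(x in I01) (`|g n x - g l x| `^ r)%:E)%E.
    apply: ae_eq_integral => //; [exact: mI01|exact: mF| |].
      by apply/measurable_EFinP; exact: inLp_measB.
    by apply: ae_imp (Ggae n) => x Hx xI; rewrite /F Hx.
  apply: int_le_nrm => //; first exact: (inLpB r1 (gr n) (gr l)).1.
  by apply: H; near: n; exact: nbhs_infty_ge.
have kk l := nrm_le_int r0 (divr_ge0 ler01 (ler0n _ _)) (measurable_funB mf (mg l)) (key l).
exists f; split=> [|l]; last exact: (kk l).2.
by apply: eq_inLp (inLpD r1 (kk 0%N).1 (gr 0%N)).1 => x _ /=; rewrite subrK.
Unshelve. all: by end_near. Qed.

Lemma pow2_small (e : R) : 0 < e -> exists l, 1 / (2 ^ l.+1)%:R <= e.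
Proof.
move=> e0; have [n ne] : exists n : nat, e^-1 < n%:R.
  by exists (Num.truncn e^-1).+1; rewrite truncnS_gt.
exists n; rewrite ler_pdivrMr ?ltr0n ?expn_gt0// mulrC -ler_pdivrMr// div1r.
by apply: le_trans (ltW ne) _; rewrite ler_nat; apply: leq_trans (leqnSn _) (ltnW (ltn_expl _ _)).
Qed.

Lemma Lp_complete r (u : nat -> R -> R) : 1 <= r -> (forall n, inLp r (u n)) ->
  (forall e, 0 < e -> exists N, forall m n, (N <= m)%N -> (N <= n)%N ->
     nrm r (fun x => u m x - u n x) <= e) ->
  exists f, inLp r f /\ cvgN r u f.
Proof.
move=> r1 ur uC.
have /choice[N NP] : forall l, exists N, forall m n, (N <= m)%N -> (N <= n)%N ->
     nrm r (fun x => u m x - u n x) <= 1 / (2 ^ l.+1)%:R.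
  by move=> l; apply: uC; rewrite divr_gt0 ?ltr0n ?expn_gt0.
(* The sum dominates every threshold [N i] with [i <= l], so later terms of the subsequence satisfy
   all earlier conditions. *)
pose phi l := (\sum_(i < l.+1) N i)%N.
have phiN l k : (l <= k)%N -> (N l <= phi k)%N.
  move=> lk; rewrite /phi (bigD1 (Ordinal (n:=k.+1) (m:=l) _))//=.
  exact: leq_addr.
have [f [fr fH]] := @rapid_limit r (fun l => u (phi l)) r1 (fun l => ur _)
  (fun l k lk => NP l _ _ (phiN l k lk) (phiN l l (leqnn l))).
exists f; split=> // e e0; have [l le] := pow2_small (divr_gt0 e0 (ltr0n R 2)).
exists (phi l) => n nl; apply: le_trans (nrm_dist r1 (ur n) fr (ur (phi l))) _.
rewrite [leRHS](splitr e) lerD//.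
  by apply: le_trans le; apply: NP; [apply: leq_trans nl|]; exact: phiN.
by rewrite nrmC; apply: le_trans le.
Qed.

(** Truncation at height [n], with dominated convergence under the majorant [|f| ^ r]. *)
Lemma bounded_dense r f (e : R) : 1 <= r -> inLp r f -> 0 < e ->
  exists g (M : R), [/\ measurable_fun I01 g, forall x, `|g x| <= M & nrm r (fun x => f x - g x) <= e].
Proof.
move=> r1 fr e0; have r0 : 0 < r by exact: lt_le_trans r1.
have mf := inLp_meas fr.
pose g (n : nat) x := if `|f x| <= n%:R then f x else 0.
have mg n : measurable_fun I01 (g n).
  apply: measurable_fun_if.
  - exact: measurable_I01.
  - by apply: measurable_fun_ler => //; exact: measurableT_comp.
  - by apply: measurable_funS mf => //; exact: measurable_I01.
  - exact: measurable_cst.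
pose F n x := (`|f x - g n x| `^ r)%:E.
have mF n : measurable_fun I01 (F n) by apply/measurable_EFinP; exact: inLp_measB.
have F0 : (\int[lam]_(x in I01) F n x)%E @[n --> \oo] --> (\int[lam]_(x in I01) (cst 0%E) x)%E.
  have [] // := @dominated_convergence _ _ _ lam _ mI01 F (cst 0%E) (fun x => (`|f x| `^ r)%:E) mF _ _ _ _.
  - apply: aeW => x _; apply: cvg_near_cst; near=> n.
    rewrite /F /g ifT ?subrr ?normr0 ?powR0// ?gt_eqF//.
    by near: n; exact: nbhs_infty_ger.
  - exact: (inLp_L1 fr).
  - apply: aeW => x n _; rewrite /F /g; case: ifPn => _.
      by rewrite subrr normr0 powR0 ?gt_eqF//= normr0 lee_fin powR_ge0.
    by rewrite subr0 /= ger0_norm ?powR_ge0.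
rewrite integral0 in F0.
have er : (0 < (e `^ r)%:E)%E by rewrite lte_fin powR_gt0.
have [n _ Hn] := F0 _ (open_ereal_lt' er).
have [_ H] := nrm_le_int r0 (ltW e0) (measurable_funB mf (mg n)) (ltW (Hn n (leqnn n))).
exists (g n), n%:R; split=> // x; rewrite /g; case: ifPn => //; by rewrite normr0.
Unshelve. all: by end_near. Qed.

End LpLim.

(** * Systems of independent uniform labels *)

Section Labels.
Context {R : realType}.
Local Notation I01 := (@I01 R).
Implicit Types (f g : R -> R) (p q r : R) (X Y Z : nat -> R -> nat).

(* [Y n] is the atom, among the [2 ^ n] atoms of the n-th block, containing the
   point: independent uniform labels. *)
Record labels Y : Prop := Labels {
  lab_meas : forall n a, measurable_fun I01 (fun x => (Y n x == a)%:R : R);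
  lab_lt : forall n x, (Y n x < 2 ^ n)%N;
  lab_law : forall N (t : nat -> nat), (forall i, (i < N)%N -> (t i < 2 ^ i)%N) ->
    Ex (fun x => \prod_(i < N) (Y i x == t i)%:R) = \prod_(i < N) ((2 ^ i)%:R)^-1 :> R }.

Definition avg n (F : nat -> R) : R := (2 ^ n)%:R^-1 * \sum_(a < 2 ^ n) F a.

(** The expectation of [F] of the first [N] labels as an iterated average, last label outermost. It
    does not mention the label system, which is what makes joint laws transferable. *)
Fixpoint Exl N (F : seq nat -> R) : R :=
  if N is M.+1 then avg M (fun a => Exl M (fun s => F (rcons s a))) else F [::].

Definition lab Y N x : seq nat := mkseq (Y ^~ x) N.

Lemma two_pow_gt0 n : 0 < (2 ^ n)%:R :> R.
Proof. by rewrite ltr0n expn_gt0. Qed.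

Lemma two_pow_neq0 n : (2 ^ n)%:R != 0 :> R.
Proof. by rewrite gt_eqF// two_pow_gt0. Qed.

Lemma eq_avg n F G : (forall a, (a < 2 ^ n)%N -> F a = G a) -> avg n F = avg n G.
Proof. by move=> FG; rewrite /avg; congr (_ * _); apply: eq_bigr => a _; exact: FG. Qed.

Lemma avg_cst n (c : R) : avg n (fun=> c) = c.
Proof.
by rewrite /avg sumr_const card_ord -[c *+ _]mulr_natl mulrA mulVf ?mul1r// two_pow_neq0.
Qed.

Lemma avgZ n (c : R) F : avg n (fun a => c * F a) = c * avg n F.
Proof. by rewrite /avg -mulr_sumr mulrCA. Qed.

Lemma avgZr n (c : R) F : avg n (fun a => F a * c) = avg n F * c.
Proof. by rewrite /avg -mulr_suml mulrA. Qed.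

Lemma avgD n F G : avg n (fun a => F a + G a) = avg n F + avg n G.
Proof. by rewrite /avg big_split/= mulrDr. Qed.

Lemma avgB n F G : avg n (fun a => F a - G a) = avg n F - avg n G.
Proof. by rewrite /avg sumrB mulrBr. Qed.

Lemma le_avg n F G : (forall a, (a < 2 ^ n)%N -> F a <= G a) -> avg n F <= avg n G.
Proof.
move=> FG; rewrite /avg ler_pM2l ?invr_gt0 ?two_pow_gt0//.
by apply: ler_sum => a _; exact: FG.
Qed.

Lemma avg_delta n b : (b < 2 ^ n)%N -> avg n (fun a => (a == b)%:R) = (2 ^ n)%:R^-1.
Proof.
move=> bn; rewrite /avg (bigD1 (Ordinal bn))//= eqxx big1 ?addr0 ?mulr1// => a.
by rewrite -val_eqE/= => /negbTE ->.
Qed.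

Section OneSystem.
Variable Y : nat -> R -> nat.
Hypothesis HY : labels Y.

Lemma label_split n x (u : nat -> R) : u (Y n x) = \sum_(a < 2 ^ n) (Y n x == a)%:R * u a.
Proof.
rewrite (bigD1 (Ordinal (lab_lt HY n x)))//= eqxx mul1r big1 ?addr0// => a.
by rewrite -val_eqE/= eq_sym => /negbTE ->; rewrite mul0r.
Qed.

Lemma lab_meas_fun N F : measurable_fun I01 (fun x => F (lab Y N x) : R).
Proof.
elim: N F => [|N IH] F.
  by rewrite (_ : (fun x => _) = cst (F [::])).
rewrite (_ : (fun x => _) =
  (fun x => \sum_(a < 2 ^ N) (Y N x == a)%:R * F (rcons (lab Y N x) a))).
  apply: measurable_sum => a; apply: measurable_funM; first exact: lab_meas.
  exact: (IH (fun s => F (rcons s a))).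
by apply/funext => x; rewrite /lab mkseqS (label_split N x (fun a => F (rcons _ a))).
Qed.

Lemma lab_bounded N (F : seq nat -> R) : exists M : R, forall x, `|F (lab Y N x)| <= M.
Proof.
elim: N F => [|N IH] F; first by exists `|F [::]|.
have [M MP] := IH (fun s => \sum_(a < 2 ^ N) `|F (rcons s a)|).
exists M => x; apply: le_trans (MP x); rewrite [leRHS]ger0_norm ?sumr_ge0//.
rewrite /lab mkseqS (label_split N x (fun a => F (rcons _ a))).
apply: le_trans (ler_norm_sum _ _ _) _; apply: ler_sum => a _.
by rewrite normrM; case: eqP => _; rewrite ?normr1 ?normr0 ?mul1r ?mul0r.
Qed.

Lemma lab_L1 N F : L1 (fun x => F (lab Y N x)).
Proof.
have [M MP] := lab_bounded N F.
by apply: (@L1_bounded _ _ M) => [|x _]; [exact: lab_meas_fun|exact: MP].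
Qed.

Lemma lab_inLp N F r : 0 <= r -> inLp r (fun x => F (lab Y N x)).
Proof.
move=> r0; have [M MP] := lab_bounded N F.
by apply: (@inLp_bounded _ _ _ M) => //; exact: lab_meas_fun.
Qed.

Lemma nth_lab N i x : (i < N)%N -> nth 0%N (lab Y N x) i = Y i x.
Proof. by move=> iN; rewrite nth_mkseq. Qed.

Lemma take_lab N M x : (N <= M)%N -> take N (lab Y M x) = lab Y N x.
Proof.
move=> NM; apply: (@eq_from_nth _ 0%N); first by rewrite size_takel ?size_mkseq.
move=> i; rewrite size_takel ?size_mkseq// => iN.
by rewrite nth_take// !nth_lab// (leq_trans iN).
Qed.

(** [lab_law] evaluates only full products of indicators. The tail makes the induction work: each
    step expands [F] over the value of its last label and moves that indicator into the tail. *)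
Lemma Ex_lab_tail N M (F : seq nat -> R) (t : nat -> nat) : (N <= M)%N ->
  (forall i, (N <= i < M)%N -> (t i < 2 ^ i)%N) ->
  Ex (fun x => F (lab Y N x) * \prod_(N <= i < M) (Y i x == t i)%:R) =
  Exl N F * \prod_(N <= i < M) ((2 ^ i)%:R)^-1.
Proof.
elim: N F t => [|N IH] F t NM tP.
  rewrite /= big_mkord -(lab_law HY (t := t)); last by move=> i iM; apply: tP.
  rewrite -ExZ; first by apply: eq_Ex => x _; rewrite big_mkord.
  apply: eq_L1 (lab_L1 M (fun s => \prod_(i < M) (nth 0%N s i == t i)%:R)) => x _.
  by apply: eq_bigr => i _; rewrite nth_lab.
pose ta a i := if i == N then a else t i.
have E x : F (lab Y N.+1 x) * \prod_(N.+1 <= i < M) (Y i x == t i)%:R =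
   \sum_(a < 2 ^ N) F (rcons (lab Y N x) a) * \prod_(N <= i < M) (Y i x == ta a i)%:R.
  rewrite /lab mkseqS (label_split N x (fun a => F (rcons _ a))) mulr_suml.
  apply: eq_bigr => a _; rewrite [in RHS]big_ltn// {1}/ta eqxx -mulrA mulrCA; congr (_ * (_ * _)).
  apply: eq_big_nat => i /andP[Ni _]; rewrite /ta ifF//; apply/negbTE; lia.
rewrite (eq_Ex (fun x _ => E x)) Ex_sum; last first.
  move=> a _.
  apply: eq_L1 (lab_L1 M (fun s => F (rcons (take N s) a) * \prod_(N <= i < M) (nth 0%N s i == ta a i)%:R)) => x _.
  rewrite take_lab; last lia.
  by congr (_ * _); apply: eq_big_nat => i /andP[_ iM]; rewrite nth_lab.
transitivity (\sum_(a < 2 ^ N) Exl N (fun s => F (rcons s a)) * \prod_(N <= i < M) ((2 ^ i)%:R)^-1).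
  apply: eq_bigr => a _; apply: (IH (fun s => F (rcons s a)) (ta a)); first lia.
  by move=> i /andP[Ni iM]; rewrite /ta; case: eqP => [->//|/eqP iN]; apply: tP; lia.
rewrite /= /avg -mulr_suml [in LHS]big_ltn// mulrCA -!mulrA; congr (_ * _).
Qed.

Lemma Ex_lab N F : Ex (fun x => F (lab Y N x)) = Exl N F.
Proof.
have := @Ex_lab_tail N N F (fun=> 0%N) (leqnn _).
rewrite big_geq// mulr1 => <-; last by move=> i; lia.
by apply: eq_Ex => x _; rewrite big_geq// mulr1.
Qed.

(** Fubini for the [N]-th label against the earlier ones; all uses of independence below go through
    this form. *)
Lemma Ex_step N (G : seq nat -> nat -> R) :
  Ex (fun x => G (lab Y N x) (Y N x)) = avg N (fun a => Ex (fun x => G (lab Y N x) a)).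
Proof.
have -> : Ex (fun x => G (lab Y N x) (Y N x)) =
  Ex (fun x => (fun s => G (take N s) (nth 0%N s N)) (lab Y N.+1 x)).
  by apply: eq_Ex => x _; rewrite take_lab ?nth_lab.
rewrite (Ex_lab N.+1 (fun s => G (take N s) (nth 0%N s N))) /=; apply: eq_avg => a _.
rewrite (Ex_lab N (fun s => G s a)).
rewrite -(Ex_lab N (fun s => G (take N (rcons s a)) (nth 0%N (rcons s a) N))) -(Ex_lab N (fun s => G s a)); apply: eq_Ex => x _.
have sN : size (lab Y N x) = N by rewrite size_mkseq.
by rewrite nth_rcons sN ltnn eqxx -cats1 take_size_cat.
Qed.

Lemma label_L1 n (u : nat -> R) : L1 (fun x => u (Y n x)).
Proof.
by apply: eq_L1 (lab_L1 n.+1 (fun s => u (nth 0%N s n))) => x _; rewrite nth_lab.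
Qed.

Lemma label_meas n (u : nat -> R) : measurable_fun I01 (fun x => u (Y n x)).
Proof. exact: L1_meas (label_L1 n u). Qed.

Lemma Ex_label n u : Ex (fun x => u (Y n x)) = avg n u.
Proof. by rewrite (Ex_step n (fun _ a => u a)); apply: eq_avg => a _; rewrite Ex_cst. Qed.

Lemma Ex_label2 n m u v : n != m ->
  Ex (fun x => u (Y n x) * v (Y m x)) = avg n u * avg m v.
Proof.
wlog nm : n m u v / (n < m)%N.
  move=> H nm; case: (ltngtP n m) => [|mn|nm']; first by move=> ?; apply: H.
    by rewrite mulrC -H 1?eq_sym//; apply: eq_Ex => x _; rewrite mulrC.
  by rewrite nm' eqxx in nm.
move=> _.
have -> : Ex (fun x => u (Y n x) * v (Y m x)) =
  Ex (fun x => (fun s a => u (nth 0%N s n) * v a) (lab Y m x) (Y m x)).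
  by apply: eq_Ex => x _; rewrite nth_lab.
rewrite (Ex_step m (fun s a => u (nth 0%N s n) * v a)) -avgZ; apply: eq_avg => a _.
rewrite -Ex_label mulrC -ExZ; last exact: label_L1.
by apply: eq_Ex => x _; rewrite nth_lab// mulrC.
Qed.

Lemma Ex_prod N (w : nat -> nat -> R) :
  Ex (fun x => \prod_(n < N) w n (Y n x)) = \prod_(n < N) avg n (w n).
Proof.
elim: N => [|N IH].
  by rewrite big_ord0 -[RHS]Ex_cst; apply: eq_Ex => x _; rewrite big_ord0.
rewrite big_ord_recr /= -IH.
have -> : Ex (fun x => \prod_(n < N.+1) w n (Y n x)) =
  Ex (fun x => (fun s a => (\prod_(n < N) w n (nth 0%N s n)) * w N a) (lab Y N x) (Y N x)).
  by apply: eq_Ex => x _; rewrite big_ord_recr/=; congr (_ * _); apply: eq_bigr => i _; rewrite nth_lab.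
rewrite (Ex_step N (fun s a => (\prod_(n < N) w n (nth 0%N s n)) * w N a)) -avgZ; apply: eq_avg => a _.
have E x : \prod_(n < N) w n (nth 0%N (lab Y N x) n) = \prod_(n < N) w n (Y n x).
  by apply: eq_bigr => i _; rewrite nth_lab.
rewrite mulrC -ExZ.
  by apply: eq_Ex => x _; rewrite mulrC E.
exact: eq_L1 (fun x _ => E x) (lab_L1 N (fun s => \prod_(n < N) w n (nth 0%N s n))).
Qed.

(* The function [a |-> dcoef n f a] of the label [Y n] is [E[f | Y n] - E f]. *)
Definition dcoef n f a : R := (2 ^ n)%:R * Ex (fun x => f x * (Y n x == a)%:R) - Ex f.

Lemma L1_ind n a f : L1 f -> L1 (fun x => f x * (Y n x == a)%:R).
Proof.
move=> f1; apply: (L1_le (g := fun x => `|f x|)); last exact: L1_norm.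
  by apply: measurable_funM; [exact: L1_meas|exact: lab_meas].
move=> x _; rewrite normrM; case: eqP => _; by rewrite ?normr1 ?normr0 ?mulr1 ?mulr0.
Qed.

Lemma L1_mul_label n (u : nat -> R) f : L1 f -> L1 (fun x => f x * u (Y n x)).
Proof.
move=> f1; apply: (@eq_L1 _ (fun x => \sum_(a < 2 ^ n) u a * (f x * (Y n x == a)%:R))).
  move=> x _; rewrite (label_split n x u) mulr_sumr; apply: eq_bigr => a _.
  by rewrite [RHS]mulrA [RHS]mulrC.
by apply: L1_sum => a _; apply: L1Z; exact: L1_ind.
Qed.

Lemma Ex_mul_label n (u : nat -> R) f : L1 f ->
  Ex (fun x => f x * u (Y n x)) = \sum_(a < 2 ^ n) u a * Ex (fun x => f x * (Y n x == a)%:R).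
Proof.
move=> f1; under eq_bigr => a _ do rewrite -(ExZ _ (L1_ind n a f1)).
rewrite -Ex_sum; last by move=> a _; apply: L1Z; exact: L1_ind.
apply: eq_Ex => x _; rewrite (label_split n x u) mulr_sumr; apply: eq_bigr => a _.
by rewrite [LHS]mulrA [LHS]mulrC.
Qed.

Lemma Ex_ind n f a : Ex (fun x => f x * (Y n x == a)%:R) = (2 ^ n)%:R^-1 * (dcoef n f a + Ex f).
Proof. by rewrite /dcoef subrK mulrA mulVf ?mul1r// two_pow_neq0. Qed.

Lemma avg_dcoef n f : L1 f -> avg n (dcoef n f) = 0.
Proof.
move=> f1; rewrite /dcoef avgB avg_cst avgZ /avg mulrA mulfV ?two_pow_neq0// mul1r.
have := Ex_mul_label n (fun=> 1) f1.
under eq_bigr do rewrite mul1r.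
by move=> <-; apply/eqP; rewrite subr_eq0; apply/eqP; apply: eq_Ex => x _; rewrite mulr1.
Qed.

Lemma Ex_mul_label_avg n (u : nat -> R) f : L1 f -> avg n u = 0 ->
  Ex (fun x => f x * u (Y n x)) = avg n (fun a => u a * dcoef n f a).
Proof.
move=> f1 u0; rewrite Ex_mul_label//.
under eq_bigr do rewrite Ex_ind mulrCA mulrDr.
rewrite -mulr_sumr; rewrite big_split/= -mulr_suml mulrDr.
by rewrite -/(avg n _) mulrA -/(avg n _) u0 mul0r addr0.
Qed.

Lemma dcoefD n f g a : L1 f -> L1 g ->
  dcoef n (fun x => f x + g x) a = dcoef n f a + dcoef n g a.
Proof.
move=> f1 g1; rewrite /dcoef ExD//.
have -> : Ex (fun x => (f x + g x) * (Y n x == a)%:R) =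
  Ex (fun x => f x * (Y n x == a)%:R) + Ex (fun x => g x * (Y n x == a)%:R).
  by rewrite -ExD; [apply: eq_Ex => x _; rewrite mulrDl|exact: L1_ind..].
by lra.
Qed.

Lemma dcoefZ n (c : R) f a : L1 f -> dcoef n (fun x => c * f x) a = c * dcoef n f a.
Proof.
move=> f1; rewrite /dcoef ExZ//.
have -> : Ex (fun x => (c * f x) * (Y n x == a)%:R) = c * Ex (fun x => f x * (Y n x == a)%:R).
  by rewrite -ExZ; [apply: eq_Ex => x _; rewrite mulrA|exact: L1_ind].
by lra.
Qed.

Lemma eq_dcoef n f g a : (forall x, I01 x -> f x = g x) -> dcoef n f a = dcoef n g a.
Proof.
move=> fg; rewrite /dcoef (eq_Ex fg); congr (_ * _ - _).
by apply: eq_Ex => x xI; rewrite fg.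
Qed.

Lemma dcoefB n f g a : L1 f -> L1 g ->
  dcoef n (fun x => f x - g x) a = dcoef n f a - dcoef n g a.
Proof.
move=> f1 g1; rewrite -mulN1r -(dcoefZ n (-1) a g1) -dcoefD//; last exact: L1Z.
by apply: eq_dcoef => x _; rewrite mulN1r.
Qed.

Lemma dcoef_sum n (I : Type) (s : seq I) (P : pred I) (F : I -> R -> R) a :
  (forall i, P i -> L1 (F i)) ->
  dcoef n (fun x => \sum_(i <- s | P i) F i x) a = \sum_(i <- s | P i) dcoef n (F i) a.
Proof.
move=> F1; rewrite /dcoef sumrB -Ex_sum// -mulr_sumr -Ex_sum; last first.
  by move=> i Pi; apply: L1_ind; exact: F1.
congr (_ * _ - _); by apply: eq_Ex => x _; rewrite mulr_suml.
Qed.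

Lemma dcoef_label n u a : (a < 2 ^ n)%N -> dcoef n (fun x => u (Y n x)) a = u a - avg n u.
Proof.
move=> an; rewrite /dcoef Ex_label; congr (_ - _).
rewrite (Ex_label n (fun b => u b * (b == a)%:R)) /avg mulrA mulfV ?two_pow_neq0// mul1r.
rewrite (bigD1 (Ordinal an))//= eqxx mulr1 big1 ?addr0// => b.
by rewrite -val_eqE/= => /negbTE ->; rewrite mulr0.
Qed.

Lemma dcoef_label_ne n m u a : n != m -> (a < 2 ^ n)%N -> dcoef n (fun x => u (Y m x)) a = 0.
Proof.
move=> nm an; rewrite /dcoef Ex_label.
have -> : Ex (fun x => u (Y m x) * (Y n x == a)%:R) = avg m u * avg n (fun b => (b == a)%:R).
  by rewrite -Ex_label2 1?eq_sym.
by rewrite avg_delta// mulrCA mulfV ?two_pow_neq0// mulr1 subrr.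
Qed.

Lemma dcoef_bound n f a : L1 f -> `|dcoef n f a| <= 2 * (2 ^ n)%:R * Ex (fun x => `|f x|).
Proof.
move=> f1; apply: le_trans (ler_normB _ _) _.
have H1 : `|Ex (fun x => f x * (Y n x == a)%:R)| <= Ex (fun x => `|f x|).
  apply: le_trans (le_norm_Ex (L1_ind n a f1)) _.
  apply: le_Ex; [exact/L1_norm/L1_ind|exact: L1_norm|] => x _.
  by rewrite normrM; case: eqP => _; rewrite ?normr1 ?normr0 ?mulr1 ?mulr0.
have H2 := le_norm_Ex f1.
have H3 : 1 <= (2 ^ n)%:R :> R by rewrite ler1n expn_gt0.
rewrite normrM ger0_norm ?ler0n//.
have H0 : 0 <= Ex (fun x => `|f x|) by exact: Ex_ge0.
have : (2 ^ n)%:R * `|Ex (fun x : R => f x * (Y n x == a)%:R)| <= (2 ^ n)%:R * Ex (fun x => `|f x|).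
  by rewrite ler_pM2l// two_pow_gt0.
have : Ex (fun x => `|f x|) <= (2 ^ n)%:R * Ex (fun x => `|f x|) by rewrite ler_peMl.
by lra.
Qed.

End OneSystem.

(** The coefficient functions come from [X] but are evaluated at [Y]: for [Y = X] a partial sum of
    the projection, in general the projection followed by the change of system. *)
Definition UN X Y N f x : R := \sum_(n < N) dcoef X n f (Y n x).

Lemma UN_lab X Y N f x : UN X Y N f x = (fun s => \sum_(n < N) dcoef X n f (nth 0%N s n)) (lab Y N x).
Proof. by apply: eq_bigr => n _; rewrite nth_lab. Qed.

Lemma UN_inLp X Y N f r : labels Y -> 0 <= r -> inLp r (UN X Y N f).
Proof.
move=> HY r0.
apply: eq_inLp (lab_inLp HY N (fun s => \sum_(n < N) dcoef X n f (nth 0%N s n)) r0) => x _.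
by rewrite UN_lab.
Qed.

Lemma dcoef_UN X Y N f n a : labels X -> labels Y -> L1 f -> (a < 2 ^ n)%N ->
  dcoef Y n (UN X Y N f) a = if (n < N)%N then dcoef X n f a else 0.
Proof.
move=> HX HY f1 an; rewrite /UN dcoef_sum//; last by move=> i _; exact: label_L1.
case: ltnP => nN.
  rewrite (bigD1 (Ordinal nN))//= dcoef_label// avg_dcoef// subr0 big1 ?addr0// => i.
  by rewrite -val_eqE/= eq_sym => ne; rewrite dcoef_label_ne.
by apply: big1 => i _; rewrite dcoef_label_ne//; apply/eqP; have := ltn_ord i; lia.
Qed.

(** The right-hand side is symmetric under exchanging [(X, f)] with [(Y, g)]; for [Y = X] this is
    self-adjointness of the partial sums. *)
Lemma Ex_UN X Y N f g : labels X -> labels Y -> L1 f -> L1 g ->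
  Ex (fun x => g x * UN X Y N f x) = \sum_(n < N) avg n (fun a => dcoef X n f a * dcoef Y n g a).
Proof.
move=> HX HY f1 g1.
under eq_bigr => n _ do rewrite -(Ex_mul_label_avg HY g1 (avg_dcoef HX n f1)).
rewrite -Ex_sum; last by move=> n _; exact: L1_mul_label.
by apply: eq_Ex => x _; rewrite mulr_sumr.
Qed.

Lemma Ex_lab_transfer X Y N F : labels X -> labels Y ->
  Ex (fun x => F (lab X N x)) = Ex (fun x => F (lab Y N x)) :> R.
Proof. by move=> HX HY; rewrite !Ex_lab. Qed.

Lemma nrm_UN X Y Z r N M f : labels X -> labels Y -> labels Z ->
  nrm r (fun x => UN X Y N f x - UN X Y M f x) = nrm r (fun x => UN X Z N f x - UN X Z M f x).
Proof.
move=> HX HY HZ; rewrite !nrmE; congr (_ `^ _).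
pose K := maxn N M.
pose F s := `|\sum_(n < N) dcoef X n f (nth 0%N s n) - \sum_(n < M) dcoef X n f (nth 0%N s n)| `^ r.
have E W x : `|UN X W N f x - UN X W M f x| `^ r = F (lab W K x).
  rewrite /F /UN; congr (`| _ - _ | `^ r); apply: eq_bigr => n _; rewrite nth_lab//.
    by apply: leq_trans (ltn_ord n) _; exact: leq_maxl.
  by apply: leq_trans (ltn_ord n) _; exact: leq_maxr.
rewrite (eq_Ex (fun x _ => E Y x)) (eq_Ex (fun x _ => E Z x)).
exact: Ex_lab_transfer.
Qed.

End Labels.

(** * Moment inequalities *)

Section Scalar.
Context {R : realType}.
Implicit Types (p q a b t x : R).

(** Multiply by [1 - x > 0]: the left side becomes at most 1 because [1 - x <= exp (- x)], and the
    right side becomes [1 + x^2 (1 - 2 x)]. *)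
Lemma expR_quad x : x <= 2^-1 -> expR x <= 1 + x + 2 * x ^+ 2.
Proof.
move=> x2; have x1 : 0 < 1 - x by lra.
have H : 1 - x <= expR (- x) by exact: expR_ge1Dx.
have E : expR x * expR (- x) = 1 by exact: expRxMexpNx_1.
have e0 := expR_gt0 x.
rewrite -(ler_pM2r x1).
apply: (@le_trans _ _ 1); first by rewrite -[leRHS]E ler_pM2l.
have -> : (1 + x + 2 * x ^+ 2) * (1 - x) = 1 + x ^+ 2 * (1 - 2 * x) by ring.
by rewrite lerDl mulr_ge0 ?sqr_ge0//; lra.
Qed.

Lemma powR_quad p t : 1 <= p -> `|t| <= (2 * p)^-1 ->
  (1 + t) `^ p <= 1 + p * t + 2 * p ^+ 2 * t ^+ 2.
Proof.
move=> p1 tp; have p0 : 0 < p by lra.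
have t2 : `|t| <= 2^-1.
  by apply: le_trans tp _; rewrite invfM ler_piMr ?invf_le1//; lra.
have t1 : 0 <= 1 + t by move: t2; rewrite ler_norml => /andP[]; lra.
apply: (@le_trans _ _ (expR (t * p))).
  rewrite expRM; apply: ge0_ler_powR; rewrite ?nnegrE ?expR_ge0//; first exact: ltW.
  exact: expR_ge1Dx.
apply: le_trans (expR_quad _) _; last by rewrite exprMn; lra.
apply: (@le_trans _ _ (`|t| * p)); first by rewrite ler_pM2r// ler_norm.
by apply: le_trans (ler_wpM2r (ltW p0) tp) _; rewrite invfM -mulrA mulVf ?mulr1// gt_eqF.
Qed.

(** The first summand serves [|t| > 1/(2p)], where both [|1 + t| ^ p] and [p |t|] are at most
    [(2 p + 1)^p |t|^p]; the second is the quadratic term for small [t]. *)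
Definition Kp p : R := 2 * (2 * p + 1) `^ p + 2 * p ^+ 2.

Lemma Kp_gt0 p : 0 < p -> 0 < Kp p.
Proof. by move=> p0; rewrite addr_gt0// mulr_gt0// ?powR_gt0 ?exprn_gt0//; lra. Qed.

Lemma powR_big p t : 1 <= p -> (2 * p)^-1 < `|t| ->
  `|1 + t| `^ p <= 1 + p * t + 2 * (2 * p + 1) `^ p * `|t| `^ p.
Proof.
move=> p1 tp; have p0 : 0 < p by lra.
have pt : 1 < 2 * p * `|t|.
  by rewrite mulrC -ltr_pdivrMr ?div1r//; lra.
have H1 : `|1 + t| `^ p <= (2 * p + 1) `^ p * `|t| `^ p.
  rewrite -powRM ?normr_ge0//; last lra.
  apply: ge0_ler_powR; rewrite ?nnegrE ?normr_ge0//; first lra.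
    by rewrite mulr_ge0//; lra.
  by apply: le_trans (ler_normD _ _) _; rewrite normr1; lra.
have H2 : p * `|t| <= (2 * p + 1) `^ p * `|t| `^ p.
  rewrite -powRM ?normr_ge0//; last lra.
  have H3 : 1 <= (2 * p + 1) * `|t| by have := normr_ge0 t; lra.
  apply: le_trans (le1r_powR H3 p1).
  by have := normr_ge0 t; nra.
have H4 : - (p * `|t|) <= p * t by rewrite -mulrN ler_pM2l// lerNl ler_normr lexx orbT.
by lra.
Qed.

Lemma one_plus_powR p t : 1 <= p ->
  `|1 + t| `^ p <= 1 + p * t + Kp p * (t ^+ 2 + `|t| `^ p).
Proof.
move=> p1; have [tp|tp] := leP `|t| (2 * p)^-1.
  have t2 : `|t| <= 2^-1.
    by apply: le_trans tp _; rewrite invfM ler_piMr ?invf_le1//; lra.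
  rewrite ger0_norm; last by move: t2; rewrite ler_norml => /andP[]; lra.
  apply: le_trans (powR_quad p1 tp) _.
  have := sqr_ge0 t; have := powR_ge0 `|t| p; have := powR_ge0 (2 * p + 1) p; have := sqr_ge0 p.
  rewrite /Kp; set A := _ `^ _; set B := `|t| `^ p; set T := t ^+ 2; set P := p ^+ 2.
  move=> *; rewrite lerD2l; nra.
apply: le_trans (powR_big p1 tp) _.
have := sqr_ge0 t; have := powR_ge0 `|t| p; have := powR_ge0 (2 * p + 1) p; have := sqr_ge0 p.
rewrite /Kp; set A := _ `^ _; set B := `|t| `^ p; set T := t ^+ 2; set P := p ^+ 2.
by move=> *; rewrite lerD2l; nra.
Qed.

(** For [p <= 2] the quadratic term is absorbed, since [t^2 <= |t|^p] when [|t| <= 1]. *)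
Lemma one_plus_powR_le2 p t : 1 <= p -> p <= 2 ->
  `|1 + t| `^ p <= 1 + p * t + Kp p * `|t| `^ p.
Proof.
move=> p1 p2; have [tp|tp] := leP `|t| (2 * p)^-1.
  have t2 : `|t| <= 2^-1.
    by apply: le_trans tp _; rewrite invfM ler_piMr ?invf_le1//; lra.
  rewrite ger0_norm; last by move: t2; rewrite ler_norml => /andP[]; lra.
  apply: le_trans (powR_quad p1 tp) _.
  have tt : t ^+ 2 <= `|t| `^ p.
    have [->|t0] := eqVneq t 0; first by rewrite expr0n/= powR_ge0.
    rewrite -normr_id -real_normK ?num_real// normr_id -powR_mulrn//; apply: ger_powR => //.
    by rewrite normr_gt0 t0/=; lra.
  have := sqr_ge0 t; have := powR_ge0 `|t| p; have := powR_ge0 (2 * p + 1) p; have := sqr_ge0 p.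
  move: tt; rewrite /Kp; set A := _ `^ _; set B := `|t| `^ p; set T := t ^+ 2; set P := p ^+ 2.
  by move=> *; rewrite lerD2l; nra.
apply: le_trans (powR_big p1 tp) _.
have := sqr_ge0 t; have := powR_ge0 `|t| p; have := powR_ge0 (2 * p + 1) p; have := sqr_ge0 p.
rewrite /Kp; set A := _ `^ _; set B := `|t| `^ p; set T := t ^+ 2; set P := p ^+ 2.
by move=> *; rewrite lerD2l; nra.
Qed.

(** The signed power of order [p - 1]: the derivative of [|a| ^ p] divided by [p], and the duality
    map of L_p into L_q. The factor [a] gives the value 0 at 0, also for [p < 2]. *)
Definition phi p a : R := a * `|a| `^ (p - 2).

Lemma powR_sq p a : p != 0 -> a ^+ 2 * `|a| `^ (p - 2) = `|a| `^ p.
Proof.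
move=> p0; have [->|a0] := eqVneq a 0.
  by rewrite expr0n/= mul0r normr0 powR0.
rewrite -real_normK ?num_real// -powR_mulrn// -powRD; last by rewrite normr_eq0 a0 implybT.
by congr (_ `^ _); lra.
Qed.

Lemma mul_phi p a : p != 0 -> a * phi p a = `|a| `^ p.
Proof. by move=> p0; rewrite /phi mulrA -expr2 powR_sq. Qed.

Lemma norm_phi p a : 1 < p -> `|phi p a| = `|a| `^ (p - 1).
Proof.
move=> p1; rewrite /phi normrM [X in _ * X]ger0_norm ?powR_ge0//.
have [->|a0] := eqVneq a 0; first by rewrite normr0 mul0r powR0//; lra.
rewrite -{1}(@powRr1 _ `|a|)// -powRD; last by rewrite normr_eq0 a0 implybT.
by congr (_ `^ _); lra.
Qed.

Lemma norm_phi_pow p q a : 1 < p -> p^-1 + q^-1 = 1 -> `|phi p a| `^ q = `|a| `^ p.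
Proof.
move=> p1 pq; rewrite norm_phi// -powRrM; congr (_ `^ _).
have q0 : q != 0.
  apply/eqP => q0; move: pq; rewrite q0 invr0 addr0 => /eqP.
  by rewrite invr_eq1 => /eqP pE; move: p1; rewrite pE ltxx.
have p0 : p != 0 by lra.
have : p * q * (p^-1 + q^-1) = p * q by rewrite pq mulr1.
have -> : p * q * (p^-1 + q^-1) = q + p by field; rewrite p0 q0.
by lra.
Qed.

(** [one_plus_powR] at [t = b / a], made homogeneous. The term linear in [b] is kept apart because
    it has expectation 0 when [b] is a new independent mean zero summand. *)
Lemma pow_add_ge2 p a b : 2 <= p ->
  `|a + b| `^ p <= `|a| `^ p + p * (b * phi p a) + Kp p * (b ^+ 2 * `|a| `^ (p - 2) + `|b| `^ p).
Proof.
move=> p2; have p1 : 1 <= p by lra. have p0 : p != 0 by lra.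
have K0 : 0 < Kp p by apply: Kp_gt0; lra.
have K1 : 1 <= Kp p.
  rewrite /Kp; have := powR_ge0 (2 * p + 1) p; nra.
have [->|a0] := eqVneq a 0.
  rewrite add0r /phi mul0r mulr0 mulr0 addr0 normr0.
  have := powR_ge0 (0 : R) p; have := powR_ge0 `|b| p; have : 0 <= b ^+ 2 * (0 : R) `^ (p - 2).
    by rewrite mulr_ge0 ?sqr_ge0 ?powR_ge0.
  by set A := _ ^+ 2 * _; set B := `|b| `^ _; set C := 0 `^ _; nra.
have ab : a + b = a * (1 + b / a) by field.
have := one_plus_powR (b / a) p1 => H.
have Ap : 0 < `|a| `^ p by rewrite powR_gt0 ?normr_gt0.
rewrite ab normrM powRM//.
apply: le_trans (ler_wpM2l (ltW Ap) H) _; rewrite le_eqVlt; apply/orP; left; apply/eqP.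
have E1 : `|a| `^ p * (b / a) ^+ 2 = b ^+ 2 * `|a| `^ (p - 2).
  by rewrite -(powR_sq a p0); field.
have E2 : `|a| `^ p * `|b / a| `^ p = `|b| `^ p.
  by rewrite -powRM// -normrM; congr (`| _ | `^ _); field.
have E3 : `|a| `^ p * (b / a) = b * phi p a.
  by rewrite -(mul_phi a p0); field.
rewrite -E1 -E2 -E3; ring.
Qed.

Lemma pow_add_le2 p a b : 1 < p -> p <= 2 ->
  `|a + b| `^ p <= `|a| `^ p + p * (b * phi p a) + Kp p * `|b| `^ p.
Proof.
move=> p1' p2; have p1 : 1 <= p by lra. have p0 : p != 0 by lra.
have K1 : 1 <= Kp p.
  rewrite /Kp; have := powR_ge0 (2 * p + 1) p; nra.
have [->|a0] := eqVneq a 0.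
  rewrite add0r /phi mul0r mulr0 mulr0 addr0 normr0.
  have := powR_ge0 (0 : R) p; have := powR_ge0 `|b| p.
  by set B := `|b| `^ _; set C := 0 `^ _; nra.
have ab : a + b = a * (1 + b / a) by field.
have := one_plus_powR_le2 (b / a) p1 p2 => H.
have Ap : 0 < `|a| `^ p by rewrite powR_gt0 ?normr_gt0.
rewrite ab normrM powRM//.
apply: le_trans (ler_wpM2l (ltW Ap) H) _; rewrite le_eqVlt; apply/orP; left; apply/eqP.
have E2 : `|a| `^ p * `|b / a| `^ p = `|b| `^ p.
  by rewrite -powRM// -normrM; congr (`| _ | `^ _); field.
have E3 : `|a| `^ p * (b / a) = b * phi p a.
  by rewrite -(mul_phi a p0); field.
rewrite -E2 -E3; ring.
Qed.

Lemma pow_add_le p a b : 0 <= p -> `|a + b| `^ p <= 2 `^ p * (`|a| `^ p + `|b| `^ p).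
Proof.
move=> p0; pose m := Num.max `|a| `|b|.
have m0 : 0 <= m by rewrite le_max normr_ge0.
apply: (@le_trans _ _ ((2 * m) `^ p)).
  apply: ge0_ler_powR; rewrite ?nnegrE//; first by rewrite mulr_ge0.
  apply: le_trans (ler_normD _ _) _.
  have : `|a| <= m by rewrite le_max lexx.
  have : `|b| <= m by rewrite le_max lexx orbT.
  by lra.
rewrite powRM// ler_wpM2l ?powR_ge0// /m.
have := powR_ge0 `|a| p; have := powR_ge0 `|b| p.
by case: (leP `|a| `|b|) => _; lra.
Qed.

End Scalar.

(** * Sums of independent mean zero label functions *)

Section IndepSums.
Context {R : realType}.
Implicit Types (f g : R -> R) (p q r : R).
Variable Y : nat -> R -> nat.
Hypothesis HY : labels Y.

Definition Ssum (u : nat -> nat -> R) N x : R := \sum_(n < N) u n (Y n x).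
Definition Sseq (u : nat -> nat -> R) N (s : seq nat) : R := \sum_(n < N) u n (nth 0%N s n).

Lemma SsumE u N x : Ssum u N x = Sseq u N (lab Y N x).
Proof. by apply: eq_bigr => n _; rewrite nth_lab. Qed.

Lemma SsumS u N x : Ssum u N.+1 x = Ssum u N x + u N (Y N x).
Proof. by rewrite /Ssum big_ord_recr. Qed.

Lemma Ex_factor N (v : nat -> R) F :
  Ex (fun x => v (Y N x) * F (lab Y N x)) = avg N v * Ex (fun x => F (lab Y N x)).
Proof.
rewrite (Ex_step HY N (fun s a => v a * F s)) -avgZr; apply: eq_avg => a _.
by rewrite ExZ//; exact: lab_L1.
Qed.

Lemma step_L1 N (v : nat -> R) F : L1 (fun x => v (Y N x) * F (lab Y N x)).
Proof.
apply: eq_L1 (lab_L1 HY N.+1 (fun s => v (nth 0%N s N) * F (take N s))) => x _.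
by rewrite nth_lab// take_lab.
Qed.

Lemma Ssum_powL1 u N p : L1 (fun x => `|Ssum u N x| `^ p).
Proof.
apply: eq_L1 (lab_L1 HY N (fun s => `|Sseq u N s| `^ p)) => x _; by rewrite SsumE.
Qed.

Lemma Ssum_inLp u N p : 0 <= p -> inLp p (Ssum u N).
Proof.
move=> p0; apply: eq_inLp (lab_inLp HY N (Sseq u N) p0) => x _; by rewrite SsumE.
Qed.

Lemma Ssum0 u x : Ssum u 0 x = 0.
Proof. by rewrite /Ssum big_ord0. Qed.

(** Induction on the number of summands: in the expansion by [pow_add_le2] the linear term is the
    new mean zero summand times a function of the earlier labels, so its expectation is 0. *)
Lemma vonBahrEsseen u N q : 1 < q -> q <= 2 -> (forall n, avg n (u n) = 0) ->
  Ex (fun x => `|Ssum u N x| `^ q) <= Kp q * \sum_(n < N) avg n (fun a => `|u n a| `^ q).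
Proof.
move=> q1 q2 u0; elim: N => [|N IH].
  rewrite big_ord0 mulr0 -[leRHS]Ex_cst le_eqVlt; apply/orP; left; apply/eqP.
  by apply: eq_Ex => x _; rewrite Ssum0 normr0 powR0//; lra.
rewrite big_ord_recr/= mulrDr.
pose G x := `|Ssum u N x| `^ q + q * (u N (Y N x) * phi q (Ssum u N x)) + Kp q * `|u N (Y N x)| `^ q.
have E1 x : u N (Y N x) * phi q (Ssum u N x) = u N (Y N x) * (fun s => phi q (Sseq u N s)) (lab Y N x).
  by rewrite SsumE.
have L1a : L1 (fun x => u N (Y N x) * phi q (Ssum u N x)).
  by apply: eq_L1 (fun x _ => esym (E1 x)) (step_L1 N (u N) (fun s => phi q (Sseq u N s))).
have L1b : L1 (fun x => `|u N (Y N x)| `^ q) by exact: (label_L1 HY N (fun a => `|u N a| `^ q)).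
have L1G : L1 G by apply: L1D; [apply: L1D; [exact: Ssum_powL1|exact: L1Z]|exact: L1Z].
apply: (@le_trans _ _ (Ex G)).
  apply: le_Ex => //; first exact: Ssum_powL1.
  by move=> x _; rewrite SsumS; exact: pow_add_le2.
rewrite /G ExD; [|by apply: L1D; [exact: Ssum_powL1|exact: L1Z]|exact: L1Z].
rewrite ExD; [|exact: Ssum_powL1|exact: L1Z].
rewrite !ExZ// (eq_Ex (fun x _ => E1 x)) (Ex_factor N (u N) (fun s => phi q (Sseq u N s))) u0 mul0r mulr0 addr0.
by rewrite (Ex_label HY N (fun a => `|u N a| `^ q)) lerD2r.
Qed.

Lemma Rosenthal_step u N p : 2 <= p -> (forall n, avg n (u n) = 0) ->
  Ex (fun x => `|Ssum u N x| `^ p) <=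
  Kp p * \sum_(n < N) (avg n (fun a => u n a ^+ 2) * Ex (fun x => `|Ssum u n x| `^ (p - 2)) +
                       avg n (fun a => `|u n a| `^ p)).
Proof.
move=> p2 u0; elim: N => [|N IH].
  rewrite big_ord0 mulr0 -[leRHS]Ex_cst le_eqVlt; apply/orP; left; apply/eqP.
  by apply: eq_Ex => x _; rewrite Ssum0 normr0 powR0//; lra.
rewrite big_ord_recr/= mulrDr.
pose H x := u N (Y N x) ^+ 2 * `|Ssum u N x| `^ (p - 2) + `|u N (Y N x)| `^ p.
pose G x := `|Ssum u N x| `^ p + p * (u N (Y N x) * phi p (Ssum u N x)) + Kp p * H x.
have E1 x : u N (Y N x) * phi p (Ssum u N x) = u N (Y N x) * (fun s => phi p (Sseq u N s)) (lab Y N x).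
  by rewrite SsumE.
have E2 x : u N (Y N x) ^+ 2 * `|Ssum u N x| `^ (p - 2) =
  (fun a => u N a ^+ 2) (Y N x) * (fun s => `|Sseq u N s| `^ (p - 2)) (lab Y N x).
  by rewrite SsumE.
have L1a : L1 (fun x => u N (Y N x) * phi p (Ssum u N x)).
  by apply: eq_L1 (fun x _ => esym (E1 x)) (step_L1 N (u N) (fun s => phi p (Sseq u N s))).
have L1c : L1 (fun x => u N (Y N x) ^+ 2 * `|Ssum u N x| `^ (p - 2)).
  by apply: eq_L1 (fun x _ => esym (E2 x)) (step_L1 N (fun a => u N a ^+ 2) (fun s => `|Sseq u N s| `^ (p - 2))).
have L1b : L1 (fun x => `|u N (Y N x)| `^ p) by exact: (label_L1 HY N (fun a => `|u N a| `^ p)).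
have L1H : L1 H by exact: L1D.
have L1G : L1 G by apply: L1D; [apply: L1D; [exact: Ssum_powL1|exact: L1Z]|exact: L1Z].
apply: (@le_trans _ _ (Ex G)).
  apply: le_Ex => //; first exact: Ssum_powL1.
  by move=> x _; rewrite SsumS; exact: pow_add_ge2.
rewrite /G ExD; [|by apply: L1D; [exact: Ssum_powL1|exact: L1Z]|exact: L1Z].
rewrite ExD; [|exact: Ssum_powL1|exact: L1Z].
rewrite !ExZ// (eq_Ex (fun x _ => E1 x)) (Ex_factor N (u N) (fun s => phi p (Sseq u N s))) u0 mul0r mulr0 addr0.
rewrite /H ExD// (eq_Ex (fun x _ => E2 x)) (Ex_factor N (fun a => u N a ^+ 2) (fun s => `|Sseq u N s| `^ (p - 2))).
rewrite (Ex_label HY N (fun a => `|u N a| `^ p)).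
have -> : Ex (fun x => `|Sseq u N (lab Y N x)| `^ (p - 2)) = Ex (fun x => `|Ssum u N x| `^ (p - 2)).
  by apply: eq_Ex => x _; rewrite SsumE.
by rewrite lerD2r.
Qed.

Lemma argmax_nat (E : nat -> R) N : exists2 M, (M <= N)%N & forall n, (n <= N)%N -> E n <= E M.
Proof.
elim: N => [|N [M MN H]]; first by exists 0%N => // n; rewrite leqn0 => /eqP ->.
case: (leP (E M) (E N.+1)) => EM.
  exists N.+1 => // n; rewrite leq_eqVlt => /orP[/eqP ->//|nN].
  by apply: le_trans EM; apply: H.
exists M; first lia.
by move=> n; rewrite leq_eqVlt => /orP[/eqP ->|nN]; [exact: ltW|exact: H].
Qed.

Lemma avg_ge0 n F : (forall a, (a < 2 ^ n)%N -> 0 <= F a) -> 0 <= avg n F :> R.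
Proof. by move=> F0; rewrite -(avg_cst n 0); exact: le_avg. Qed.

(** Either [W <= 2 k B], or the first term carries at least half of [W], and dividing by
    [W ^ ((p - 2) / p)] leaves [W ^ (2 / p) <= 2 k A]. *)
Lemma self_bound (W A B k p : R) : 2 <= p -> 0 <= W -> 0 <= A -> 0 <= B -> 0 < k ->
  W <= k * (A * W `^ ((p - 2) / p) + B) -> W <= (2 * k * A) `^ (p / 2) + 2 * k * B.
Proof.
move=> p2 W0 A0 B0 k0 H; have p0 : 0 < p by lra.
have [BW|BW] := leP W (2 * k * B); first by have := powR_ge0 (2 * k * A) (p / 2); lra.
have Wp : 0 < W by apply: le_lt_trans BW; rewrite !mulr_ge0//; lra.
have H1 : W <= (2 * k * A) * W `^ ((p - 2) / p).
  have := powR_ge0 W ((p - 2) / p); move: H BW; set V := W `^ _; nra.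
have WE : W = W `^ (2 / p) * W `^ ((p - 2) / p).
  rewrite -powRD; last by rewrite (gt_eqF Wp) implybT.
  by rewrite -mulrDl (_ : 2 + (p - 2) = p) ?mulfV ?powRr1//; lra.
have V0 : 0 < W `^ ((p - 2) / p) by rewrite powR_gt0.
have H2 : W `^ (2 / p) <= 2 * k * A by rewrite -(ler_pM2r V0) -WE.
have -> : W = (W `^ (2 / p)) `^ (p / 2).
  by rewrite -powRrM (_ : 2 / p * (p / 2) = 1) ?powRr1//; field; lra.
apply: (@le_trans _ _ ((2 * k * A) `^ (p / 2))).
  apply: ge0_ler_powR => //; first by rewrite divr_ge0//; lra.
  - by rewrite nnegrE powR_ge0.
  - by rewrite nnegrE !mulr_ge0//; lra.
by rewrite lerDl !mulr_ge0//; lra.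
Qed.

(** Taking the partial sum with the largest p-th moment lets Jensen bound every moment of order
    [p - 2] in [Rosenthal_step] by a power of that one moment; [self_bound] then solves for it. *)
Lemma Rosenthal u N p : 2 <= p -> (forall n, avg n (u n) = 0) ->
  Ex (fun x => `|Ssum u N x| `^ p) <=
  (2 * Kp p * \sum_(n < N) avg n (fun a => u n a ^+ 2)) `^ (p / 2) +
  2 * Kp p * \sum_(n < N) avg n (fun a => `|u n a| `^ p).
Proof.
move=> p2 u0; have p0 : 0 < p by lra.
pose E n := Ex (fun x => `|Ssum u n x| `^ p).
have [M MN HM] := argmax_nat E N.
apply: le_trans (HM _ (leqnn N)) _.
have A0 n : 0 <= avg n (fun a => u n a ^+ 2) by apply: avg_ge0 => a _; exact: sqr_ge0.
have B0 n : 0 <= avg n (fun a => `|u n a| `^ p) by apply: avg_ge0 => a _; exact: powR_ge0.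
have E0 : 0 <= E M by exact: Expow_ge0.
have K0 := Kp_gt0 p0.
apply: self_bound => //; [exact: sumr_ge0|exact: sumr_ge0|].
apply: le_trans (Rosenthal_step M p2 u0) _.
rewrite ler_pM2l// mulr_suml -big_split/=.
have Q n : 0 <= Ex (fun x => `|Ssum u n x| `^ (p - 2)) by exact: Expow_ge0.
apply: (@le_trans _ _ (\sum_(n < N) (avg n (fun a => u n a ^+ 2) * Ex (fun x => `|Ssum u n x| `^ (p - 2)) +
                       avg n (fun a => `|u n a| `^ p)))).
  rewrite -!(big_mkord xpredT (fun n => avg n (fun a => u n a ^+ 2) * Ex (fun x => `|Ssum u n x| `^ (p - 2)) +
                       avg n (fun a => `|u n a| `^ p))).
  rewrite [leRHS](big_cat_nat (n := M))//= lerDl sumr_ge0// => n _.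
  by rewrite addr_ge0// mulr_ge0.
apply: ler_sum => n _; rewrite lerD2r ler_wpM2l//.
have EnM : E n <= E M by apply: HM; exact: ltnW.
apply: (@le_trans _ _ (E n `^ ((p - 2) / p))); last first.
  apply: ge0_ler_powR => //; first by rewrite divr_ge0//; lra.
  by rewrite nnegrE Expow_ge0.
(* For [p = 2] the exponent [p - 2] is 0, outside the range of Jensen's inequality; both sides are
   then 1. *)
move: p2; rewrite le_eqVlt => /orP[/eqP p2|p2].
  rewrite (_ : p - 2 = 0) ?mul0r ?powRr0; last lra.
  by rewrite -[leRHS]Ex_cst le_eqVlt; apply/orP; left; apply/eqP; apply: eq_Ex => x _; rewrite powRr0.
have [_ J] := @Ex_jensen R (p - 2) p (Ssum u n) ltac:(lra) ltac:(lra) (Ssum_inLp u n (ltW p0)).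
exact: J.
Qed.

Lemma avg_pow_centered n (v : nat -> R) q : 1 <= q ->
  avg n (fun a => `|v a - avg n v| `^ q) <= 2 `^ q * 2 * avg n (fun a => `|v a| `^ q).
Proof.
move=> q1; have q0 : 0 <= q by lra.
apply: (@le_trans _ _ (avg n (fun a => 2 `^ q * (`|v a| `^ q + `|avg n v| `^ q)))).
  by apply: le_avg => a _; have := pow_add_le (v a) (- avg n v) q0; rewrite normrN.
rewrite avgZ avgD avg_cst -mulrA ler_wpM2l ?powR_ge0//.
suff : `|avg n v| `^ q <= avg n (fun a => `|v a| `^ q) by lra.
rewrite -(Ex_label HY n v) -(Ex_label HY n (fun a => `|v a| `^ q)).
have vq : inLp q (fun x => v (Y n x)).
  by apply: eq_inLp (lab_inLp HY n.+1 (fun s => v (nth 0%N s n)) q0) => x _; rewrite nth_lab.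
rewrite -(@nrm_powR R q (fun x => v (Y n x))); last lra.
apply: ge0_ler_powR; rewrite ?nnegrE ?nrm_ge0//.
apply: le_trans (le_norm_Ex (inL1 q1 vq)) _; exact: Ex_le_nrm.
Qed.

Lemma conj_gt1 p q : 1 < p -> p^-1 + q^-1 = 1 -> 1 < q.
Proof.
move=> p1 pq; have p0 : 0 < p by lra.
have qi : q^-1 = 1 - p^-1 by lra.
have pi : 0 < p^-1 < 1 by rewrite invr_gt0 p0 invf_lt1.
have q0 : 0 < q by rewrite -invr_gt0 qi; lra.
by rewrite -[q]invrK qi invf_gt1; lra.
Qed.

Lemma avg_mulB n (v w : nat -> R) : avg n v = 0 ->
  avg n (fun a => v a * (w a - avg n w)) = avg n (fun a => v a * w a).
Proof.
move=> v0; rewrite -[RHS]subr0 -[in RHS](mul0r (avg n w)) -v0 -avgZr -avgB.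
by apply: eq_avg => a _; rewrite mulrBr.
Qed.

Lemma le_conj_root (B K F p q : R) : 0 <= B -> 0 <= K -> 0 <= F -> 1 < p -> p^-1 + q^-1 = 1 ->
  B <= F * (K * B) `^ q^-1 -> B <= K `^ (p / q) * F `^ p.
Proof.
move=> B0 K0 F0 p1 pq H; have p0 : 0 < p by lra.
have [->|Bn0] := eqVneq B 0; first by rewrite mulr_ge0 ?powR_ge0.
have Bp : 0 < B by rewrite lt_neqAle eq_sym Bn0.
have V0 : 0 < B `^ q^-1 by rewrite powR_gt0.
have BE : B = B `^ p^-1 * B `^ q^-1.
  by rewrite -powRD ?pq ?powRr1// oner_eq0.
have H1 : B `^ p^-1 <= F * K `^ q^-1.
  by rewrite -(ler_pM2r V0) -BE -mulrA -powRM.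
have -> : B = (B `^ p^-1) `^ p by rewrite -powRrM mulVf ?powRr1//; lra.
rewrite [p / q]mulrC powRrM mulrC -powRM ?powR_ge0//.
apply: ge0_ler_powR; rewrite ?nnegrE ?powR_ge0 ?(ltW p0)//.
by rewrite mulr_ge0 ?powR_ge0.
Qed.

(** [2 ^ q * 2] is the cost of centring the dual test function; the exponent [p / q] comes from
    solving the resulting inequality for the block sum. *)
Definition Bconst p q : R := (Kp q * (2 `^ q * 2)) `^ (p / q).

(** Duality: [f] is paired with the sum of the centred images [psi n] of its blocks under [phi p].
    The pairing equals the left side [B], while von Bahr-Esseen, applicable as [q <= 2], bounds the
    L_q norm of the test function by a multiple of [B ^ (1 / q)]. *)
Lemma block_pow_bound p q f N : 2 <= p -> p^-1 + q^-1 = 1 -> inLp p f ->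
  \sum_(n < N) avg n (fun a => `|dcoef Y n f a| `^ p) <= Bconst p q * nrm p f `^ p.
Proof.
move=> p2 pq fp; have p1 : 1 < p by lra. have p0 : 0 < p by lra.
have q1 := conj_gt1 p1 pq.
have q0 : 0 < q by lra.
have q2 : q <= 2.
  have qi : q^-1 = 1 - p^-1 by lra.
  rewrite -(invrK q) -(invrK 2) lef_pV2 ?posrE ?invr_gt0// qi.
  have : p^-1 <= 2^-1 by rewrite lef_pV2 ?posrE.
  by lra.
have f1 : L1 f by apply: inL1 fp; exact: ltW.
set d := fun n => dcoef Y n f.
set B := \sum_(n < N) _.
pose psi n a := phi p (d n a).
pose g n a := psi n a - avg n (psi n).
have g0 n : avg n (g n) = 0 by rewrite avgB avg_cst subrr.
have d0 n : avg n (d n) = 0 by exact: avg_dcoef.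
have BE : B = Ex (fun x => f x * Ssum g N x).
  have -> : Ex (fun x => f x * Ssum g N x) = \sum_(n < N) Ex (fun x => f x * g n (Y n x)).
    rewrite -Ex_sum; last by move=> n _; exact: L1_mul_label.
    by apply: eq_Ex => x _; rewrite mulr_sumr.
  apply: eq_bigr => n _; rewrite (Ex_mul_label_avg HY f1 (g0 n)).
  rewrite -/(d n); under [RHS]eq_avg do rewrite mulrC.
  rewrite /g avg_mulB//; apply: eq_avg => a _; rewrite /psi mul_phi//; lra.
have GB : Ex (fun x => `|Ssum g N x| `^ q) <= Kp q * (2 `^ q * 2) * B.
  apply: le_trans (vonBahrEsseen N q1 q2 g0) _.
  rewrite -mulrA ler_pM2l ?Kp_gt0// mulr_sumr; apply: ler_sum => n _.
  apply: le_trans (avg_pow_centered n (psi n) (ltW q1)) _; rewrite ler_wpM2l ?mulr_ge0 ?powR_ge0//.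
  by rewrite le_eqVlt; apply/orP; left; apply/eqP; apply: eq_avg => a _; exact: norm_phi_pow.
have B0 : 0 <= B by apply: sumr_ge0 => n _; apply: avg_ge0 => a _; exact: powR_ge0.
apply: le_conj_root => //.
- by rewrite mulr_ge0 ?mulr_ge0 ?powR_ge0// ltW// Kp_gt0.
- exact: nrm_ge0.
rewrite {1}BE; apply: le_trans (ler_norm _) _.
have [H1 H2] := hoelderE p0 q0 pq fp (Ssum_inLp g N (ltW q0)).
apply: le_trans (le_norm_Ex H1) _; apply: le_trans H2 _.
rewrite ler_wpM2l ?nrm_ge0// nrmE; apply: ge0_ler_powR; rewrite ?nnegrE ?invr_ge0 ?Expow_ge0 ?(ltW q0)//.
by rewrite !mulr_ge0 ?powR_ge0// ltW// Kp_gt0.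
Qed.

End IndepSums.

(** * Projections onto spans of label functions *)

Section Projections.
Context {R : realType}.
Local Notation I01 := (@I01 R).
Implicit Types (f g : R -> R) (p q r : R) (X Y Z : nat -> R -> nat).

Lemma UN_Ssum X Y N f : UN X Y N f = Ssum Y (fun n => dcoef X n f) N.
Proof. by []. Qed.

Lemma powR2 (x : R) : `|x| `^ 2 = x ^+ 2.
Proof. by rewrite powR_mulrn// real_normK ?num_real. Qed.

Lemma half_conj : 2^-1 + 2^-1 = 1 :> R.
Proof. by lra. Qed.

Lemma conj_exp p : 1 < p -> p^-1 + (p / (p - 1))^-1 = 1.
Proof. by move=> p1; rewrite invf_div; field; lra. Qed.

Lemma square_bound Y f p N : labels Y -> 2 <= p -> inLp p f ->
  \sum_(n < N) avg n (fun a => dcoef Y n f a ^+ 2) <= Bconst 2 2 * nrm p f `^ 2.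
Proof.
move=> HY p2 fp; have [f2 fn] := nrm_mono (ler1n R 2) p2 fp.
have := block_pow_bound HY N (lexx 2) half_conj f2.
under eq_bigr do under eq_avg do rewrite powR2.
move=> H; apply: le_trans H _; rewrite ler_wpM2l ?powR_ge0//.
by apply: ge0_ler_powR; rewrite ?nnegrE ?nrm_ge0.
Qed.

Lemma nrm_le_of_pow p f (e : R) : 0 < p -> 0 <= e -> Ex (fun x => `|f x| `^ p) <= e `^ p -> nrm p f <= e.
Proof.
move=> p0 e0 H; rewrite nrmE -[leRHS]powRr1// -(mulfV (lt0r_neq0 p0)) powRrM.
by apply: ge0_ler_powR; rewrite ?nnegrE ?invr_ge0 ?powR_ge0 ?Expow_ge0// ltW.
Qed.

Lemma PN_bound_ge2 Y p : labels Y -> 2 <= p ->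
  exists C : R, 0 <= C /\ forall f N, inLp p f -> nrm p (UN Y Y N f) <= C * nrm p f.
Proof.
move=> HY p2; have p1 : 1 < p by lra. have p0 : 0 < p by lra.
pose q := p / (p - 1); have pq := conj_exp p1.
pose C0 := (2 * Kp p * Bconst 2 2) `^ (p / 2) + 2 * Kp p * Bconst p q.
have K0 := Kp_gt0 p0.
have B0 (a b : R) : 0 <= Bconst a b by exact: powR_ge0.
have C00 : 0 <= C0 by rewrite addr_ge0 ?powR_ge0// !mulr_ge0// ltW.
exists (C0 `^ p^-1); split; first exact: powR_ge0.
move=> f N fp; set F := nrm p f; have F0 : 0 <= F by exact: nrm_ge0.
apply: nrm_le_of_pow => //; first by rewrite mulr_ge0// powR_ge0.
rewrite powRM ?powR_ge0// -powRrM mulVf ?(lt0r_neq0 p0)// powRr1//.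
have f1 : L1 f by apply: inL1 fp; exact: ltW.
rewrite UN_Ssum; apply: le_trans (Rosenthal HY N p2 (fun n => avg_dcoef HY n f1)) _.
rewrite /C0 [leRHS]mulrDl lerD//; last first.
  by rewrite -[leRHS]mulrA ler_pM2l ?mulr_gt0//; exact: block_pow_bound.
have -> : F `^ p = (F `^ 2) `^ (p / 2) by rewrite -powRrM; congr (_ `^ _); field.
rewrite -powRM ?powR_ge0//; last by rewrite !mulr_ge0// ltW.
apply: ge0_ler_powR.
- by rewrite divr_ge0// ltW.
- rewrite nnegrE !mulr_ge0//; first exact: ltW.
  by apply: sumr_ge0 => n _; apply: avg_ge0 => a _; exact: sqr_ge0.
- by rewrite nnegrE !mulr_ge0 ?powR_ge0// ltW.
- by rewrite -[leRHS]mulrA ler_pM2l ?mulr_gt0//; exact: square_bound.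
Qed.

Lemma nd_bounded_cauchy (s : nat -> R) (C e : R) : (forall m n, (m <= n)%N -> s m <= s n) ->
  (forall n, s n <= C) -> 0 < e ->
  exists N, forall m n, (N <= m)%N -> (m <= n)%N -> s n - s m <= e.
Proof.
move=> nd sC e0; pose A := range s.
have A0 : has_sup A by split; [exists (s 0%N); exists 0%N|exists C => _ [n _ <-]].
have [_ [N _ <-] H] := sup_adherent e0 A0.
exists N => m n Nm mn.
have H1 : s n <= sup A by apply: sup_upper_bound => //; exists n.
have := nd _ _ Nm; lra.
Qed.

(** The piece between [M] and [N] is again an independent sum, and its Rosenthal bound involves only
    increments of two bounded nondecreasing sums. *)
Lemma PN_cauchy_ge2 Y p f (e : R) : labels Y -> 2 <= p -> inLp p f -> 0 < e ->
  exists N0, forall M N, (N0 <= M)%N -> (M <= N)%N ->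
    nrm p (fun x => UN Y Y N f x - UN Y Y M f x) <= e.
Proof.
move=> HY p2 fp e0; have p1 : 1 < p by lra. have p0 : 0 < p by lra.
pose q := p / (p - 1); have pq := conj_exp p1.
have K0 := Kp_gt0 p0.
have f1 : L1 f by apply: inL1 fp; exact: ltW.
pose sA N := \sum_(n < N) avg n (fun a => dcoef Y n f a ^+ 2).
pose sB N := \sum_(n < N) avg n (fun a => `|dcoef Y n f a| `^ p).
have ndg (F : nat -> R) : (forall n, 0 <= F n) -> forall m n, (m <= n)%N -> \sum_(i < m) F i <= \sum_(i < n) F i.
  move=> F0 m n mn; rewrite -!(big_mkord xpredT F) [leRHS](big_cat_nat (n := m))//=.
  by rewrite lerDl sumr_ge0.
have A0 n : 0 <= avg n (fun a => dcoef Y n f a ^+ 2) by apply: avg_ge0 => a _; exact: sqr_ge0.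
have B0 n : 0 <= avg n (fun a => `|dcoef Y n f a| `^ p) by apply: avg_ge0 => a _; exact: powR_ge0.
(* Chosen so that each of the two terms of Rosenthal's bound is at most [e ^ p / 2]. *)
pose d1 := (e `^ p / 2) `^ (2 / p) / (2 * Kp p).
pose d2 := e `^ p / 2 / (2 * Kp p).
have ep : 0 < e `^ p / 2 by rewrite divr_gt0 ?powR_gt0.
have d10 : 0 < d1 by rewrite divr_gt0 ?powR_gt0// mulr_gt0.
have d20 : 0 < d2 by rewrite divr_gt0// mulr_gt0.
have [N1 H1] := nd_bounded_cauchy (ndg _ A0) (fun N => square_bound N HY p2 fp) d10.
have [N2 H2] := nd_bounded_cauchy (ndg _ B0) (fun N => block_pow_bound HY N p2 pq fp) d20.
exists (maxn N1 N2) => M N; rewrite geq_max => /andP[M1 M2] MN.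
pose u n a := if (n < M)%N then 0 else dcoef Y n f a.
have u0 n : avg n (u n) = 0.
  by rewrite /u; case: ltnP => _; [rewrite avg_cst|exact: avg_dcoef].
have split_sum (F G : nat -> R) : (forall n, (M <= n)%N -> G n = F n) -> (forall n, (n < M)%N -> G n = 0) ->
    \sum_(n < N) G n = \sum_(n < N) F n - \sum_(n < M) F n.
  move=> GF G0; rewrite -!(big_mkord xpredT) !(big_cat_nat (n := M) (m := 0%N) (p := N))//=.
  rewrite addrAC subrr add0r [X in X + _]big1_seq ?add0r; last first.
    by move=> n; rewrite mem_index_iota => /andP[_ /andP[_ nM]]; exact: G0.
  by apply: eq_big_nat => n /andP[Mn _]; exact: GF.
apply: nrm_le_of_pow => //; first exact: ltW.
have -> : Ex (fun x => `|UN Y Y N f x - UN Y Y M f x| `^ p) = Ex (fun x => `|Ssum Y u N x| `^ p).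
  apply: eq_Ex => x _; congr (`| _ | `^ p).
  rewrite /UN /Ssum (split_sum (fun n => dcoef Y n f (Y n x)) (fun n => u n (Y n x)))// => n nM.
    by rewrite /u ltnNge nM.
  by rewrite /u nM.
apply: le_trans (Rosenthal HY N p2 u0) _.
rewrite (split_sum (fun n => avg n (fun a => dcoef Y n f a ^+ 2)) (fun n => avg n (fun a => u n a ^+ 2))); first last.
- by move=> n nM; rewrite /u nM expr0n/= avg_cst.
- by move=> n Mn; rewrite /u ltnNge Mn.
rewrite (split_sum (fun n => avg n (fun a => `|dcoef Y n f a| `^ p)) (fun n => avg n (fun a => `|u n a| `^ p))); first last.
- by move=> n nM; rewrite /u nM normr0 powR0 ?avg_cst//; lra.
- by move=> n Mn; rewrite /u ltnNge Mn.
rewrite [leRHS](splitr (e `^ p)) lerD//; last first.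
  have := H2 M N M2 MN; rewrite /d2 ler_pdivlMr ?mulr_gt0//; by rewrite mulrC.
have := H1 M N M1 MN; rewrite /d1 ler_pdivlMr ?mulr_gt0// mulrC => H3.
have -> : e `^ p / 2 = ((e `^ p / 2) `^ (2 / p)) `^ (p / 2).
  by rewrite -powRrM (_ : 2 / p * (p / 2) = 1) ?powRr1//; [exact: ltW|field; lra].
apply: ge0_ler_powR => //; first by rewrite divr_ge0// ltW.
- by rewrite nnegrE mulr_ge0//; [rewrite mulr_ge0// ltW|rewrite subr_ge0; exact: (ndg _ A0)].
- by rewrite nnegrE powR_ge0.
Qed.

Lemma UN_selfadj Y N f g : labels Y -> L1 f -> L1 g ->
  Ex (fun x => g x * UN Y Y N f x) = Ex (fun x => f x * UN Y Y N g x).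
Proof.
move=> HY f1 g1; rewrite !Ex_UN//; apply: eq_bigr => n _; apply: eq_avg => a _.
by rewrite mulrC.
Qed.

(** For [p < 2], self-adjointness moves the partial sum operator onto the image of [UN Y Y N f]
    under [phi p], which lies in L_q with [q > 2], where the bound is already known. *)
Lemma PN_bound Y p : labels Y -> 1 < p ->
  exists C : R, 0 <= C /\ forall f N, inLp p f -> nrm p (UN Y Y N f) <= C * nrm p f.
Proof.
move=> HY p1; have [p2|p2] := leP 2 p; first exact: PN_bound_ge2.
have p0 : 0 < p by lra.
pose q := p / (p - 1); have pq := conj_exp p1; rewrite -/q in pq.
have q0 : 0 < q by rewrite divr_gt0; lra.
have q2 : 2 <= q by rewrite /q ler_pdivlMr; lra.
have [C [C0 CP]] := PN_bound_ge2 HY q2.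
exists C; split=> // f N fp; set S := UN Y Y N f.
have f1 : L1 f by apply: inL1 fp; exact: ltW.
have Sp : inLp p S by apply: UN_inLp => //; exact: ltW.
pose s := Ex (fun x => `|S x| `^ p).
have s0 : 0 <= s by exact: Expow_ge0.
pose F t := phi p (\sum_(n < N) dcoef Y n f (nth 0%N t n)).
have psiE x : phi p (S x) = F (lab Y N x) by rewrite /S UN_lab.
have psiq : inLp q (fun x => phi p (S x)).
  by apply: eq_inLp (lab_inLp HY N F (ltW q0)) => x _; rewrite psiE.
have psi1 : L1 (fun x => phi p (S x)) by apply: inL1 psiq; lra.
have npsi : nrm q (fun x => phi p (S x)) = s `^ q^-1.
  rewrite nrmE /s; congr (_ `^ _); apply: eq_Ex => x _; exact: norm_phi_pow.
have sE : s = Ex (fun x => f x * UN Y Y N (fun x => phi p (S x)) x).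
  rewrite -UN_selfadj//; apply: eq_Ex => x _; rewrite -/S mulrC mul_phi//; lra.
have Uq : inLp q (UN Y Y N (fun x => phi p (S x))) by apply: UN_inLp => //; exact: ltW.
have [H1 H2] := hoelderE p0 q0 pq fp Uq.
have H : s <= nrm p f * (C * s `^ q^-1).
  rewrite {1}sE; apply: le_trans (ler_norm _) _; apply: le_trans (le_norm_Ex H1) _.
  by apply: le_trans H2 _; rewrite ler_wpM2l ?nrm_ge0// -npsi; exact: CP.
have [sz|sn0] := eqVneq s 0.
  by rewrite nrmE -/s sz powR0 ?mulr_ge0 ?nrm_ge0// invr_neq0//; lra.
have sp : 0 < s by rewrite lt_neqAle eq_sym sn0.
have V0 : 0 < s `^ q^-1 by rewrite powR_gt0.
have BE : s = s `^ p^-1 * s `^ q^-1 by rewrite -powRD ?pq ?powRr1// oner_eq0.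
by rewrite nrmE -/s -(ler_pM2r V0) -BE mulrAC mulrC.
Qed.

Lemma UN_sub X Y N f g x : labels X -> L1 f -> L1 g ->
  UN X Y N (fun x => f x - g x) x = UN X Y N f x - UN X Y N g x.
Proof. by move=> HX f1 g1; rewrite /UN -sumrB; apply: eq_bigr => n _; rewrite dcoefB. Qed.

(** For [p < 2], replace [f] by a bounded [g]: the partial sums of [g] are Cauchy in L_2, hence in
    L_p, and those of [f - g] are uniformly small by [PN_bound]. *)
Lemma PN_cauchy Y p f (e : R) : labels Y -> 1 < p -> inLp p f -> 0 < e ->
  exists N0, forall M N, (N0 <= M)%N -> (M <= N)%N ->
    nrm p (fun x => UN Y Y N f x - UN Y Y M f x) <= e.
Proof.
move=> HY p1 fp e0; have [p2|p2] := leP 2 p; first exact: PN_cauchy_ge2.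
have p0 : 0 < p by lra. have p1' : 1 <= p by lra.
have [C [C0 CP]] := PN_bound HY p1.
have d0 : 0 < e / (4 * (C + 1)) by rewrite divr_gt0 ?mulr_gt0//; lra.
have [g [K [mg gK gd]]] := bounded_dense p1' fp d0.
have g2 : inLp 2 g by apply: (@inLp_bounded _ _ _ K) => // x _; exact: gK.
have gp : inLp p g by apply: (@inLp_bounded _ _ _ K); [lra|by []|move=> x _; exact: gK].
have [N0 H] := PN_cauchy_ge2 HY (lexx 2) g2 (divr_gt0 e0 (ltr0n R 2)).
exists N0 => M N M0 MN.
have f1 := inL1 p1' fp; have g1 := inL1 p1' gp.
have UNp N' h : inLp p (UN Y Y N' h) by apply: UN_inLp => //; lra.
have fgp := (inLpB p1' fp gp).1.
have E (x : R) : UN Y Y N f x - UN Y Y M f x =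
   (UN Y Y N g x - UN Y Y M g x) + (UN Y Y N (fun x => f x - g x) x - UN Y Y M (fun x => f x - g x) x).
  by rewrite !UN_sub//; lra.
rewrite (eq_nrm p (fun x _ => E x)).
have B1 := inLpB p1' (UNp N g) (UNp M g).
have B2 := inLpB p1' (UNp N (fun x => f x - g x)) (UNp M (fun x => f x - g x)).
apply: le_trans (inLpD p1' B1.1 B2.1).2 _.
rewrite [leRHS](splitr e) lerD//.
  have UN2 N' : inLp 2 (UN Y Y N' g) by apply: UN_inLp.
  apply: le_trans (H M N M0 MN).
  exact: (nrm_mono p1' (ltW p2) (inLpB (ler1n R 2) (UN2 N) (UN2 M)).1).2.
apply: le_trans B2.2 _.
have := CP _ N fgp; have := CP _ M fgp; set nf := nrm p (fun x => f x - g x) in gd *.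
move=> h1 h2; apply: le_trans (lerD h2 h1) _.
have : C * nf <= (C + 1) * (e / (4 * (C + 1))).
  by apply: ler_pM => //; [exact: nrm_ge0|lra].
have -> : (C + 1) * (e / (4 * (C + 1))) = e / 4 by field; lra.
by lra.
Qed.

Lemma cvgN_unique r (u : nat -> R -> R) f g : 1 <= r -> (forall n, inLp r (u n)) ->
  inLp r f -> inLp r g -> cvgN r u f -> cvgN r u g -> ae01 f g.
Proof.
move=> r1 ur fr gr uf ug; have [fgr _] := inLpB r1 fr gr.
have E0 : nrm r (fun x => f x - g x) = 0.
  apply/eqP; rewrite eq_le nrm_ge0 andbT; apply/ler_addgt0Pr => e e0; rewrite add0r.
  have [N1 H1] := uf _ (divr_gt0 e0 (ltr0n R 2)).
  have [N2 H2] := ug _ (divr_gt0 e0 (ltr0n R 2)).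
  pose n := maxn N1 N2.
  apply: le_trans (nrm_dist r1 fr gr (ur n)) _; rewrite [leRHS](splitr e) lerD//.
    by rewrite nrmC; apply: H1; exact: leq_maxl.
  by apply: H2; exact: leq_maxr.
have := nrm0_ae (lt_le_trans ltr01 r1) fgr E0.
by apply: ae_imp => x H xI; apply/eqP; rewrite -subr_eq0 H.
Qed.

Lemma cvgN_ae r (u : nat -> R -> R) f g : (forall n, measurable_fun I01 (u n)) ->
  measurable_fun I01 f -> measurable_fun I01 g -> ae01 f g -> cvgN r u f -> cvgN r u g.
Proof.
move=> mu mf mg fg uf e e0; have [N H] := uf e e0; exists N => n nN.
rewrite -(@ae_nrm R r (fun x => u n x - f x)); first exact: H.
- exact: measurable_funB.
- exact: measurable_funB.
- exact: (ae01_comp (fun x y => u n x - y)).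
Qed.

Lemma cvgN_mono s r (u : nat -> R -> R) f : 1 <= s -> s <= r -> (forall n, inLp r (u n)) -> inLp r f ->
  cvgN r u f -> cvgN s u f.
Proof.
move=> s1 sr ur fr uf e e0; have [N H] := uf e e0; exists N => n nN.
apply: le_trans (H n nN).
exact: (nrm_mono s1 sr (inLpB (le_trans s1 sr) (ur n) fr).1).2.
Qed.

(* The limit is taken in L_1, so that one operator serves all exponents; the junk
   value without a limit is 0. *)
Definition Ulim X Y f : R -> R :=
  xget (fun=> 0) [set g | inLp 1 g /\ cvgN 1 (fun N => UN X Y N f) g].

(** The L_p limit exists by completeness; it is also an L_1 limit, and uniqueness of L_1 limits
    identifies it with the chosen one. *)
Lemma Ulim_spec p X Y f : labels X -> labels Y -> 1 < p -> inLp p f ->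
  inLp p (Ulim X Y f) /\ cvgN p (fun N => UN X Y N f) (Ulim X Y f).
Proof.
move=> HX HY p1 fp; have p1' : 1 <= p by lra.
have UNp N : inLp p (UN X Y N f) by apply: UN_inLp => //; lra.
have UN1 N : inLp 1 (UN X Y N f) by exact: UN_inLp.
have [g [gp gc]] : exists g, inLp p g /\ cvgN p (fun N => UN X Y N f) g.
  apply: Lp_complete => // e e0.
  have [N0 H] := PN_cauchy HX p1 fp e0.
  exists N0 => m n mN nN; rewrite (nrm_UN _ _ _ _ HX HY HX).
  by case: (leqP n m) => mn; [apply: H|rewrite nrmC; apply: H => //; exact: ltnW].
have g1 : inLp 1 g := (nrm_mono (lexx 1) p1' gp).1.
have gc1 : cvgN 1 (fun N => UN X Y N f) g by exact: cvgN_mono gc.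
have [] : [set g | inLp 1 g /\ cvgN 1 (fun N => UN X Y N f) g] (Ulim X Y f).
  by apply: (xgetPex _ (P := [set g | inLp 1 g /\ cvgN 1 (fun N => UN X Y N f) g])); exists g.
move=> U1 Uc; have gU := cvgN_unique (lexx 1) UN1 g1 U1 gc1 Uc.
split; first exact: ae_inLp (inLp_meas U1) gU gp.
apply: (cvgN_ae _ (inLp_meas gp) (inLp_meas U1) gU gc) => n; exact: inLp_meas (UNp n).
Qed.

End Projections.

Opaque inLp pnorm.

(** * Change of label system: boundedness, isometry, equidistribution *)

Section Transfer.
Context {R : realType}.
Local Notation lam := (@lebesgue_measure R).
Local Notation I01 := (@I01 R).
Implicit Types (f g : R -> R) (p q r : R) (X Y Z : nat -> R -> nat).

Lemma le_of_eps (a b c : R) : 0 <= c -> (forall e, 0 < e -> a <= b + c * e) -> a <= b.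
Proof.
move=> c0 H; apply/ler_addgt0Pr => e e0.
have c1 : 0 < c + 1 by lra.
apply: le_trans (H (e / (c + 1)) (divr_gt0 e0 c1)) _; rewrite lerD2l mulrCA.
by rewrite ler_piMr ?(ltW e0)// ler_pdivrMr//; lra.
Qed.

Lemma UN0 X Y f x : UN X Y 0 f x = 0.
Proof. by rewrite /UN big_ord0. Qed.

Lemma nrm_UN1 X Y Z r N f : labels X -> labels Y -> labels Z ->
  nrm r (UN X Y N f) = nrm r (UN X Z N f).
Proof.
move=> HX HY HZ; have := nrm_UN r N 0 f HX HY HZ.
by rewrite (eq_nrm r (g := UN X Y N f)) ?(eq_nrm r (f := fun x => UN X Z N f x - _) (g := UN X Z N f))// => x _; rewrite UN0 subr0.
Qed.

(** [C] is uniform in the target system, because the norms of the partial sums do not depend on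
    it. *)
Lemma Ulim_bound X p : labels X -> 1 < p ->
  exists C : R, 0 <= C /\ forall Y f, labels Y -> inLp p f -> nrm p (Ulim X Y f) <= C * nrm p f.
Proof.
move=> HX p1; have [C [C0 CP]] := PN_bound HX p1; exists C; split=> // Y f HY fp.
have [Up Uc] := Ulim_spec HX HY p1 fp.
apply: (@le_of_eps _ _ 1) => // e e0; rewrite mul1r; have [N H] := Uc e e0.
have UNp : inLp p (UN X Y N f) by apply: UN_inLp => //; lra.
apply: le_trans (nrm_le_dist (ltW p1) Up UNp) _; rewrite lerD//.
  by rewrite (nrm_UN1 _ _ _ HX HY HX); exact: CP.
by rewrite nrmC; exact: H.
Qed.

Lemma dcoef_dist Y n f g a r : labels Y -> 1 <= r -> inLp r f -> inLp r g ->
  `|dcoef Y n f a - dcoef Y n g a| <= 2 * (2 ^ n)%:R * nrm r (fun x => f x - g x).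
Proof.
move=> HY r1 fr gr; have [fgr _] := inLpB r1 fr gr.
rewrite -(dcoefB HY n a (inL1 r1 fr) (inL1 r1 gr)).
apply: le_trans (dcoef_bound HY n a (inL1 r1 fgr)) _.
by rewrite ler_wpM2l ?mulr_ge0 ?ler0n//; exact: Ex_le_nrm.
Qed.

Lemma dcoef_Ulim p X Y f n a : labels X -> labels Y -> 1 < p -> inLp p f -> (a < 2 ^ n)%N ->
  dcoef Y n (Ulim X Y f) a = dcoef X n f a.
Proof.
move=> HX HY p1 fp an; have [Up Uc] := Ulim_spec HX HY p1 fp.
have f1 := inL1 (ltW p1) fp.
apply/eqP; rewrite -subr_eq0 -normr_le0.
apply: (@le_of_eps _ _ (2 * (2 ^ n)%:R)); first by rewrite mulr_ge0 ?ler0n.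
move=> e e0; rewrite add0r; have [N0 H] := Uc e e0.
pose N := maxn N0 n.+1.
have UNp : inLp p (UN X Y N f) by apply: UN_inLp => //; lra.
have <- : dcoef Y n (UN X Y N f) a = dcoef X n f a.
  by rewrite dcoef_UN// leq_max ltnSn orbT.
apply: le_trans (dcoef_dist n a HY (ltW p1) Up UNp) _.
rewrite ler_wpM2l ?mulr_ge0 ?ler0n// nrmC; apply: H; exact: leq_maxl.
Qed.

Lemma UN_Ulim p X Y Z f N : labels X -> labels Y -> labels Z -> 1 < p -> inLp p f ->
  UN Y Z N (Ulim X Y f) = UN X Z N f.
Proof.
move=> HX HY HZ p1 fp; apply/funext => x; apply: eq_bigr => n _.
by rewrite (dcoef_Ulim HX HY p1 fp)//; exact: lab_lt.
Qed.

(** The limit is picked by choice from a set that depends only on the sequence of partial sums, so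
    equal sequences give identical functions. This is why the composition law [Ulim_comp] is an
    exact equality. *)
Lemma eq_Ulim X Y X' Y' f g : (fun N => UN X Y N f) = (fun N => UN X' Y' N g) ->
  Ulim X Y f = Ulim X' Y' g.
Proof. by rewrite /Ulim => ->. Qed.

Lemma Ulim_comp p X Y Z f : labels X -> labels Y -> labels Z -> 1 < p -> inLp p f ->
  Ulim Y Z (Ulim X Y f) = Ulim X Z f.
Proof.
move=> HX HY HZ p1 fp; apply: eq_Ulim.
by apply/funext => N; exact: (UN_Ulim N HX HY HZ p1 fp).
Qed.

Lemma UN_lin X Y N (c : R) f g x : labels X -> L1 f -> L1 g ->
  UN X Y N (fun x => c * f x + g x) x = c * UN X Y N f x + UN X Y N g x.
Proof.
move=> HX f1 g1; rewrite /UN mulr_sumr -big_split/=; apply: eq_bigr => n _.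
by rewrite dcoefD//; [rewrite dcoefZ|exact: L1Z].
Qed.

Lemma cvgN_lin r (u v : nat -> R -> R) (c : R) f g : 1 <= r -> (forall n, inLp r (u n)) ->
  (forall n, inLp r (v n)) -> inLp r f -> inLp r g -> cvgN r u f -> cvgN r v g ->
  cvgN r (fun n x => c * u n x + v n x) (fun x => c * f x + g x).
Proof.
move=> r1 ur vr fr gr uf vg e e0.
have d0 : 0 < e / 2 / (`|c| + 1) by rewrite !divr_gt0//; have := normr_ge0 c; lra.
have [N1 H1] := uf _ d0; have [N2 H2] := vg _ (divr_gt0 e0 (ltr0n R 2)).
exists (maxn N1 N2) => n; rewrite geq_max => /andP[n1 n2].
have [ufr _] := inLpB r1 (ur n) fr; have [vgr _] := inLpB r1 (vr n) gr.
have E (x : R) : c * u n x + v n x - (c * f x + g x) = c * (u n x - f x) + (v n x - g x) by lra.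
rewrite (eq_nrm r (fun x _ => E x)); apply: le_trans (inLpD r1 (inLpZ c ufr) vgr).2 _.
rewrite [leRHS](splitr e) lerD//; last exact: H2.
rewrite nrmZ//; last exact: lt_le_trans r1.
have := H1 n n1; rewrite ler_pdivlMr; last by have := normr_ge0 c; lra.
by have := nrm_ge0 r (fun x => u n x - f x); have := normr_ge0 c; nra.
Qed.

Lemma Ulim_lin p X Y (c : R) f g : labels X -> labels Y -> 1 < p -> inLp p f -> inLp p g ->
  ae01 (Ulim X Y (fun x => c * f x + g x)) (fun x => c * Ulim X Y f x + Ulim X Y g x).
Proof.
move=> HX HY p1 fp gp; have p1' := ltW p1.
have [Uf cf] := Ulim_spec HX HY p1 fp; have [Ug cg] := Ulim_spec HX HY p1 gp.
have fgp := (inLpD p1' (inLpZ c fp) gp).1.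
have [Ufg cfg] := Ulim_spec HX HY p1 fgp.
have UNp h N : inLp p (UN X Y N h) by apply: UN_inLp => //; lra.
apply: (cvgN_unique p1' (UNp (fun x => c * f x + g x)) Ufg (inLpD p1' (inLpZ c Uf) Ug).1 cfg).
move=> e e0; have [N H] := cvgN_lin c p1' (UNp f) (UNp g) Uf Ug cf cg e0.
exists N => n nN; apply: le_trans (H n nN); rewrite le_eqVlt; apply/orP; left; apply/eqP.
by apply: eq_nrm => x _; rewrite UN_lin//; [exact: (inL1 p1' fp)|exact: (inL1 p1' gp)].
Qed.

Lemma Ulim_selfadj p q X f g : labels X -> 1 < p -> 1 < q -> p^-1 + q^-1 = 1 ->
  inLp p f -> inLp q g -> Ex (fun x => Ulim X X f x * g x) = Ex (fun x => f x * Ulim X X g x).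
Proof.
move=> HX p1 q1 pq fp gq.
have [Uf cf] := Ulim_spec HX HX p1 fp; have [Ug cg] := Ulim_spec HX HX q1 gq.
have p0 : 0 < p by lra. have q0 : 0 < q by lra.
apply/eqP; rewrite -subr_eq0 -normr_le0.
apply: (@le_of_eps _ _ (nrm q g + nrm p f)); first by rewrite addr_ge0 ?nrm_ge0.
move=> e e0; rewrite add0r; have [N1 H1] := cf e e0; have [N2 H2] := cg e e0.
pose N := maxn N1 N2.
have UNf : inLp p (UN X X N f) by apply: UN_inLp => //; lra.
have UNg : inLp q (UN X X N g) by apply: UN_inLp => //; lra.
have [d1 _] := inLpB (ltW p1) UNf Uf; have [d2 _] := inLpB (ltW q1) UNg Ug.
have [a1 a2] := hoelderE p0 q0 pq d1 gq.
have [b1 b2] := hoelderE p0 q0 pq fp d2.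
have [c1 _] := hoelderE p0 q0 pq Uf gq.
have [c2 _] := hoelderE p0 q0 pq fp Ug.
have [c3 _] := hoelderE p0 q0 pq UNf gq.
have [c4 _] := hoelderE p0 q0 pq fp UNg.
have E1 : Ex (fun x => (UN X X N f x - Ulim X X f x) * g x) =
  Ex (fun x => UN X X N f x * g x) - Ex (fun x => Ulim X X f x * g x).
  by rewrite -ExB//; apply: eq_Ex => x _; rewrite mulrBl.
have E2 : Ex (fun x => f x * (UN X X N g x - Ulim X X g x)) =
  Ex (fun x => f x * UN X X N g x) - Ex (fun x => f x * Ulim X X g x).
  by rewrite -ExB//; apply: eq_Ex => x _; rewrite mulrBr.
have E3 : Ex (fun x => UN X X N f x * g x) = Ex (fun x => f x * UN X X N g x).
  rewrite -(UN_selfadj N HX (inL1 (ltW p1) fp) (inL1 (ltW q1) gq)).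
  by apply: eq_Ex => x _; rewrite mulrC.
have h1 : `|Ex (fun x => (UN X X N f x - Ulim X X f x) * g x)| <= e * nrm q g.
  apply: le_trans (le_norm_Ex a1) _; apply: le_trans a2 _; rewrite ler_wpM2r ?nrm_ge0//.
  by apply: H1; exact: leq_maxl.
have h2 : `|Ex (fun x => f x * (UN X X N g x - Ulim X X g x))| <= nrm p f * e.
  apply: le_trans (le_norm_Ex b1) _; apply: le_trans b2 _; rewrite ler_wpM2l ?nrm_ge0//.
  by apply: H2; exact: leq_maxr.
move: h1 h2; rewrite E1 E2 E3; set A := Ex _; set B := Ex _; set C := Ex _.
rewrite !ler_norml => /andP[h1 h2] /andP[h3 h4]; apply/andP; split; lra.
Qed.

Lemma Ulim_iso p X Y Z f : labels X -> labels Y -> labels Z -> 1 < p -> inLp p f ->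
  nrm p (Ulim X Y f) = nrm p (Ulim X Z f).
Proof.
move=> HX HY HZ p1 fp.
suff H Y' Z' : labels Y' -> labels Z' -> nrm p (Ulim X Y' f) <= nrm p (Ulim X Z' f).
  by apply/eqP; rewrite eq_le !H.
move=> HY' HZ'.
have [UY cY] := Ulim_spec HX HY' p1 fp; have [UZ cZ] := Ulim_spec HX HZ' p1 fp.
apply: (@le_of_eps _ _ 2) => // e e0.
have [N1 H1] := cY e e0; have [N2 H2] := cZ e e0; pose N := maxn N1 N2.
have UNY : inLp p (UN X Y' N f) by apply: UN_inLp => //; lra.
have UNZ : inLp p (UN X Z' N f) by apply: UN_inLp => //; lra.
apply: le_trans (nrm_le_dist (ltW p1) UY UNY) _; rewrite nrmC.
have := H1 N (leq_maxl _ _); have := H2 N (leq_maxr _ _).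
have := nrm_le_dist (ltW p1) UNZ UZ; rewrite (nrm_UN1 _ _ _ HX HY' HZ').
by lra.
Qed.

(** For the labels of the Haar families this is the space of the theorem, by [RXE]. *)
Definition Zspan p Y : set (R -> R) := [set f | inLp p f /\ forall e, 0 < e ->
  exists N u, (forall n, avg n (u n) = 0 :> R) /\ nrm p (fun x => f x - Ssum Y u N x) <= e].

Lemma UN_fix Y u N M x : labels Y -> (forall n, avg n (u n) = 0) -> (N <= M)%N ->
  UN Y Y M (Ssum Y u N) x = Ssum Y u N x.
Proof.
move=> HY u0 NM; rewrite /UN.
have E n : dcoef Y n (Ssum Y u N) (Y n x) = if (n < N)%N then u n (Y n x) else 0.
  rewrite /Ssum dcoef_sum//; last by move=> i _; exact: (label_L1 HY i (u i)).
  case: ltnP => nN.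
    rewrite (bigD1 (Ordinal nN))//= dcoef_label// ?(lab_lt HY)// u0 subr0 big1 ?addr0// => i.
    by rewrite -val_eqE/= eq_sym => ne; rewrite dcoef_label_ne// (lab_lt HY).
  by apply: big1 => i _; rewrite dcoef_label_ne ?(lab_lt HY)//; apply/eqP; have := ltn_ord i; lia.
rewrite /Ssum; under eq_bigr do rewrite E.
rewrite -big_mkcond -(big_mkord (fun n => (n < N)%N) (fun n => u n (Y n x))) /=.
rewrite (big_cat_nat (n := N))//= [X in _ + X]big1_seq ?addr0; last first.
  by move=> n; rewrite mem_index_iota => /andP[h1 h2]; lia.
rewrite -(big_mkord xpredT (fun n => u n (Y n x))) big_nat_cond [RHS]big_nat_cond.
by apply: eq_bigl => n; rewrite andbT -andbA andbb.
Qed.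

(** A finite sum close to [f] is fixed by [UN] from some index on, and [PN_bound] controls the
    remainder uniformly. *)
Lemma Zspan_Ulim_id p Y f : labels Y -> 1 < p -> Zspan p Y f -> ae01 (Ulim Y Y f) f.
Proof.
move=> HY p1 [fp Hf]; have p1' := ltW p1; have p0 : 0 <= p by lra.
have [Up Uc] := Ulim_spec HY HY p1 fp.
have UNp N h : inLp p (UN Y Y N h) by apply: UN_inLp.
apply: (cvgN_unique p1' (fun N => UNp N f) Up fp Uc).
have [C [C0 CP]] := PN_bound HY p1.
move=> e e0; have d0 : 0 < e / (C + 1) by rewrite divr_gt0//; lra.
have [N [u [u0 H]]] := Hf _ d0; exists N => M NM.
have Sp : inLp p (Ssum Y u N) := Ssum_inLp HY u N p0.
have [dp _] := inLpB p1' fp Sp.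
have E (x : R) : UN Y Y M f x - f x = UN Y Y M (fun x => f x - Ssum Y u N x) x - (f x - Ssum Y u N x).
  rewrite UN_sub//; [|exact: (inL1 p1' fp)|exact: (inL1 p1' Sp)].
  by rewrite UN_fix//; lra.
rewrite (eq_nrm p (fun x _ => E x)); apply: le_trans (inLpB p1' (UNp M _) dp).2 _.
have := CP _ M dp; move: H; set d := nrm p _ => H; rewrite ler_pdivlMr in H; last lra.
by move=> H'; apply: le_trans (lerD H' (lexx _)) _; lra.
Qed.

Lemma Ulim_Zspan p X Y f : labels X -> labels Y -> 1 < p -> inLp p f -> Zspan p Y (Ulim X Y f).
Proof.
move=> HX HY p1 fp; have [Up Uc] := Ulim_spec HX HY p1 fp; split=> // e e0.
have [N H] := Uc e e0; exists N, (fun n => dcoef X n f); split.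
  by move=> n; apply: avg_dcoef => //; exact: (inL1 (ltW p1) fp).
by rewrite nrmC; exact: H.
Qed.

Definition law f (B : set R) : \bar R := lam (I01 `&` f @^-1` B).

(** The two image measures are finite and agree on half-open intervals, which generate the Borel
    sets and are closed under intersection. *)
Lemma law_unique f g : measurable_fun I01 f -> measurable_fun I01 g ->
  (forall t, law f [set` `]-oo, t]] = law g [set` `]-oo, t]]) -> equidist f g.
Proof.
move=> mf mg H.
have mpre (k : R -> R) B : measurable_fun I01 k -> measurable B ->
    @measurable _ (measurableTypeR R) (I01 `&` k @^-1` B).
  by move=> mk mB; exact: (mk measurable_I01 B mB).
have law0 k : law k set0 = 0%E by rewrite /law preimage_set0 setI0 measure0.
have lawge0 k A : (0 <= law k A)%E by exact: measure_ge0.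
have law_sa k : measurable_fun I01 k -> semi_sigma_additive (law k).
  move=> mk F mF tF mUF; rewrite /law preimage_bigcup setI_bigcupr.
  apply: measure_semi_sigma_additive.
  - by move=> n; exact: mpre.
  - apply/trivIsetP => /= i j _ _ ij.
    rewrite setIACA setIid -preimage_setI.
    by move/trivIsetP : tF => /(_ _ _ _ _ ij) ->//; rewrite preimage_set0 setI0.
  - by rewrite -setI_bigcupr -preimage_bigcup; exact: mpre.
pose m1 : {measure set R -> \bar R} := HB.pack (law f)
  (isMeasure.Build _ _ _ (law f) (law0 f) (lawge0 f) (law_sa f mf)).
pose m2 : {measure set R -> \bar R} := HB.pack (law g)
  (isMeasure.Build _ _ _ (law g) (law0 g) (lawge0 g) (law_sa g mg)).
have fin k B : measurable_fun I01 k -> measurable B -> (law k B < +oo)%E.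
  move=> mk mB; apply: le_lt_trans I01_finite; apply: le_measure; rewrite ?inE.
  - exact: mpre.
  - exact: mI01.
  - exact: subIsetl.
have D k a b : measurable_fun I01 k -> a <= b ->
   law k [set` `]a, b]] = (law k [set` `]-oo, b]] - law k [set` `]-oo, a]])%E.
  move=> mk ab; have -> : `]a, b]%classic = `]-oo, b] `\` `]-oo, a].
    by rewrite -[RHS]setCK setCD setCitvl setUC -[LHS]setCK setCitv.
  have E : I01 `&` k @^-1` (`]-oo, b] `\` `]-oo, a]) =
     (I01 `&` (k @^-1` `]-oo, b])) `\` (I01 `&` k @^-1` `]-oo, a]).
    apply/seteqP; split => [x [h1 [h2 h3]]|x [[h1 h2] h3]]; split => //; first by move=> [_].
    by split=> // h4; apply: h3.
  rewrite /law E.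
  rewrite measureD; [|exact: mpre|exact: mpre|exact: fin].
  congr (_ - lam _)%E; apply/seteqP; split=> [x [_]//|x [h1 h2]]; split=> //; split=> //.
  by move: h2; rewrite /= !in_itv/= => h2; exact: le_trans h2 ab.
have := @measure_unique _ R R (@ocitv R) (fun n => [set` `]- n%:R, n%:R]]) erefl (@ocitvI R) _ _ m1 m2 _ _.
move=> U B mB; apply: U => //.
- by move=> n; exact: is_ocitv.
- apply/seteqP; split=> // x _; have [n nx] : exists n : nat, `|x| < n%:R.
    by exists (Num.truncn `|x|).+1; rewrite truncnS_gt.
  exists n => //=; rewrite in_itv/=; move: nx; rewrite ltr_norml => /andP[-> /ltW ->] //.
- move=> A /ocitvP[->|[[a b]]/= ab ->]; first by rewrite /m1/m2 /= !law0.
  by rewrite /m1 /m2 /= !D ?(ltW ab)// !H.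
- by move=> n; exact: fin.
Qed.

Lemma law_Ex f B : measurable_fun I01 f -> measurable B -> law f B = (Ex (fun x => \1_B (f x)))%:E.
Proof.
move=> mf mB.
have mfB : measurable_fun I01 (fun x => \1_B (f x) : R).
  by apply: (measurableT_comp _ mf) => //; exact: measurable_indic.
have f1 : L1 (fun x => \1_B (f x)).
  apply: (@L1_bounded _ _ 1) => // x _; rewrite indicE.
  by case: (_ \in _); rewrite ?normr1 ?normr0.
rewrite EFin_Ex// /law.
have mpre : @measurable _ (measurableTypeR R) (I01 `&` f @^-1` B) := mf measurable_I01 B mB.
have := integral_indic lam mI01 mpre; rewrite -setIA [_ `&` I01]setIC setIA setIid => <-.
apply: eq_integral => x /set_mem xI; rewrite !indicE; congr (_%:R%:E).
have [h|h] := boolP (f x \in B); first by rewrite mem_set//; split=> //; exact: (set_mem h).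
by rewrite memNset// => -[_ h2]; move: h; rewrite (mem_set (h2 : B (f x))).
Qed.

Definition cdfE f (t : R) : R := Ex (fun x => (f x <= t)%R%:R).

Lemma indic_ray (t y : R) : \1_[set` `]-oo, t]] y = (y <= t)%R%:R :> R.
Proof.
rewrite indicE; congr (_%:R); have [h|h] := boolP (y <= t); first by rewrite mem_set//= in_itv.
by rewrite memNset//= in_itv/= (negbTE h).
Qed.

Lemma cdf_L1 f t : measurable_fun I01 f -> L1 (fun x => (f x <= t)%R%:R).
Proof.
move=> mf; apply: (@L1_bounded _ _ 1); last by move=> x _; case: (f x <= t)%R; rewrite ?normr1 ?normr0.
have -> : (fun x => (f x <= t)%R%:R) = (fun x => \1_[set` `]-oo, t]] (f x) : R).
  by apply/funext => x; rewrite indic_ray.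
apply: (measurableT_comp _ mf); apply: measurable_indic; exact: measurable_itv.
Qed.

(** Markov's inequality: if [f x <= s] but [u x > t], then [|u x - f x|] exceeds [t - s]. *)
Lemma cdf_approx f u (s t : R) : L1 f -> L1 u -> s < t ->
  cdfE f s <= cdfE u t + (t - s)^-1 * Ex (fun x => `|u x - f x|).
Proof.
move=> f1 u1 st; have d1 : L1 (fun x => `|u x - f x|) by apply: L1_norm; exact: L1B.
rewrite -ExZ// /cdfE -ExD; [|apply: cdf_L1; exact: L1_meas|exact: L1Z].
apply: le_Ex; [apply: cdf_L1; exact: L1_meas|by apply: L1D; [apply: cdf_L1; exact: L1_meas|exact: L1Z]|].
move=> x _; have d0 : 0 <= (t - s)^-1 * `|u x - f x| by rewrite mulr_ge0 ?invr_ge0//; lra.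
case: (leP (f x) s) => fs; last by rewrite addr_ge0//; case: (u x <= t)%R.
case: (leP (u x) t) => ut; first by rewrite lerDl.
rewrite add0r mulrC ler_pdivlMr ?mul1r; last lra.
by apply: le_trans (ler_norm _); lra.
Qed.

Lemma cdf_right f t : measurable_fun I01 f ->
  forall e, 0 < e -> exists2 d, 0 < d & cdfE f (t + d) <= cdfE f t + e.
Proof.
move=> mf e e0.
pose F n x : \bar R := ((f x <= t + n.+1%:R^-1)%R%:R)%:E.
have mF n : measurable_fun I01 (F n) by apply/measurable_EFinP; exact: (L1_meas (cdf_L1 (t + n.+1%:R^-1) mf)).
have C : (\int[lam]_(x in I01) F n x)%E @[n --> \oo] --> (\int[lam]_(x in I01) ((f x <= t)%R%:R)%:E)%E.
  have [] // := @dominated_convergence _ _ _ lam _ mI01 F (fun x => ((f x <= t)%R%:R)%:E) (fun=> 1%:E) mF _ _ _ _.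
  - by apply/measurable_EFinP; exact: (L1_meas (cdf_L1 t mf)).
  - apply: aeW => x _; apply: cvg_near_cst.
    case: (leP (f x) t) => ft.
      apply: nearW => n; rewrite /F; congr (_%:R%:E); apply/eqP; rewrite eqb1.
      by apply: le_trans ft _; rewrite lerDl invr_ge0.
    near=> n; rewrite /F; congr (_%:R%:E); apply/eqP; rewrite eqb0 -ltNge -ltrBrDl.
    near: n; have := near_infty_natSinv_lt (PosNum (_ : 0 < f x - t)).
    by apply; rewrite subr_gt0.
  - exact: L1_cst.
  - by apply: aeW => x n _; rewrite /F /= lee_fin; case: (f x <= _)%R; rewrite ?normr1 ?normr0.
rewrite -(EFin_Ex (cdf_L1 t mf)) -/(cdfE f t) in C.
have lt : ((cdfE f t)%:E < (cdfE f t + e)%:E)%E by rewrite lte_fin ltrDl.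
have [n _ Hn] := C _ (open_ereal_lt' lt).
exists n.+1%:R^-1; first by rewrite invr_gt0.
have := Hn n (leqnn n); rewrite /= -(EFin_Ex (cdf_L1 (t + n.+1%:R^-1) mf)) lte_fin; exact: ltW.
Unshelve. all: by end_near. Qed.

(** Two gaps of length [d / 2] absorb the errors of the two approximations, and right continuity of
    the distribution function of [g] removes the total shift [d]. *)
Lemma cdf_le_lim f g (u v : nat -> R -> R) t : inLp 1 f -> inLp 1 g ->
  (forall n, inLp 1 (u n)) -> (forall n, inLp 1 (v n)) -> cvgN 1 u f -> cvgN 1 v g ->
  (forall n s, cdfE (u n) s = cdfE (v n) s) -> cdfE f t <= cdfE g t.
Proof.
move=> f1 g1 u1 v1 uf vg uv; apply/ler_addgt0Pr => e e0.
have e20 : 0 < e / 2 by lra.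
have [d d0 Hd] := cdf_right t (inLp_meas g1) e20.
suff : cdfE f t <= cdfE g (t + d) by lra.
apply: (@le_of_eps _ _ (4 / d)); first by rewrite divr_ge0// ltW.
move=> z z0.
have [N1 H1] := uf _ z0; have [N2 H2] := vg _ z0; pose n := maxn N1 N2.
have L (h : R -> R) : inLp 1 h -> L1 h by exact: inL1.
have A1 := @cdf_approx f (u n) t (t + d / 2) (L _ f1) (L _ (u1 n)) ltac:(lra).
have A2 := @cdf_approx (v n) g (t + d / 2) (t + d) (L _ (v1 n)) (L _ g1) ltac:(lra).
rewrite uv in A1.
have B1 : Ex (fun x => `|u n x - f x|) <= z.
  exact: le_trans (Ex_le_nrm (lexx 1) (inLpB (lexx 1) (u1 n) f1).1) (H1 n (leq_maxl _ _)).
have B2 : Ex (fun x => `|g x - v n x|) <= z.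
  apply: le_trans (Ex_le_nrm (lexx 1) (inLpB (lexx 1) g1 (v1 n)).1) _.
  by rewrite nrmC; exact: (H2 n (leq_maxr _ _)).
have dE : t + d / 2 - t = d / 2 by lra.
have dE' : t + d - (t + d / 2) = d / 2 by lra.
rewrite dE invf_div in A1; rewrite dE' invf_div in A2.
have C1 : 2 / d * Ex (fun x => `|u n x - f x|) <= 2 / d * z by rewrite ler_wpM2l// divr_ge0// ltW.
have C2 : 2 / d * Ex (fun x => `|g x - v n x|) <= 2 / d * z by rewrite ler_wpM2l// divr_ge0// ltW.
have -> : 4 / d * z = 2 / d * z + 2 / d * z by rewrite -mulrDl -mulrDl; congr (_ / _ * _); lra.
by lra.
Qed.

Lemma equidist_Ulim p X Y f : labels X -> labels Y -> 1 < p -> Zspan p X f ->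
  equidist (Ulim X Y f) f.
Proof.
move=> HX HY p1 Zf; have [fp _] := Zf; have p1' := ltW p1.
have [Up Uc] := Ulim_spec HX HY p1 fp.
have [Ip Ic] := Ulim_spec HX HX p1 fp.
have IF := Zspan_Ulim_id HX p1 Zf.
have L h : inLp p h -> inLp 1 h by move=> hp; exact: (nrm_mono (lexx 1) p1' hp).1.
have UNp Z N : labels Z -> inLp p (UN X Z N f) by move=> HZ; apply: UN_inLp => //; lra.
have c1 : cvgN 1 (fun N => UN X Y N f) (Ulim X Y f) by exact: (cvgN_mono (lexx 1) p1' (fun n => UNp Y n HY) Up Uc).
have c2 : cvgN 1 (fun N => UN X X N f) f.
  apply: (@cvgN_ae _ 1 _ (Ulim X X f)) => //.
  - by move=> n; exact: inLp_meas (UNp _ n HX).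
  - exact: inLp_meas Ip.
  - exact: inLp_meas fp.
  - exact: (cvgN_mono (lexx 1) p1' (fun n => UNp X n HX) Ip Ic).
have cE N s : cdfE (UN X Y N f) s = cdfE (UN X X N f) s.
  pose F t := ((\sum_(n < N) dcoef X n f (nth 0%N t n) <= s)%R)%:R : R.
  have E Z x : (UN X Z N f x <= s)%R%:R = F (lab Z N x) by rewrite UN_lab.
  by rewrite /cdfE (eq_Ex (fun x _ => E Y x)) (eq_Ex (fun x _ => E X x)) (Ex_lab_transfer N F HX HY).
apply: law_unique; [exact: inLp_meas Up|exact: inLp_meas fp|move=> t].
rewrite !law_Ex; try exact: measurable_itv; [|exact: inLp_meas fp|exact: inLp_meas Up].
have I h : Ex (fun x => \1_[set` `]-oo, t]] (h x)) = cdfE h t.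
  by apply: eq_Ex => x _; rewrite indic_ray.
rewrite !I; congr (_%:E); apply/eqP; rewrite eq_le; apply/andP; split.
  exact: (cdf_le_lim t (L _ Up) (L _ fp) (fun n => L _ (UNp Y n HY)) (fun n => L _ (UNp X n HX)) c1 c2 cE).
exact: (cdf_le_lim t (L _ fp) (L _ Up) (fun n => L _ (UNp X n HX)) (fun n => L _ (UNp Y n HY)) c2 c1 (fun n s => esym (cE n s))).
Qed.

End Transfer.

(** * From Haar systems to labels *)

Section HaarLabels.
Context {R : realType}.

(* The value of [haar k i] on the a-th dyadic interval of length [2 ^ - n]. *)
Definition hv (n k i a : nat) : R :=
  let b := (a %/ 2 ^ (n - k.+1))%N in
  if b == i.*2 then 1 else if b == i.*2.+1 then -1 else 0.

(** A grid point of level [l <= n] is also one of level [n], so it cannot lie strictly inside the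
    a-th interval. *)
Lemma dyadic_le (n l j a : nat) (x : R) : (l <= n)%N ->
  a%:R / (2 ^ n)%:R <= x -> x < a.+1%:R / (2 ^ n)%:R ->
  (j%:R / (2 ^ l)%:R <= x) = (j * 2 ^ (n - l) <= a)%N.
Proof.
move=> ln ax xa.
have E : j%:R / (2 ^ l)%:R = (j * 2 ^ (n - l))%:R / (2 ^ n)%:R :> R.
  have -> : (2 ^ n = 2 ^ (n - l) * 2 ^ l)%N by rewrite -expnD subnK.
  have := two_pow_neq0 (R := R) l; have := two_pow_neq0 (R := R) (n - l).
  rewrite !natrM; set e := (2 ^ (n - l))%:R; set w := (2 ^ l)%:R => e0 w0; field; by rewrite w0 e0.
rewrite E; apply/idP/idP => H.
  have := le_lt_trans H xa; rewrite ltr_pM2r ?invr_gt0 ?two_pow_gt0// ltr_nat.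
  by rewrite ltnS.
by apply: le_trans ax; rewrite ler_pM2r ?invr_gt0 ?two_pow_gt0// ler_nat.
Qed.

Lemma haar_hv (n k i a : nat) (x : R) : (k < n)%N ->
  a%:R / (2 ^ n)%:R <= x -> x < a.+1%:R / (2 ^ n)%:R -> haar k i x = hv n k i a.
Proof.
move=> kn ax xa; rewrite /haar /hv.
have E1 : i%:R / (2 ^ k)%:R = (i.*2)%:R / (2 ^ k.+1)%:R :> R.
  by rewrite expnS -muln2 mulnC !natrM -mulf_div divff ?mul1r.
have E2 : i.+1%:R / (2 ^ k)%:R = (i.*2.+2)%:R / (2 ^ k.+1)%:R :> R.
  by rewrite expnS -doubleS -muln2 mulnC !natrM -mulf_div divff ?mul1r.
rewrite E1 E2 !ltNge !(dyadic_le _ kn ax xa).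
have e0 : (0 < 2 ^ (n - k.+1))%N by rewrite expn_gt0.
rewrite -!leq_divRL//; set b := (a %/ _)%N.
case: (eqVneq b i.*2) => [->|b1]; first by rewrite leqnn ltnn.
case: (eqVneq b i.*2.+1) => [->|b2]; first by rewrite leqnSn leqnn ltnn.
case: (leqP i.*2 b) => h1 /=; last by rewrite (leqNgt i.*2.+1) (leq_trans h1).
have -> /= : (i.*2 < b)%N by lia.
by have -> : (i.*2.+1 < b)%N by lia.
Qed.

Lemma hv_shift n N k i a : (k < n)%N -> hv (n + N) k i a = hv n k i (a %/ 2 ^ N).
Proof.
by move=> kn; rewrite /hv -divnMA -expnD (_ : (N + (n - k.+1) = n + N - k.+1)%N)//; lia.
Qed.

Lemma hvS n k i a : (k < n)%N -> hv n.+1 k i a = hv n k i a./2.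
Proof. by move=> kn; have := @hv_shift n 1 k i a kn; rewrite addn1 expn1 divn2. Qed.

Lemma hv_last n i a : hv n.+1 n i a = (i == a./2)%:R * (-1) ^+ (odd a).
Proof.
rewrite /hv subnn divn1; have := odd_double_half a.
case: (eqVneq i a./2) => [->|ne]; case: (odd a) => /= H.
- by rewrite -{1}H add1n eq_sym ltn_eqF// -{1}H add1n eqxx mul1r.
- by rewrite -{1}H add0n eqxx mul1r.
- rewrite mul0r; case: eqP => [h|_]; first lia.
  by case: eqP => [h|_]//; lia.
- rewrite mul0r; case: eqP => [h|_]; first lia.
  by case: eqP => [h|_]//; lia.
Qed.

(** Reproducing kernel of the mean zero functions on [2 ^ n] points. Inductively, the finest level
    contributes plus or minus [2 ^ n] for points with the same parent, which refines the indicator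
    of equal parents to that of equal points. *)
Lemma hv_kernel n a b : (a < 2 ^ n)%N -> (b < 2 ^ n)%N ->
  \sum_(k < n) \sum_(i < 2 ^ k) (2 ^ k)%:R * (hv n k i a * hv n k i b) =
  (2 ^ n)%:R * (a == b)%:R - 1.
Proof.
elim: n a b => [|n IH] a b.
  rewrite big_ord0 expn0 !ltnS !leqn0 => /eqP -> /eqP ->; by rewrite eqxx mulr1 subrr.
move=> an bn; rewrite big_ord_recr/=.
have an' : (a./2 < 2 ^ n)%N by move: an; rewrite expnS; have := odd_double_half a; lia.
have bn' : (b./2 < 2 ^ n)%N by move: bn; rewrite expnS; have := odd_double_half b; lia.
have -> : \sum_(k < n) \sum_(i < 2 ^ k) (2 ^ k)%:R * (hv n.+1 k i a * hv n.+1 k i b) =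
   (2 ^ n)%:R * (a./2 == b./2)%:R - 1 :> R.
  rewrite -IH//; apply: eq_bigr => k _; apply: eq_bigr => i _.
  by rewrite !hvS.
have -> : \sum_(i < 2 ^ n) (2 ^ n)%:R * (hv n.+1 n i a * hv n.+1 n i b) =
   (2 ^ n)%:R * ((a./2 == b./2)%:R * ((-1) ^+ odd a * (-1) ^+ odd b)) :> R.
  rewrite -mulr_sumr; congr (_ * _).
  rewrite (bigD1 (Ordinal an'))//= !hv_last eqxx big1 ?addr0 => [|i].
    by case: eqP => _; rewrite ?mul1r ?mul0r ?mulr0.
  by rewrite -val_eqE/= hv_last => /negbTE ->; rewrite !mul0r.
have -> : (a == b) = (a./2 == b./2) && (odd a == odd b).
  apply/eqP/andP => [->//|[/eqP h1 /eqP h2]].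
  by rewrite -(odd_double_half a) -(odd_double_half b) h1 h2.
rewrite expnS natrM; case: eqP => _ /=; last by rewrite mul0r !mulr0; lra.
by case: (odd a); case: (odd b) => /=; rewrite ?expr0 ?expr1; lra.
Qed.

(** The kernel of all levels minus that of the first [n]; the latter sees only the group
    [a %/ 2 ^ N]. It is the source of the trace and total terms in [lamB_tr]. *)
Lemma hv_kernel_tail n N a b : (a < 2 ^ (n + N))%N -> (b < 2 ^ (n + N))%N ->
  \sum_(n <= k < n + N) \sum_(i < 2 ^ k) (2 ^ k)%:R * (hv (n + N) k i a * hv (n + N) k i b) =
  (2 ^ (n + N))%:R * (a == b)%:R - (2 ^ n)%:R * (a %/ 2 ^ N == b %/ 2 ^ N)%N%:R.
Proof.
move=> an bn; have := hv_kernel an bn.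
rewrite -(big_mkord xpredT (fun k => \sum_(i < 2 ^ k) (2 ^ k)%:R * (hv (n + N) k i a * hv (n + N) k i b))).
rewrite (big_cat_nat (n := n))//=; last exact: leq_addr.
have -> : \sum_(0 <= k < n) \sum_(i < 2 ^ k) (2 ^ k)%:R * (hv (n + N) k i a * hv (n + N) k i b) =
   (2 ^ n)%:R * (a %/ 2 ^ N == b %/ 2 ^ N)%N%:R - 1 :> R.
  rewrite big_mkord -hv_kernel; try by rewrite ltn_divLR ?expn_gt0// -expnD.
  by apply: eq_bigr => k _; apply: eq_bigr => i _; rewrite !hv_shift.
by move=> H; apply/eqP; rewrite eq_sym -subr_eq0; move/eqP: H; rewrite -subr_eq0 => /eqP H; apply/eqP; lra.
Qed.

Lemma sum_double n (F : nat -> R) :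
  \sum_(a < 2 ^ n.+1) F a = \sum_(c < 2 ^ n) (F c.*2 + F c.*2.+1).
Proof.
rewrite -(big_mkord xpredT F) -(big_mkord xpredT (fun c => F c.*2 + F c.*2.+1)) expnS mul2n.
elim: (2 ^ n)%N => [|m IH]; first by rewrite !big_geq.
by rewrite doubleS big_nat_recr//= big_nat_recr//= IH [RHS]big_nat_recr//= addrA.
Qed.

Lemma avg_hv n k i : (k < n)%N -> avg n (hv n k i) = 0.
Proof.
move=> kn; rewrite /avg; suff -> : \sum_(a < 2 ^ n) hv n k i a = 0 by rewrite mulr0.
elim: n kn => [//|n IH]; rewrite ltnS leq_eqVlt => /orP[/eqP ->|kn].
  rewrite sum_double; apply: big1 => c _; rewrite !hv_last /= odd_double /= doubleK uphalf_double.
  by rewrite expr0 expr1; lra.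
rewrite sum_double; transitivity (\sum_(c < 2 ^ n) 2 * hv n k i c); last by rewrite -mulr_sumr IH// mulr0.
apply: eq_bigr => c _; rewrite !hvS//= doubleK uphalf_double; lra.
Qed.

(** The finest Haar function at the parent of [a] is nonzero only on the two children of that
    parent, and its sign there is the parity. *)
Lemma hv_inj n a a' : (a < 2 ^ n.+1)%N -> (a' < 2 ^ n.+1)%N ->
  hv n.+1 n a./2 a = hv n.+1 n a./2 a' -> a = a'.
Proof.
have N1 : (-1 : R) <> 1 by move=> ?; lra.
have N2 : (1 : R) <> -1 by move=> ?; lra.
move=> an an'; rewrite !hv_last eqxx mul1r; case: eqP => [h|_]; last first.
  by rewrite mul0r => /eqP; rewrite signr_eq0.
rewrite mul1r => /eqP H; rewrite -(odd_double_half a) -(odd_double_half a') h; congr (_ + _)%N.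
by move: H; case: (odd a); case: (odd a') => //=; rewrite ?expr0 ?expr1 => /eqP.
Qed.

Lemma hv_expand n (u : nat -> R) a : avg n u = 0 -> (a < 2 ^ n)%N ->
  u a = \sum_(k < n) \sum_(i < 2 ^ k) ((2 ^ k)%:R * avg n (fun b => u b * hv n k i b)) * hv n k i a.
Proof.
move=> u0 an.
transitivity (avg n (fun b => u b * ((2 ^ n)%:R * (a == b)%:R - 1))).
  transitivity (avg n (fun b => (2 ^ n)%:R * (u b * (b == a)%:R)) - avg n u); last first.
    by rewrite -avgB; apply: eq_avg => b _; rewrite mulrBr mulr1 mulrCA eq_sym.
  rewrite u0 subr0 avgZ /avg mulrA mulfV ?two_pow_neq0// mul1r.
  rewrite (bigD1 (Ordinal an))//= eqxx mulr1 big1 ?addr0// => b.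
  by rewrite -val_eqE/= => /negbTE ->; rewrite mulr0.
transitivity (avg n (fun b => u b * \sum_(k < n) \sum_(i < 2 ^ k) (2 ^ k)%:R * (hv n k i a * hv n k i b))).
  by apply: eq_avg => b bn; rewrite hv_kernel.
rewrite /avg mulr_sumr.
under eq_bigr => b _ do rewrite mulr_sumr mulr_sumr.
rewrite exchange_big; apply: eq_bigr => k _ /=.
under eq_bigr => b _ do rewrite mulr_sumr mulr_sumr.
rewrite exchange_big; apply: eq_bigr => i _ /=.
rewrite mulr_sumr mulr_sumr mulr_suml; apply: eq_bigr => b _; ring.
Qed.

End HaarLabels.

(** * Labels read off from the given Haar families *)

Section LabelsOfHaar.
Context {R : realType}.
Local Notation lam := (@lebesgue_measure R).
Local Notation I01 := (@I01 R).
Implicit Types (f g : R -> R) (p q r : R) (X Y Z : nat -> R -> nat).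
Variable h : nat -> nat -> nat -> R -> R.
Hypothesis mh : forall n k i, measurable_fun I01 (h n k i).
Hypothesis lawh : forall n, (0 < n)%N -> same_joint_law n (h n) haar.
Hypothesis indh : blocks_independent h.

Definition atomb n a x : bool :=
  [forall k : 'I_n, [forall i : 'I_(2 ^ k), h n k i x == hv n k i a]].

Lemma atombP n a x : reflect
  (forall k i, (k < n)%N -> (i < 2 ^ k)%N -> h n k i x = hv n k i a) (atomb n a x).
Proof.
apply: (iffP forallP) => H.
  by move=> k i kn ik; have /forallP/(_ (Ordinal ik))/eqP := H (Ordinal kn).
by move=> k; apply/forallP => i; apply/eqP; exact: H.
Qed.

Lemma atomb_inj n a a' x : (a < 2 ^ n)%N -> (a' < 2 ^ n)%N -> atomb n a x -> atomb n a' x -> a = a'.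
Proof.
case: n => [|n]; first by rewrite expn0 !ltnS !leqn0 => /eqP -> /eqP ->.
move=> an an' /atombP H1 /atombP H2; apply: (hv_inj (R := R) an an').
have a2 : (a./2 < 2 ^ n)%N by move: an; rewrite expnS; have := odd_double_half a; lia.
by rewrite -(H1 n a./2)// -(H2 n a./2).
Qed.

(** Almost every point lies in exactly one atom; the value 0 elsewhere keeps the label below [2 ^ n]
    at every point. *)
Definition XL n x : nat := if [pick a : 'I_(2 ^ n) | atomb n a x] is Some a then a else 0%N.

Lemma XL_lt n x : (XL n x < 2 ^ n)%N.
Proof. by rewrite /XL; case: pickP => [a _|_]; [exact: ltn_ord|rewrite expn_gt0]. Qed.

Lemma XL_atom n a x : (a < 2 ^ n)%N -> atomb n a x -> XL n x = a.
Proof.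
move=> an H; rewrite /XL; case: pickP => [b Hb|/(_ (Ordinal an))]; last by rewrite /= H.
exact: (atomb_inj _ _ Hb H).
Qed.

Lemma atom_sum n x : \sum_(a < 2 ^ n) (atomb n a x)%:R =
  ([exists a : 'I_(2 ^ n), atomb n a x])%:R :> R.
Proof.
case: existsP => [[a Ha]|H].
  rewrite (bigD1 a)//= Ha big1 ?addr0// => b ba; case Hb: (atomb n b x) => //.
  by move: ba; rewrite -val_eqE/= (atomb_inj (ltn_ord b) (ltn_ord a) Hb Ha) eqxx.
by rewrite big1// => a _; case Ha: (atomb n a x) => //; exfalso; apply: H; exists a.
Qed.

Lemma XL_ind n a x : (a < 2 ^ n)%N -> (XL n x == a)%:R =
  (atomb n a x)%:R + (a == 0%N)%:R * (1 - \sum_(b < 2 ^ n) (atomb n b x)%:R) :> R.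
Proof.
move=> an; rewrite atom_sum; case: existsP => [[b Hb]|H].
  rewrite subrr mulr0 addr0 (XL_atom (ltn_ord b) Hb); congr (_%:R).
  case: (eqVneq (b : nat) a) => [<-|ba]; first by rewrite Hb.
  case Ha: (atomb n a x) => //.
  by move: ba; rewrite (atomb_inj (ltn_ord b) an Hb Ha) eqxx.
have N b : (b < 2 ^ n)%N -> atomb n b x = false.
  by move=> bn; apply/negbTE/negP => Hb; apply: H; exists (Ordinal bn).
rewrite N// subr0 add0r mulr1; congr (_%:R); rewrite /XL; case: pickP => [b Hb|_].
  by exfalso; apply: H; exists b.
by rewrite eq_sym.
Qed.

Lemma eq_ind_meas n k i (v : R) : measurable_fun I01 (fun x => (h n k i x == v)%:R : R).
Proof.
have -> : (fun x => (h n k i x == v)%:R) = (fun x => \1_[set v] (h n k i x) : R).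
  apply/funext => x; rewrite indicE; congr (_%:R); case: (eqVneq (h n k i x) v) => H.
    by rewrite mem_set.
  by rewrite memNset// => /eqP; rewrite (negbTE H).
by apply: (measurableT_comp _ (mh n k i)); apply: measurable_indic; exact: measurable_set1.
Qed.

Lemma atomb_prod n a x : (atomb n a x)%:R =
  \prod_(k < n) \prod_(i < 2 ^ k) (h n k i x == hv n k i a)%:R :> R.
Proof.
have nat_all (I : finType) (P : pred I) : ([forall i, P i])%:R = \prod_(i : I) (P i)%:R :> R.
  case: forallP => [H|H]; first by rewrite big1// => i _; rewrite H.
  have /existsP[i Pi] : [exists i, ~~ P i] by rewrite -negb_forall; apply/forallP.
  by rewrite (bigD1 i)//= (negbTE Pi) mul0r.
by rewrite /atomb nat_all; apply: eq_bigr => k _; rewrite nat_all.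
Qed.

Lemma atomb_meas n a : measurable_fun I01 (fun x => (atomb n a x)%:R : R).
Proof.
under eq_fun do rewrite atomb_prod.
apply: measurable_prod => k _; apply: measurable_prod => i _; exact: eq_ind_meas.
Qed.

Lemma atomb_L1 n a : L1 (fun x => (atomb n a x)%:R).
Proof.
apply: (@L1_bounded _ _ 1); first exact: atomb_meas.
by move=> x _; case: (atomb n a x); rewrite ?normr1 ?normr0.
Qed.

Definition atomset n a : set R := I01 `&` [set x | atomb n a x].

Lemma atomsetE n a : atomset n a = I01 `&` \bigcap_(k in [set k | (k < n)%N])
  \bigcap_(i in [set i | (i < 2 ^ k)%N]) (h n k i @^-1` [set hv n k i a]).
Proof.
apply/seteqP; split=> x [xI H]; split=> //.
  by move=> k /= kn i /= ik; move/atombP: H => H; exact: H.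
by apply/atombP => k i kn ik; exact: (H k kn i ik).
Qed.

Lemma dyadic_atom (n : nat) (x : R) : 0 <= x -> x < 1 ->
  exists a, [/\ (a < 2 ^ n)%N, a%:R / (2 ^ n)%:R <= x & x < a.+1%:R / (2 ^ n)%:R].
Proof.
move=> x0 x1; pose a := Num.truncn (x * (2 ^ n)%:R).
have y0 : 0 <= x * (2 ^ n)%:R by rewrite mulr_ge0.
have /andP[h1 h2] := truncn_itv y0; exists a; split.
- rewrite -(ltr_nat R); apply: le_lt_trans h1 _.
  by rewrite gtr_pMl// two_pow_gt0.
- by rewrite ler_pdivrMr// two_pow_gt0.
- by rewrite ltr_pdivlMr// two_pow_gt0.
Qed.

(** The endpoint 1 belongs to [I01] but to no dyadic interval; this excludes it from the atoms in
    [lam_atomset]. *)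
Lemma haar_one k i : (i < 2 ^ k)%N -> haar k i 1 = 0 :> R.
Proof.
move=> ik; rewrite /haar.
have m1 : (i.*2.+1)%:R / (2 ^ k.+1)%:R <= 1 :> R.
  by rewrite ler_pdivrMr ?two_pow_gt0// mul1r ler_nat expnS; lia.
have b1 : i.+1%:R / (2 ^ k)%:R <= 1 :> R.
  by rewrite ler_pdivrMr ?two_pow_gt0// mul1r ler_nat.
by rewrite ltNge m1 andbF ltNge b1 andbF.
Qed.

Lemma lam_atomset n a : (0 < n)%N -> (a < 2 ^ n)%N -> lam (atomset n a) = ((2 ^ n)%:R^-1)%:E.
Proof.
case: n => [//|n] n0 an; rewrite atomsetE.
have := lawh n0 (B := fun k i => [set hv n.+1 k i a]) (fun k i => measurable_set1 _).
move=> ->.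
pose l : R := a%:R / (2 ^ n.+1)%:R; pose u : R := a.+1%:R / (2 ^ n.+1)%:R.
have -> : I01 `&` \bigcap_(k in [set k | (k < n.+1)%N])
  \bigcap_(i in [set i | (i < 2 ^ k)%N]) (haar k i @^-1` [set hv n.+1 k i a]) = `[l, u[%classic.
  have l0 : 0 <= l by rewrite divr_ge0.
  have u1 : u <= 1 by rewrite ler_pdivrMr ?two_pow_gt0// mul1r ler_nat.
  apply/seteqP; split=> x; last first.
    rewrite /= in_itv/= => /andP[lx xu]; split.
      by rewrite /Defs.I01/= in_itv/=; apply/andP; split; [exact: le_trans lx|exact/ltW/(lt_le_trans xu)].
    by move=> k /= kn i /= ik; apply: haar_hv.
  move=> [xI H]; move: xI; rewrite /Defs.I01/= in_itv/= => /andP[x0 x1].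
  have {}H k i : (k < n.+1)%N -> (i < 2 ^ k)%N -> haar k i x = hv n.+1 k i a by move=> kn ik; exact: (H k kn i ik).
  have a2 : (a./2 < 2 ^ n)%N by move: an; rewrite expnS; have := odd_double_half a; lia.
  have xlt1 : x < 1.
    rewrite lt_neqAle x1 andbT; apply/eqP => x1'; have := H n a./2 (ltnSn n) a2.
    rewrite x1' haar_one// hv_last eqxx mul1r => /esym/eqP; by rewrite signr_eq0.
  have [b [bn bx xb]] := dyadic_atom n.+1 x0 xlt1.
  have ab : a = b.
    apply: (hv_inj (R := R) an bn); rewrite -(haar_hv _ (ltnSn n) bx xb).
    by rewrite H.
  by rewrite in_itv/= /l /u ab bx xb.
rewrite lebesgue_measure_itv/= lte_fin.
have -> : l < u by rewrite ltr_pM2r ?invr_gt0 ?two_pow_gt0// ltr_nat.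
by rewrite -EFinB /l /u -mulrBl -natr1 addrAC subrr add0r mul1r.
Qed.

Lemma Ex_ind_set (P : R -> bool) : L1 (fun x => (P x)%:R) ->
  lam (I01 `&` [set x | P x]) = (Ex (fun x => (P x)%:R))%:E.
Proof.
move=> P1; have mP : measurable_fun I01 (fun x => (P x)%:R : R) := L1_meas P1.
have := law_Ex mP (measurable_set1 (1 : R)); rewrite /law.
have -> : I01 `&` (fun x => (P x)%:R : R) @^-1` [set 1] = I01 `&` [set x | P x].
  apply/seteqP; split=> x [xI /= H]; split=> //=; last by rewrite H.
  by move: H; case: (P x) => //= /eqP; rewrite eq_sym oner_eq0.
move=> ->; congr (_%:E); apply: eq_Ex => x _; rewrite indicE.
case: (P x); first by rewrite mem_set.
by rewrite memNset//= => /eqP; rewrite eq_sym oner_eq0.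
Qed.

Lemma Ex_atom n a : (a < 2 ^ n)%N -> Ex (fun x => (atomb n a x)%:R) = (2 ^ n)%:R^-1 :> R.
Proof.
move=> an; case: (posnP n) => [n0|n0].
  subst n; rewrite expn0 invr1 -[RHS]Ex_cst; apply: eq_Ex => x _.
  by case: atombP => // H; exfalso; apply: H.
have := Ex_ind_set (atomb_L1 n a); rewrite -/(atomset n a) lam_atomset// => -[->] //.
Qed.

(** There are [2 ^ n] disjoint atoms of measure [2 ^ - n], so the indicator [G] of their complement
    has mean 0. *)
Lemma atom_ae n : {ae lam, forall x, I01 x -> [exists a : 'I_(2 ^ n), atomb n a x]}.
Proof.
pose G x : R := 1 - \sum_(a < 2 ^ n) (atomb n a x)%:R.
have G1 : L1 G by apply: L1B; [exact: L1_cst|apply: L1_sum => a _; exact: atomb_L1].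
have Gn x : `|G x| = G x by rewrite /G atom_sum; case: [exists _, _]; rewrite ?subrr ?subr0 ?normr0 ?normr1.
have GE : Ex G = 0.
  rewrite /G ExB; [|exact: L1_cst|by apply: L1_sum => a _; exact: atomb_L1].
  rewrite Ex_cst Ex_sum; last by move=> a _; exact: atomb_L1.
  under eq_bigr => a _ do rewrite Ex_atom//.
  by rewrite sumr_const card_ord -[_ *+ _]mulr_natl mulfV ?subrr// two_pow_neq0.
have Gp : inLp 1 G.
  apply/inLpP; split; first exact: L1_meas.
  by apply: eq_L1 (L1_norm G1) => x _; rewrite powRr1.
have : nrm 1 G = 0.
  rewrite nrmE invr1 powRr1 ?Expow_ge0// -GE; apply: eq_Ex => x _.
  by rewrite powRr1// Gn.
move=> /(nrm0_ae ltr01 Gp); apply: ae_imp => x H xI; move: (H xI); rewrite /G atom_sum.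
by case: [exists _, _] => //; rewrite subr0 => /eqP; rewrite oner_eq0.
Qed.

Lemma sigma_setI (D : set R) (G : set (set R)) A B : (forall C, G C -> C `<=` D) ->
  <<s D, G >> A -> <<s D, G >> B -> <<s D, G >> (A `&` B).
Proof.
move=> GD; have [_ _ _ I] : [/\ <<s D, G >> D, setSD_closed <<s D, G >>, ndseq_closed <<s D, G >> & setI_closed <<s D, G >>].
  apply/sigma_algebraP; last exact: smallest_sigma_algebra.
  move=> C /(_ [set C' | C' `<=` D]); apply; split; last exact: GD.
  split=> [|A' _|F FD]; [exact: sub0set|exact: subDsetl|].
  by apply: bigcup_sub => i _; exact: FD.
exact: I.
Qed.

Lemma sigma_atom n a : (0 < n)%N -> block_sigma h n (atomset n a).
Proof.
move=> n0; rewrite /block_sigma.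
have GD C : block_gen h n C -> C `<=` I01 by move=> [k [i [B [_ _ _ ->]]]]; exact: subIsetl.
have D1 : <<s I01, block_gen h n >> I01.
  by rewrite -[X in <<s _, _ >> X](setD0 I01); apply: sigma_algebraCD; exact: sigma_algebra0.
pose P k i x := h n k i x == hv n k i a.
have genP k i : (k < n)%N -> (i < 2 ^ k)%N -> <<s I01, block_gen h n >> (I01 `&` [set x | P k i x]).
  move=> kn ik; apply: sub_sigma_algebra; exists k, i, [set hv n k i a]; split=> //.
  by apply/seteqP; split=> x [xI H]; split=> //; [exact/eqP|exact/eqP].
have step (I : Type) (s : seq I) (Q : I -> R -> bool) : (forall i, <<s I01, block_gen h n >> (I01 `&` [set x | Q i x])) ->
    <<s I01, block_gen h n >> (I01 `&` [set x | all (Q ^~ x) s]).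
  move=> HQ; elim: s => [|i s IH] /=.
    by rewrite (_ : [set _ | _] = setT) ?setIT//; apply/seteqP; split.
  rewrite (_ : _ `&` _ = (I01 `&` [set x | Q i x]) `&` (I01 `&` [set x | all (Q ^~ x) s])).
    exact: sigma_setI.
  apply/seteqP; split=> x /=; first by move=> [xI /andP[]].
  by move=> [[xI q1] [_ q2]]; split=> //; rewrite q1.
have -> : atomset n a = I01 `&` [set x | all (fun k : 'I_n => all (fun i : 'I_(2 ^ k) => P k i x) (enum 'I_(2 ^ k))) (enum 'I_n)].
  apply/seteqP; split=> x [xI H]; split=> //.
    by apply/allP => k _; apply/allP => i _; apply/eqP; move/atombP: H; apply.
  apply/atombP => k i kn ik; apply/eqP.
  have /allP/(_ (Ordinal ik)) := (allP H) (Ordinal kn) (mem_enum _ _); apply; exact: mem_enum.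
apply: (step _ _ (fun (k : 'I_n) x => all (fun i : 'I_(2 ^ k) => P k i x) (enum 'I_(2 ^ k)))) => k.
by apply: (step _ _ (fun (i : 'I_(2 ^ k)) x => P k i x)) => i; exact: genP.
Qed.

Lemma labels_XL : labels XL.
Proof.
have ind_bound b : `|(b : bool)%:R| <= 1 :> R by case: b; rewrite ?normr1 ?normr0.
have indae n a : (a < 2 ^ n)%N -> ae01 (fun x => (XL n x == a)%:R) (fun x => (atomb n a x)%:R).
  by move=> an; apply: ae_imp (atom_ae n) => x H xI; rewrite XL_ind// atom_sum H// subrr mulr0 addr0.
have mX n a : measurable_fun I01 (fun x => (XL n x == a)%:R : R).
  have [an|an] := ltnP a (2 ^ n).
    under eq_fun do rewrite XL_ind//.
    apply: measurable_funD; first exact: atomb_meas.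
    apply: measurable_funM; first exact: measurable_cst.
    apply: measurable_funB; first exact: measurable_cst.
    by apply: measurable_sum => b; exact: atomb_meas.
  rewrite (_ : (fun x => _) = cst 0); first exact: measurable_cst.
  apply/funext => x; case: eqP => // H; exfalso.
  by have := XL_lt n x; rewrite H ltnNge an.
split=> //; first exact: XL_lt.
move=> N t tP.
have mprod (F : nat -> R -> R) : (forall i, measurable_fun I01 (F i)) ->
    measurable_fun I01 (fun x => \prod_(i < N) F i x).
  by move=> mF; apply: measurable_prod => i _; exact: mF.
transitivity (Ex (fun x => \prod_(i < N) (atomb i (t i) x)%:R) : R).
  apply: ae_Ex; [by apply: (mprod (fun i x => (XL i x == t i)%:R)) => i; exact: mX|by apply: (mprod (fun i x => (atomb i (t i) x)%:R)) => i; exact: atomb_meas|].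
  have : forall M, (M <= N)%N -> ae01 (fun x => \prod_(i < M) (XL i x == t i)%:R) (fun x => \prod_(i < M) (atomb i (t i) x)%:R).
    elim=> [|M IH] MN; first by apply: aeW => x _; rewrite !big_ord0.
    apply: ae_imp2 (IH (ltnW MN)) (indae M (t M) (tP M MN)) => x H1 H2 xI.
    by rewrite !big_ord_recr/= H1// H2.
  by apply.
case: N tP mprod => [|N] tP mprod.
  by rewrite big_ord0 -[RHS]Ex_cst; apply: eq_Ex => x _; rewrite big_ord0.
(* Block 0 contains no Haar function and [blocks_independent] concerns positive indices only; its
   factor is identically 1 and is split off. *)
pose P x := all (fun i => atomb i (t i) x) (iota 1 N).
have PE x : \prod_(i < N.+1) (atomb i (t i) x)%:R = (P x)%:R :> R.
  rewrite big_ord_recl /=.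
  have -> : atomb 0 (t 0%N) x by apply/atombP.
  rewrite mul1r -(big_mkord xpredT (fun i => (atomb i.+1 (t i.+1) x)%:R)) /P.
  have -> : iota 1 N = map S (iota 0 N) by rewrite -(iotaDl 1 0 N).
  rewrite /index_iota subn0; elim: (iota 0 N) => [|i s IH]; first by rewrite big_nil.
  by rewrite big_cons IH/=; case: (atomb _ _ _); rewrite ?mul1r ?mul0r.
have mP : measurable_fun I01 (fun x => (P x)%:R : R).
  under eq_fun do rewrite -PE.
  by apply: (mprod (fun i x => (atomb i (t i) x)%:R)) => i; exact: atomb_meas.
have P1 : L1 (fun x => (P x)%:R) by apply: (@L1_bounded _ _ 1).
rewrite (eq_Ex (fun x _ => PE x)).
have := Ex_ind_set P1.
have -> : I01 `&` [set x | P x] = I01 `&` \bigcap_(n in [set n | n \in iota 1 N]) atomset n (t n).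
  apply/seteqP; split=> x [xI H]; split=> //.
    by move=> n /= nN; split=> //; exact: (allP H n nN).
  by apply/allP => n nN; case: (H n nN).
rewrite indh; first last.
- by move=> n; rewrite mem_iota => /andP[n0 _]; exact: sigma_atom.
- by move=> n; rewrite mem_iota => /andP[].
- exact: iota_uniq.
have -> : (\prod_(n <- iota 1 N) lam (atomset n (t n)) = (\prod_(n <- iota 1 N) (2 ^ n)%:R^-1)%:E)%E.
  rewrite big_seq_cond [in RHS]big_seq_cond.
  elim/big_ind2: _ => [//|x1 y1 x2 y2 -> ->|n]; first by rewrite EFinM.
  rewrite andbT mem_iota => /andP[n0 nN]; apply: lam_atomset => //; apply: tP; lia.
move=> [<-]; rewrite big_ord_recl expn0 invr1 mul1r.
have -> : iota 1 N = map S (iota 0 N) by rewrite -(iotaDl 1 0 N).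
rewrite big_map -(big_mkord xpredT (fun i => ((2 ^ i.+1)%:R^-1 : R))).
by rewrite /index_iota subn0.
Qed.

Lemma h_ae n k i : (k < n)%N -> (i < 2 ^ k)%N -> ae01 (h n k i) (fun x => hv n k i (XL n x)).
Proof.
move=> kn ik; apply: ae_imp (atom_ae n) => x H xI; have /existsP[a Ha] := H xI.
by rewrite (XL_atom (ltn_ord a) Ha); move/atombP: Ha; apply.
Qed.

Definition comb N (c : nat -> nat -> nat -> R) (x : R) : R :=
  \sum_(n < N) \sum_(k < n) \sum_(i < 2 ^ k) c n k i * h n k i x.

Definition combu (c : nat -> nat -> nat -> R) n a : R :=
  \sum_(k < n) \sum_(i < 2 ^ k) c n k i * hv n k i a.

Lemma avg_combu c n : avg n (combu c n) = 0.
Proof.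
rewrite /avg; suff -> : \sum_(a < 2 ^ n) combu c n a = 0 by rewrite mulr0.
rewrite /combu exchange_big big1// => k _; rewrite exchange_big big1// => i _ /=.
rewrite -mulr_sumr; have := avg_hv (R := R) i (ltn_ord k); rewrite /avg => /eqP.
by rewrite mulf_eq0 invr_eq0 (negbTE (two_pow_neq0 n))/= => /eqP ->; rewrite mulr0.
Qed.

Lemma ae01_sum (I : eqType) (s : seq I) (F G : I -> R -> R) : (forall i, i \in s -> ae01 (F i) (G i)) ->
  ae01 (fun x => \sum_(i <- s) F i x) (fun x => \sum_(i <- s) G i x).
Proof.
elim: s => [|i s IH] H; first by apply: aeW => x _; rewrite !big_nil.
apply: ae_imp2 (H i (mem_head _ _)) (IH _) => [x H1 H2 xI|j js].
  by rewrite !big_cons H1// H2.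
by apply: H; rewrite inE js orbT.
Qed.

Lemma comb_ae N c : ae01 (comb N c) (Ssum XL (combu c) N).
Proof.
apply: ae01_sum => n _; apply: ae01_sum => k _; apply: ae01_sum => i _.
apply: (ae01_comp (fun _ y => c n k i * y)); exact: h_ae.
Qed.

Lemma comb_meas N c : measurable_fun I01 (comb N c).
Proof.
apply: measurable_sum => n; apply: measurable_sum => k; apply: measurable_sum => i.
by apply: measurable_funM => //; exact: measurable_cst.
Qed.

Lemma comb_inLp p N c : 0 <= p -> inLp p (comb N c).
Proof.
move=> p0; apply: ae_inLp (comb_meas N c) (ae01_sym (comb_ae N c)) _.
by apply: Ssum_inLp => //; exact: labels_XL.
Qed.

(** Linear combinations of the Haar functions of a block are exactly the mean zero functions of its
    label: [avg_combu] gives one direction, [hv_expand] the other. *)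
Lemma RXE p : 1 < p -> RX p h = Zspan p XL.
Proof.
move=> p1; have p1' := ltW p1; have p0 : 0 <= p by lra.
apply/seteqP; split=> f [fp H]; split=> // e e0.
  have [N [c Hc]] := H e e0; exists N, (combu c); split; first exact: avg_combu.
  have [d _] := inLpB p1' fp (comb_inLp N c p0).
  move: Hc; rewrite -/(comb N c) pnormE// lte_fin => /ltW; apply: le_trans.
  rewrite le_eqVlt; apply/orP; left; apply/eqP; apply: ae_nrm.
  - by apply: measurable_funB; [exact: inLp_meas fp|exact: inLp_meas (Ssum_inLp labels_XL _ _ p0)].
  - exact: inLp_meas d.
  - by apply: (ae01_comp (fun x y => f x - y)); apply: ae01_sym; exact: comb_ae.
have [N [u [u0 Hu]]] := H (e / 2) (divr_gt0 e0 (ltr0n R 2)).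
pose c n k i : R := (2 ^ k)%:R * avg n (fun b => u n b * hv n k i b).
exists N, c; have [d _] := inLpB p1' fp (comb_inLp N c p0).
rewrite -/(comb N c) pnormE// lte_fin; apply: (@le_lt_trans _ _ (e / 2)); last lra.
apply: le_trans Hu; rewrite le_eqVlt; apply/orP; left; apply/eqP; apply: ae_nrm.
- exact: inLp_meas d.
- by apply: measurable_funB; [exact: inLp_meas fp|exact: inLp_meas (Ssum_inLp labels_XL _ _ p0)].
- apply: (ae01_comp (fun x y => f x - y)); apply: ae01_trans (comb_ae N c) _.
  apply: aeW => x _; apply: eq_bigr => n _; rewrite (hv_expand (u0 n) (XL_lt n x)).
  by [].
Qed.

End LabelsOfHaar.

(** * Independent random permutations *)

Section RandomPerm.
Context {R : realType}.
Variables (G L : finType).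
Hypothesis L1 : (1 < #|L|)%N.
Local Notation S := {perm L}.
Local Notation Th := {ffun G -> S}.
Variable M : G -> L -> G -> L -> R.

Definition upd (th : Th) g s : Th := [ffun k => if k == g then s else th k].

(** Multiplying the [g]-th permutation by a fixed [s] is a bijection of the family of permutations;
    averaging over [s] as well leaves inner sums over coordinate [g] alone, which vanish. *)
Lemma sum_upd_eq0 (F : Th -> R) g : (forall th, \sum_(s : S) F (upd th g s) = 0) ->
  \sum_(th : Th) F th = 0.
Proof.
move=> H; pose shift (s : S) (th : Th) : Th := upd th g (th g * s)%g.
have shift_inj s : injective (shift s).
  move=> t1 t2 /ffunP E; apply/ffunP => k; have := E k; rewrite !ffunE.
  by case: eqP => [-> /mulIg|].
have : \sum_(s : S) \sum_(th : Th) F th = 0.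
  transitivity (\sum_(s : S) \sum_(th : Th) F (shift s th)).
    by apply: eq_bigr => s _; rewrite (reindex_inj (shift_inj s)).
  rewrite exchange_big big1// => th _ /=.
  by rewrite -[RHS](H th) [RHS](reindex_inj (mulgI (th g))).
rewrite sumr_const => /eqP; rewrite mulrn_eq0 => /orP[|/eqP//].
by rewrite -[#|_|]/(#|S|) cardE; have := mem_enum S 1%g; case: (enum S).
Qed.

Section Pair.
Variables x y : L -> R.
Hypothesis x0 : \sum_a x a = 0.
Hypothesis y0 : \sum_a y a = 0.

(** The part of the bilinear form with matrix [M] coming from the groups [g] and [g'], when [x] and
    [y] are read through the permutations. *)
Definition Qf g g' (s s' : S) : R := \sum_a \sum_b x (s a) * y (s' b) * M g a g' b.

Lemma sum_perm (z : L -> R) (s : S) : \sum_a z (s a) = \sum_a z a.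
Proof. by rewrite [RHS](reindex_inj (@perm_inj _ s)). Qed.

Lemma sum_perm_pt (z : L -> R) a b : \sum_(s : S) z (s a) = \sum_(s : S) z (s b).
Proof.
rewrite (reindex_inj (mulgI (tperm a b))); apply: eq_bigr => s _.
by rewrite permM tpermL.
Qed.

Lemma cardL_neq0 : (#|L|)%:R != 0 :> R.
Proof. by rewrite pnatr_eq0 -lt0n; apply: leq_trans L1. Qed.

Lemma sum_perm_pt0 (z : L -> R) a : \sum_c z c = 0 -> \sum_(s : S) z (s a) = 0.
Proof.
move=> z0; have : \sum_b \sum_(s : S) z (s b) = 0.
  by rewrite exchange_big big1// => s _; rewrite sum_perm.
rewrite (eq_bigr (fun=> \sum_(s : S) z (s a))); last by move=> b _; exact: sum_perm_pt.
by rewrite sumr_const -mulr_natl => /eqP; rewrite mulf_eq0 (negbTE cardL_neq0) => /eqP.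
Qed.

Lemma Qf_sum_l g g' s' : \sum_(s : S) Qf g g' s s' = 0.
Proof.
rewrite /Qf exchange_big big1// => a _; rewrite exchange_big big1// => b _ /=.
by rewrite -!mulr_suml sum_perm_pt0// !mul0r.
Qed.

Lemma Qf_sum_r g g' s : \sum_(s' : S) Qf g g' s s' = 0.
Proof.
rewrite /Qf exchange_big big1// => a _; rewrite exchange_big big1// => b _ /=.
by rewrite -mulr_suml -mulr_sumr sum_perm_pt0// mulr0 mul0r.
Qed.

Definition sxy : R := \sum_a x a * y a.
Definition tr g : R := \sum_a M g a g a.
Definition tot g : R := \sum_a \sum_b M g a g b.
(* The mean of [Qf g g s s] over uniformly random permutations [s]. *)
Definition mug g : R := sxy / (#|L|%:R - 1) * (tr g - tot g / #|L|%:R).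

Lemma sum_xy_diag a : \sum_(s : S) x (s a) * y (s a) = #|S|%:R * sxy / #|L|%:R.
Proof.
have : \sum_b \sum_(s : S) x (s b) * y (s b) = #|S|%:R * sxy.
  rewrite exchange_big /= (eq_bigr (fun=> sxy)); last first.
    by move=> s _; rewrite (sum_perm (fun b => x b * y b)).
  by rewrite sumr_const -[_ *+ _]mulr_natl.
rewrite (eq_bigr (fun=> \sum_(s : S) x (s a) * y (s a))); last first.
  by move=> b _; exact: (sum_perm_pt (fun b => x b * y b)).
by rewrite sumr_const -[_ *+ _]mulr_natl => <-; rewrite mulrAC mulfV ?mul1r// cardL_neq0.
Qed.

(** Double transitivity of the symmetric group: [t] sends [a] to [a'] and [b] to [b'], and the sum
    is invariant under translation by [t]. *)
Lemma sum_xy_off a b a' b' : a != b -> a' != b' ->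
  \sum_(s : S) x (s a) * y (s b) = \sum_(s : S) x (s a') * y (s b').
Proof.
move=> ab ab'; pose c := tperm a a' b.
have ca' : c != a' by rewrite /c -[X in _ != X](tpermL a a') (inj_eq perm_inj) eq_sym.
pose t := (tperm a a' * tperm c b')%g.
have ta : t a = a' by rewrite permM tpermL tpermD// eq_sym.
have tb : t b = b' by rewrite permM -/c tpermL.
rewrite [RHS](eq_bigr (fun s => x ((t * s)%g a) * y ((t * s)%g b))).
  by rewrite [LHS](reindex_inj (mulgI t)).
by move=> s _; rewrite [(t * s)%g a]permM [(t * s)%g b]permM ta tb.
Qed.

Lemma cardL1_neq0 : #|L|%:R - 1 != 0 :> R.
Proof. by rewrite subr_eq0 pnatr_eq1; apply/eqP => H; move: L1; rewrite H. Qed.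

(** Since [y] sums to 0, the [#|L| - 1] equal off-diagonal values cancel the diagonal one. *)
Lemma sum_xy_neq a b : a != b ->
  \sum_(s : S) x (s a) * y (s b) = - (#|S|%:R * sxy / #|L|%:R) / (#|L|%:R - 1).
Proof.
move=> ab.
have : \sum_c \sum_(s : S) x (s a) * y (s c) = 0.
  rewrite exchange_big big1// => s _; by rewrite -mulr_sumr sum_perm y0 mulr0.
rewrite (bigD1 a)//= sum_xy_diag (eq_bigr (fun=> \sum_(s : S) x (s a) * y (s b))); last first.
  by move=> c ca; apply: sum_xy_off; rewrite // eq_sym.
rewrite sumr_const.
have -> : #|[pred i | i != a]| = (#|L| - 1)%N.
  by rewrite cardC1 subn1.
rewrite -[X in _ + X]mulr_natl natrB; last exact: ltnW.
move=> H; apply: (mulfI cardL1_neq0); rewrite mulrCA [in RHS]mulfV ?cardL1_neq0// mulr1.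
by apply/eqP; rewrite -addr_eq0 addrC H.
Qed.

Lemma Qf_sum_diag g : \sum_(s : S) Qf g g s s = #|S|%:R * mug g.
Proof.
rewrite /Qf exchange_big.
under eq_bigr => a _ do rewrite exchange_big.
have E a b : \sum_(s : S) x (s a) * y (s b) * M g a g b =
  (#|S|%:R * sxy / #|L|%:R / (#|L|%:R - 1)) * (#|L|%:R * ((a == b)%:R * M g a g b) - M g a g b).
  rewrite -mulr_suml; case: (eqVneq a b) => [<-|ab].
    rewrite sum_xy_diag mul1r; have := cardL1_neq0; have := cardL_neq0.
    by set n := #|L|%:R; move=> n0 n1; field; rewrite n1 n0.
  rewrite sum_xy_neq// mul0r mulr0 sub0r; ring.
rewrite /= (eq_bigr (fun a => (#|S|%:R * sxy / #|L|%:R / (#|L|%:R - 1)) * (#|L|%:R * M g a g a - \sum_b M g a g b))).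
  rewrite -mulr_sumr sumrB -mulr_sumr -/(tr g) -/(tot g) /mug.
  have := cardL1_neq0; have := cardL_neq0.
  by set n := #|L|%:R; move=> n0 n1; field; rewrite n1 n0.
move=> a _; rewrite (eq_bigr _ (fun b _ => E a b)) -mulr_sumr sumrB -mulr_sumr; congr (_ * (_ * _ - _)).
rewrite (bigD1 a)//= eqxx mul1r big1 ?addr0// => b ba.
by rewrite eq_sym (negbTE ba) mul0r.
Qed.

(** The term of a pair of groups minus its mean; for distinct groups the mean is 0 because [x] and
    [y] sum to 0. *)
Definition qt (P : G * G) (th : Th) : R :=
  Qf P.1 P.2 (th P.1) (th P.2) - (P.1 == P.2)%:R * mug P.1.

Lemma qt_sum0 P j th : (j == P.1) || (j == P.2) -> \sum_(s : S) qt P (upd th j s) = 0.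
Proof.
case: P => g g' /=; rewrite /qt /=; case: (eqVneq g g') => [<-|gg'].
  rewrite orbb => /eqP ->; under eq_bigr => s _ do rewrite !ffunE eqxx mul1r.
  by rewrite sumrB Qf_sum_diag sumr_const -[_ *+ #|_|]mulr_natl subrr.
case/orP => /eqP ->.
  under eq_bigr => s _ do rewrite !ffunE eqxx eq_sym (negbTE gg') mul0r subr0.
  exact: Qf_sum_l.
under eq_bigr => s _ do rewrite !ffunE eqxx (negbTE gg') mul0r subr0.
exact: Qf_sum_r.
Qed.

Lemma qt_indep P j th s : j != P.1 -> j != P.2 -> qt P (upd th j s) = qt P th.
Proof. by move=> j1 j2; rewrite /qt !ffunE eq_sym (negbTE j1) eq_sym (negbTE j2). Qed.

Definition swap (P : G * G) : G * G := (P.2, P.1).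

(* Some index occurs in exactly one of [P] and [P'], and averaging over the permutation
   of that group already gives 0. *)
Lemma qt_orth P P' : P' != P -> P' != swap P -> \sum_(th : Th) qt P th * qt P' th = 0.
Proof.
have half (U V : G * G) j : (j == U.1) || (j == U.2) -> j != V.1 -> j != V.2 ->
    \sum_(th : Th) qt U th * qt V th = 0.
  move=> jU j1 j2; apply: (@sum_upd_eq0 _ j) => th.
  under eq_bigr => s _ do rewrite [qt V _]qt_indep//.
  by rewrite -mulr_suml qt_sum0// mul0r.
case: P => g g'; case: P' => l l'; rewrite /swap /= => n1 n2.
have [g1|g1] := boolP ((g == l) || (g == l')); last first.
  by rewrite negb_or in g1; case/andP: g1 => g1 g2; apply: (half _ _ g) => //=; rewrite eqxx.
have [g2|g2] := boolP ((g' == l) || (g' == l')); last first.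
  by rewrite negb_or in g2; case/andP: g2 => g3 g4; apply: (half _ _ g') => //=; rewrite eqxx orbT.
under eq_bigr => th _ do rewrite mulrC.
have [l1|l1] := boolP ((l == g) || (l == g')); last first.
  by rewrite negb_or in l1; case/andP: l1 => l1 l2; apply: (half _ _ l) => //=; rewrite eqxx.
have [l2|l2] := boolP ((l' == g) || (l' == g')); last first.
  by rewrite negb_or in l2; case/andP: l2 => l3 l4; apply: (half _ _ l') => //=; rewrite eqxx orbT.
exfalso; move: n1 n2 g1 g2 l1 l2; rewrite !xpair_eqE ![g == _]eq_sym ![g' == _]eq_sym.
by case: (l == g); case: (l' == g'); case: (l == g'); case: (l' == g).
Qed.

Definition Wf (th : Th) : R := \sum_g \sum_g' Qf g g' (th g) (th g').

Lemma Wf_center th : Wf th - \sum_g mug g = \sum_P qt P th.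
Proof.
rewrite -(pair_big xpredT xpredT (fun g g' => qt (g, g') th)) /= /Wf -sumrB.
apply: eq_bigr => g _; rewrite sumrB /=; congr (_ - _).
by rewrite (bigD1 g)//= eqxx mul1r big1 ?addr0// => g' /negbTE; rewrite eq_sym => ->; rewrite mul0r.
Qed.

Lemma qt_sq P : \sum_(th : Th) qt P th ^+ 2 <= \sum_(th : Th) Qf P.1 P.2 (th P.1) (th P.2) ^+ 2.
Proof.
case: P => g g'; rewrite /qt /=; case: (eqVneq g g') => [<-|_]; last first.
  by under eq_bigr do rewrite mul0r subr0.
pose c := mug g; pose q th := Qf g g (th g) (th g).
have H0 : \sum_(th : Th) (q th - c) = 0.
  apply: (@sum_upd_eq0 _ g) => th; have := @qt_sum0 (g, g) g th.
  rewrite eqxx /= => /(_ isT) E; rewrite -[RHS]E; apply: eq_bigr => s _; by rewrite /qt /= eqxx mul1r.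
have -> : \sum_(th : Th) q th ^+ 2 = \sum_(th : Th) (q th - 1 * c) ^+ 2 + 2 * c * \sum_(th : Th) (q th - c) + \sum_(th : Th) c ^+ 2.
  rewrite mulr_sumr -!big_split /=; apply: eq_bigr => th _; ring.
by rewrite H0 mulr0 addr0 lerDl sumr_ge0// => th _; exact: sqr_ge0.
Qed.

(** By [qt_orth] only the products of [P] with itself and with [swap P] survive. The latter are
    bounded by the mean of the two squares, whence the factor 2. *)
Lemma variance_bound : \sum_(th : Th) (Wf th - \sum_g mug g) ^+ 2 <=
  2 * \sum_(th : Th) \sum_g \sum_g' Qf g g' (th g) (th g') ^+ 2.
Proof.
have -> : \sum_(th : Th) (Wf th - \sum_g mug g) ^+ 2 = \sum_P \sum_P' \sum_(th : Th) qt P th * qt P' th.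
  under eq_bigr => th _ do rewrite Wf_center expr2 mulr_suml.
  rewrite exchange_big; apply: eq_bigr => P _ /=.
  under eq_bigr => th _ do rewrite mulr_sumr.
  by rewrite exchange_big.
have swapK : involutive swap by case.
apply: (@le_trans _ _ (\sum_P (\sum_(th : Th) qt P th ^+ 2 + \sum_(th : Th) (qt P th ^+ 2 + qt (swap P) th ^+ 2) / 2))).
  apply: ler_sum => P _.
  rewrite (bigD1 P)//= lerD//.
  have [sP|sP] := eqVneq (swap P) P.
    rewrite big1 => [|P' P'P]; last by apply: qt_orth => //; rewrite sP.
    by apply: sumr_ge0 => th _; rewrite divr_ge0// addr_ge0 ?sqr_ge0.
  rewrite (bigD1 (swap P))//= [X in _ + X]big1 ?addr0 => [|P' /andP[h1 h2]]; last exact: qt_orth.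
  apply: ler_sum => th _; have := sqr_ge0 (qt P th - qt (swap P) th); rewrite sqrrB; lra.
have -> : \sum_P (\sum_(th : Th) qt P th ^+ 2 + \sum_(th : Th) (qt P th ^+ 2 + qt (swap P) th ^+ 2) / 2) =
   2 * \sum_P \sum_(th : Th) qt P th ^+ 2.
  rewrite big_split /=.
  have -> : \sum_P \sum_(th : Th) (qt P th ^+ 2 + qt (swap P) th ^+ 2) / 2 =
    (\sum_P \sum_(th : Th) qt P th ^+ 2 + \sum_P \sum_(th : Th) qt (swap P) th ^+ 2) / 2.
    by rewrite mulrDl !mulr_suml -big_split /=; apply: eq_bigr => P _; rewrite !mulr_suml -big_split /=; apply: eq_bigr => th _; rewrite mulrDl.
  have -> : \sum_P \sum_(th : Th) qt (swap P) th ^+ 2 = \sum_P \sum_(th : Th) qt P th ^+ 2.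
    by rewrite [RHS](reindex_inj (inv_inj swapK)).
  lra.
rewrite ler_pM2l//.
have -> : \sum_(th : Th) \sum_g \sum_g' Qf g g' (th g) (th g') ^+ 2 =
   \sum_(P : G * G) \sum_(th : Th) Qf P.1 P.2 (th P.1) (th P.2) ^+ 2.
  rewrite [RHS]exchange_big; apply: eq_bigr => th _ /=.
  by rewrite -(pair_big xpredT xpredT (fun g g' => Qf g g' (th g) (th g') ^+ 2)).
by apply: ler_sum => P _; exact: qt_sq.
Qed.

End Pair.

(** First moment method: the mean over [th] of the sum of all [#|I| ^ 2] squared deviations obeys
    the bound, so a single [th] serves all pairs at once. *)
Lemma exists_perm (I : finType) (x : I -> L -> R) (V : R) : (forall i, \sum_a x i a = 0) ->
  (forall (th : Th) i j, \sum_g \sum_g' Qf (x i) (x j) g g' (th g) (th g') ^+ 2 <= V) ->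
  exists th : Th, forall i j, (Wf (x i) (x j) th - \sum_g mug (x i) (x j) g) ^+ 2 <=
    2 * (#|I| * #|I|)%:R * V.
Proof.
move=> x0 HV.
pose D th i j := (Wf (x i) (x j) th - \sum_g mug (x i) (x j) g) ^+ 2.
have D0 th i j : 0 <= D th i j by exact: sqr_ge0.
have [th Hth] : exists th, \sum_i \sum_j D th i j <= 2 * (#|I| * #|I|)%:R * V.
  apply/existsP; rewrite -[X in is_true X]negbK negb_exists; apply/negP => /forallP H.
  have : \sum_(th : Th) 2 * (#|I| * #|I|)%:R * V < \sum_(th : Th) \sum_i \sum_j D th i j.
    rewrite -subr_gt0 -sumrB (bigD1 [ffun=> 1%g])//= ltr_pwDl//; first by rewrite subr_gt0 ltNge.
    by apply: sumr_ge0 => th _; rewrite subr_ge0 ltW// ltNge.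
  apply/negP; rewrite -leNgt exchange_big.
  apply: (@le_trans _ _ (\sum_(i : I) \sum_(j : I) 2 * \sum_(th : Th) V)).
    apply: ler_sum => i _; rewrite exchange_big /=; apply: ler_sum => j _.
    apply: le_trans (variance_bound (x0 i) (x0 j)) _; rewrite ler_pM2l//.
    by apply: ler_sum => th _; exact: HV.
  rewrite le_eqVlt; apply/orP; left; apply/eqP.
  by rewrite !sumr_const -mulrA [_%:R * V]mulr_natl !mulrnAr -!mulrnA mulnC mulnAC.
exists th => i j; apply: le_trans Hth; rewrite -/(D th i j) (bigD1 i)//= (bigD1 j)//=.
rewrite -addrA lerDl addr_ge0// sumr_ge0// => k _; by apply: sumr_ge0.
Qed.

End RandomPerm.

(** * Relabelled systems *)

Section Derived.
Context {R : realType}.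
Local Notation I01 := (@I01 R).
Implicit Types (f g : R -> R) (p q r : R) (X Y Z : nat -> R -> nat).

Lemma Zspan_inLp p Y f : Zspan p Y f -> inLp p f.
Proof. by case. Qed.

Lemma Zspan_ae p Y f g : labels Y -> 0 <= p -> measurable_fun I01 g -> ae01 f g ->
  Zspan p Y f -> Zspan p Y g.
Proof.
move=> HY p0 mg fg [Lf Hf]; have Lg := ae_inLp mg fg Lf; split => // e e0.
have [N [u [u0 H]]] := Hf e e0; exists N, u; split => //.
have mS : measurable_fun I01 (Ssum Y u N) by exact: (inLp_meas (Ssum_inLp HY u N p0)).
rewrite -(@ae_nrm _ p (fun x => f x - Ssum Y u N x))//.
- by apply: measurable_funB => //; exact: inLp_meas Lf.
- by apply: measurable_funB.
- exact: (ae01_comp (fun x y => y - Ssum Y u N x)).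
Qed.

Lemma Zspan_lin p Y (c : R) f g : labels Y -> 1 < p -> Zspan p Y f -> Zspan p Y g ->
  Zspan p Y (fun x => c * f x + g x).
Proof.
move=> HY p1 Zf Zg; have Lf := Zspan_inLp Zf; have Lg := Zspan_inLp Zg.
have Lh : inLp p (fun x => c * f x + g x) by exact: (inLpD (ltW p1) (inLpZ c Lf) Lg).1.
apply: (Zspan_ae HY (ltW (lt_trans ltr01 p1)) (inLp_meas Lh) _ (Ulim_Zspan HY HY p1 Lh)).
apply: ae01_trans (Ulim_lin c HY HY p1 Lf Lg) _.
exact: (ae01_comp2 (fun x y z => c * y + z) (Zspan_Ulim_id HY p1 Zf) (Zspan_Ulim_id HY p1 Zg)).
Qed.

Lemma Zspan_closed p Y f : labels Y -> 1 < p -> inLp p f ->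
  (forall e, 0 < e -> exists2 g, Zspan p Y g & nrm p (fun x => f x - g x) <= e) -> Zspan p Y f.
Proof.
move=> HY p1 Lf H; split => // e e0.
have e20 : 0 < e / 2 by rewrite divr_gt0.
have [g [Lg Hg] fg] := H _ e20; have [N [u [u0 gu]]] := Hg _ e20.
exists N, u; split => //.
have p0 : 0 <= p by exact: ltW (lt_trans ltr01 p1).
apply: le_trans (nrm_dist (ltW p1) Lf (Ssum_inLp HY u N p0) Lg) _.
by rewrite [leRHS](splitr e) lerD.
Qed.

Lemma nrm_zero p : 0 < p -> nrm p (fun=> 0 : R) = 0.
Proof.
move=> p0; apply/eqP; rewrite eq_le nrm_ge0 andbT; apply: nrm_bounded => // x _.
by rewrite normr0.
Qed.

Lemma Zspan0 p Y : labels Y -> 1 < p -> Zspan p Y (fun=> 0).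
Proof.
move=> HY p1; split; first by apply: (@inLp_bounded _ _ _ 0) => [|//|x _]; rewrite ?normr0// ltW// (lt_trans ltr01).
move=> e e0; exists 0%N, (fun _ _ => 0); split; first by move=> n; exact: avg_cst.
rewrite (@eq_nrm _ p _ (fun=> 0)); last by move=> x _; rewrite Ssum0 subr0.
by rewrite nrm_zero ?ltW// (lt_trans ltr01).
Qed.

Lemma Zspan_sum p Y (I : Type) (s : seq I) (c : I -> R) (F : I -> R -> R) : labels Y -> 1 < p ->
  (forall i, Zspan p Y (F i)) -> Zspan p Y (fun x => \sum_(i <- s) c i * F i x).
Proof.
move=> HY p1 ZF; elim: s => [|i s IH].
  by under eq_fun do rewrite big_nil; exact: Zspan0.
by under eq_fun do rewrite big_cons; exact: Zspan_lin.
Qed.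

Lemma label_Zspan p Y n (u : nat -> R) : labels Y -> 1 < p -> avg n u = 0 ->
  Zspan p Y (fun x => u (Y n x)).
Proof.
move=> HY p1 u0; have p0 : 0 <= p by exact: ltW (lt_trans ltr01 p1).
pose w k a := if k == n then u a else 0.
have E x : Ssum Y w n.+1 x = u (Y n x).
  by rewrite SsumS /w eqxx /Ssum big1 ?add0r// => -[i /= lin] _; rewrite ltn_eqF.
have Ef : Ssum Y w n.+1 = (fun x => u (Y n x)) by apply/funext.
rewrite -Ef; split; first exact: Ssum_inLp.
move=> e e0; exists n.+1, w; split.
  by move=> k; rewrite /w; case: eqP => [->//|_]; exact: avg_cst.
have := Zspan0 HY p1; case=> _ /(_ e e0)[N [v [v0 H]]].
apply: le_trans (ltW e0).
apply: nrm_bounded => //; first exact: lt_trans ltr01 p1.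
  by apply: measurable_funB; exact: (inLp_meas (Ssum_inLp HY w n.+1 p0)).
by move=> x _; rewrite subrr normr0.
Qed.

Lemma Ssum_Zspan p Y u N : labels Y -> 1 < p -> (forall n, avg n (u n) = 0) ->
  Zspan p Y (Ssum Y u N).
Proof.
move=> HY p1 u0.
have -> : Ssum Y u N = (fun x => \sum_(n <- index_enum 'I_N) 1 * u n (Y n x)).
  by apply/funext => x; apply: eq_bigr => n _; rewrite mul1r.
by apply: (@Zspan_sum _ _ _ _ (fun=> 1)) => // n; exact: label_Zspan.
Qed.

(** Fibres of equal size, expressed as invariance of averages, which is the form in which it is
    used. *)
Definition balanced m n (pi : nat -> nat) : Prop :=
  (forall A, (A < 2 ^ m)%N -> (pi A < 2 ^ n)%N) /\
  forall u : nat -> R, avg m (fun A => u (pi A)) = avg n u.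

Definition relabel X (m : nat -> nat) (pi : nat -> nat -> nat) n x := pi n (X (m n) x).

Lemma incr_inj (m : nat -> nat) : (forall i j, (i < j)%N -> (m i < m j)%N) -> injective m.
Proof.
move=> mi i j E; apply/eqP; case: (ltngtP i j) => // ij; have := mi _ _ ij; by rewrite E ltnn.
Qed.

Lemma labels_relabel X m pi : labels X -> (forall i j, (i < j)%N -> (m i < m j)%N) ->
  (forall n, balanced (m n) n (pi n)) -> labels (relabel X m pi).
Proof.
move=> HX mi bal; split.
- by move=> n a; exact: (label_meas HX (m n) (fun A => (pi n A == a)%:R)).
- by move=> n x; apply: (bal n).1; exact: lab_lt.
move=> N t tlt.
(* Regroup the factors by source block [k = m i]. As [m] is injective each [w k] has at most one
   factor, and [Ex_prod] separates the blocks. *)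
pose w k A : R := \prod_(i < N | m i == k) (pi i A == t i)%:R.
transitivity (Ex (fun x => \prod_(k < m N) w k (X k x))).
  congr Ex; apply/funext => x; rewrite /w /relabel.
  rewrite (exchange_big_dep xpredT)//=; apply: eq_bigr => i _.
  by rewrite (big_pred1 (Ordinal (mi _ _ (ltn_ord i)))) => [//|k] /=; rewrite -val_eqE /= eq_sym.
rewrite (Ex_prod HX).
transitivity (\prod_(k < m N) \prod_(i < N | m i == k) (2 ^ i)%:R^-1 : R).
  apply: eq_bigr => k _; rewrite /w.
  have [[i /= ik]|no] := pselect (exists i : 'I_N, m i = k).
    have P1 : (fun j : 'I_N => m j == k) =1 pred1 i.
      by move=> j /=; rewrite -ik (inj_eq (incr_inj mi)).
    rewrite [RHS](big_pred1 i)//; under eq_avg => A _ do rewrite (big_pred1 i)//.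
    by rewrite -ik ((bal i).2 (fun b => (b == t i)%:R)) avg_delta// tlt.
  rewrite [RHS]big_pred0; last by move=> i; apply/eqP => ik; apply: no; exists i.
  rewrite -[RHS](avg_cst k); apply: eq_avg => A _; rewrite big_pred0// => i.
  by apply/eqP => ik; apply: no; exists i.
rewrite (exchange_big_dep xpredT)//=; apply: eq_bigr => i _.
by rewrite (big_pred1 (Ordinal (mi _ _ (ltn_ord i)))) => [//|k] /=; rewrite -val_eqE /= eq_sym.
Qed.

(** A function of the new label [n] is a function of the old label [m n], and balance keeps its mean
    0. *)
Lemma relabel_Zspan p X m pi f : labels X -> (forall i j, (i < j)%N -> (m i < m j)%N) ->
  (forall n, balanced (m n) n (pi n)) -> 1 < p -> Zspan p (relabel X m pi) f -> Zspan p X f.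
Proof.
move=> HX mi bal p1 [Lf Hf]; apply: (Zspan_closed HX p1 Lf) => e e0.
have [N [u [u0 H]]] := Hf e e0; exists (Ssum (relabel X m pi) u N); last exact: H.
have -> : Ssum (relabel X m pi) u N =
   (fun x => \sum_(n <- index_enum 'I_N) 1 * (fun A => u n (pi n A)) (X (m n) x)).
  by apply/funext => x; apply: eq_bigr => n _; rewrite mul1r.
apply: (Zspan_sum _ (fun=> 1) HX p1) => n.
apply: (@label_Zspan _ _ (m n) (fun A => u n (pi n A)) HX p1).
by rewrite (bal n).2 u0.
Qed.

End Derived.

(** * Off-diagonal blocks *)

Section Operator.
Context {R : realType}.
Local Notation I01 := (@I01 R).
Implicit Types (f g y : R -> R) (q r : R).
Variables (X : nat -> R -> nat) (p : R) (T : (R -> R) -> (R -> R)) (C : R).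
Hypothesis HX : labels X.
Hypothesis p1 : 1 < p.
Hypothesis TZ : forall f, Zspan p X f -> Zspan p X (T f).
Hypothesis Tlin : linear_on (Zspan p X) T.
Hypothesis C0 : 0 <= C.
Hypothesis TC : forall f, Zspan p X f -> nrm p (T f) <= C * nrm p f.

Lemma p_gt0 : 0 < p.
Proof. exact: lt_trans ltr01 p1. Qed.

Lemma T_null f : Zspan p X f -> nrm p f = 0 -> ae01 (T f) (fun=> 0).
Proof.
move=> Zf f0; apply: (nrm0_ae p_gt0 (Zspan_inLp (TZ Zf))).
by apply/eqP; rewrite eq_le nrm_ge0 andbT; apply: le_trans (TC Zf) _; rewrite f0 mulr0.
Qed.

(** [T] acts on representatives; linearity and boundedness make it respect equality almost
    everywhere. *)
Lemma T_ae f g : Zspan p X f -> Zspan p X g -> ae01 f g -> ae01 (T f) (T g).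
Proof.
move=> Zf Zg fg; have Zd := Zspan_lin (-1) HX p1 Zf Zg.
have d0 : nrm p (fun x => -1 * f x + g x) = 0.
  rewrite -(nrm_zero p_gt0); apply: ae_nrm.
  - exact: inLp_meas (Zspan_inLp Zd).
  - exact: measurable_cst.
  - by apply: ae_imp fg => x E I; rewrite E// mulN1r addNr.
apply: ae_imp2 (T_null Zd d0) (Tlin (-1) Zf Zg) => x E1 E2 I.
have := E2 I; rewrite E1// => /esym/eqP; rewrite mulN1r addrC subr_eq0 => /eqP ->//.
Qed.

Lemma T_sum (I : Type) (s : seq I) (c : I -> R) (F : I -> R -> R) :
  (forall i, Zspan p X (F i)) ->
  ae01 (T (fun x => \sum_(i <- s) c i * F i x)) (fun x => \sum_(i <- s) c i * T (F i) x).
Proof.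
move=> ZF; elim: s => [|i s IH].
  rewrite (_ : (fun x => \sum_(i <- [::]) c i * F i x) = fun=> 0); last first.
    by apply/funext => x; rewrite big_nil.
  rewrite (_ : (fun x => \sum_(i <- [::]) c i * T (F i) x) = fun=> 0); last first.
    by apply/funext => x; rewrite big_nil.
  exact: (T_null (Zspan0 HX p1) (nrm_zero p_gt0)).
rewrite (_ : (fun x => \sum_(j <- i :: s) c j * F j x) =
             fun x => c i * F i x + (fun x => \sum_(j <- s) c j * F j x) x); last first.
  by apply/funext => x; rewrite big_cons.
rewrite (_ : (fun x => \sum_(j <- i :: s) c j * T (F j) x) =
             fun x => c i * T (F i) x + \sum_(j <- s) c j * T (F j) x); last first.
  by apply/funext => x; rewrite big_cons.
apply: ae01_trans (Tlin (c i) (ZF i) (Zspan_sum s c HX p1 ZF)) _.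
exact: (ae01_comp2 (fun x a b => c i * a + b) (ae01_refl _) IH).
Qed.

Lemma L1_mul_bounded y f (K : R) : measurable_fun I01 y -> (forall x, I01 x -> `|y x| <= K) ->
  L1 f -> L1 (fun x => y x * f x).
Proof.
move=> my yK Lf; apply: (@L1_le _ _ (fun x => K * `|f x|)).
- exact: (measurable_funM my (L1_meas Lf)).
- by move=> x Ix; rewrite normrM ler_wpM2r// yK.
- exact: (L1Z K (L1_norm Lf)).
Qed.

Lemma T_L1 f : Zspan p X f -> L1 (T f).
Proof. by move=> Zf; exact: (inL1 (ltW p1) (Zspan_inLp (TZ Zf))). Qed.

Lemma Ex_T_sum y (K : R) (I : Type) (s : seq I) (c : I -> R) (F : I -> R -> R) :
  measurable_fun I01 y -> (forall x, I01 x -> `|y x| <= K) -> (forall i, Zspan p X (F i)) ->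
  Ex (fun x => y x * T (fun x => \sum_(i <- s) c i * F i x) x) =
  \sum_(i <- s) c i * Ex (fun x => y x * T (F i) x).
Proof.
move=> my yK ZF; have L i := L1_mul_bounded my yK (T_L1 (ZF i)).
transitivity (Ex (fun x => \sum_(i <- s) c i * (y x * T (F i) x))).
  apply: ae_Ex.
  - exact: L1_meas (L1_mul_bounded my yK (T_L1 (Zspan_sum s c HX p1 ZF))).
  - by apply: (@L1_meas _ (fun x => \sum_(i <- s) c i * (y x * T (F i) x))); apply: L1_sum => i _; exact: (L1Z (c i) (L i)).
  - apply: ae_imp (T_sum s c ZF) => x E Ix; rewrite E// mulr_sumr.
    by apply: eq_bigr => i _; rewrite mulrCA.
rewrite (@Ex_sum _ _ _ _ (fun i x => c i * (y x * T (F i) x))); last by move=> i _; exact: (L1Z (c i) (L i)).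
by apply: eq_bigr => i _; rewrite (ExZ (c i) (L i)).
Qed.

Lemma Ex_T_bound y f : measurable_fun I01 y -> (forall x, I01 x -> `|y x| <= 1) -> Zspan p X f ->
  `|Ex (fun x => y x * T f x)| <= C * nrm p f.
Proof.
move=> my y1 Zf; have L := T_L1 Zf; have L' := L1_mul_bounded my y1 L.
apply: le_trans (le_norm_Ex L') _; apply: le_trans (TC Zf).
apply: le_trans (Ex_le_nrm (ltW p1) (Zspan_inLp (TZ Zf))).
apply: (le_Ex (L1_norm L') (L1_norm L)) => x Ix.
by rewrite normrM ler_piMl// y1.
Qed.

(** Up to [e], [g] is a sum over the first [N] blocks, and a mean zero function of a later label is
    orthogonal to that sum. *)
Lemma off1 g (e : R) : Zspan p X g -> 0 < e -> exists m0, forall m, (m0 <= m)%N ->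
  forall u : nat -> R, avg m u = 0 -> (forall A, (A < 2 ^ m)%N -> `|u A| <= 1) ->
  `|Ex (fun x => u (X m x) * g x)| <= e.
Proof.
move=> Zg e0; have [Lg Hg] := Zg; have [N [w [w0 H]]] := Hg e e0.
exists N => m Nm u u0 u1.
have LS := Ssum_inLp HX w N (ltW p_gt0).
have mu := label_meas HX m u.
have ux x : I01 x -> `|u (X m x)| <= 1 by move=> _; apply: u1; exact: lab_lt.
have LD := (inLpB (ltW p1) Lg LS).1; have LD1 := inL1 (ltW p1) LD.
have LS1 := inL1 (ltW p1) LS.
have LuS := L1_mul_bounded mu ux LS1; have LuD := L1_mul_bounded mu ux LD1.
have S0 : Ex (fun x => u (X m x) * Ssum X w N x) = 0.
  transitivity (Ex (fun x => \sum_(n < N) w n (X n x) * u (X m x))).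
    by congr Ex; apply/funext => x; rewrite mulrC /Ssum mulr_suml.
  rewrite (@Ex_sum _ _ _ _ (fun (n : 'I_N) x => w n (X n x) * u (X m x))); last first.
    by move=> n _; exact: (L1_mul_label HX m u (label_L1 HX n (w n))).
  apply: big1 => n _; rewrite (@Ex_label2 _ _ HX n m (w n) u); first by rewrite u0 mulr0.
  by rewrite neq_ltn (leq_trans (ltn_ord n) Nm).
have -> : Ex (fun x => u (X m x) * g x) = Ex (fun x => u (X m x) * (g x - Ssum X w N x)).
  rewrite -[LHS]subr0 -[X in _ - X]S0 -(ExB (L1_mul_bounded mu ux (inL1 (ltW p1) Lg)) LuS).
  by congr Ex; apply/funext => x; rewrite mulrBr.
apply: le_trans (le_norm_Ex LuD) _; apply: le_trans H.
apply: le_trans (Ex_le_nrm (ltW p1) LD).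
apply: (le_Ex (L1_norm LuD) (L1_norm LD1)) => x Ix.
by rewrite normrM ler_piMl// ux.
Qed.

(** [b] marks the active blocks and [K] counts them. Bounding [|S| ^ (p - r)] by [K ^ (p - r)] with
    [r = min p 2] leaves an exponent to which von Bahr-Esseen applies; as [r > 1], the norm is of
    smaller order than [K]. *)
Lemma Ssum_pow_bound (w : nat -> nat -> R) N (b : nat -> bool) : (forall n, avg n (w n) = 0) ->
  (forall n A, (A < 2 ^ n)%N -> `|w n A| <= (b n)%:R) ->
  Ex (fun x => `|Ssum X w N x| `^ p) <= (\sum_(n < N) (b n)%:R) `^ (p - Num.min p 2) *
    (Kp (Num.min p 2) * \sum_(n < N) (b n)%:R).
Proof.
move=> w0 wb; set K := \sum_(n < N) _; set r := Num.min p 2.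
have r1 : 1 < r by rewrite lt_min p1 ltr1n.
have rp : r <= p by rewrite ge_min lexx.
have r2 : r <= 2 by rewrite ge_min lexx orbT.
have r0 : 0 <= r by lra.
have K0 : 0 <= K by apply: sumr_ge0.
have SK x : `|Ssum X w N x| <= K.
  apply: le_trans (ler_norm_sum _ _ _) _; apply: ler_sum => n _; apply: wb; exact: lab_lt.
have Lr := Ssum_powL1 HX w N r.
apply: (@le_trans _ _ (Ex (fun x => K `^ (p - r) * `|Ssum X w N x| `^ r))).
  apply: (le_Ex (Ssum_powL1 HX w N p) (L1Z _ Lr)) => x _.
  have -> : `|Ssum X w N x| `^ p = `|Ssum X w N x| `^ (p - r) * `|Ssum X w N x| `^ r.
    by rewrite -powRD subrK// (gt_eqF p_gt0).
  rewrite ler_wpM2r ?powR_ge0// ge0_ler_powR ?nnegrE ?subr_ge0//; exact: SK.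
rewrite (ExZ _ Lr) ler_wpM2l ?powR_ge0//.
apply: le_trans (vonBahrEsseen HX N r1 r2 w0) _.
apply: ler_wpM2l; first by apply/ltW/Kp_gt0; lra.
apply: ler_sum => n _.
rewrite -[leRHS](avg_cst n); apply: le_avg => A lA.
have := wb n A lA; case: (b n) => /= H.
  have E1 : 1 `^ r = 1 by rewrite powR1.
  by rewrite -[leRHS]E1 ge0_ler_powR ?nnegrE.
have -> : `|w n A| = 0 by apply/eqP; rewrite eq_le H normr_ge0.
by rewrite powR0// gt_eqF//; lra.
Qed.

(* Otherwise a signed sum of [K] offending block functions has norm [o(K)], because they
   are independent, but its image is tested by [y] with value at least [e K]. *)
Lemma off2 y (e : R) : measurable_fun I01 y -> (forall x, I01 x -> `|y x| <= 1) -> 0 < e ->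
  exists m0, forall m, (m0 <= m)%N ->
  forall u : nat -> R, avg m u = 0 -> (forall A, (A < 2 ^ m)%N -> `|u A| <= 1) ->
  `|Ex (fun x => y x * T (fun x => u (X m x)) x)| <= e.
Proof.
move=> my y1 e0; apply: contrapT => no.
pose ph f := Ex (fun x => y x * T f x).
pose ok m (u : nat -> R) := avg m u = 0 /\ forall A, (A < 2 ^ m)%N -> `|u A| <= 1.
have Zok m u : ok m u -> Zspan p X (fun x => u (X m x)) by case=> u0 _; exact: label_Zspan.
pose bad m := exists2 u, ok m u & e < ph (fun x => u (X m x)).
have phZ (c : R) f : Zspan p X f -> ph (fun x => c * f x) = c * ph f.
  move=> Zf; have := Ex_T_sum [:: tt] (fun=> c) my y1 (fun=> Zf).
  rewrite big_seq1 => <-; rewrite /ph; congr (Ex (fun x => y x * T _ x)).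
  by apply/funext => z; apply/funext => x; rewrite big_seq1.
have badi m0 : exists2 m, (m0 <= m)%N & bad m.
  apply: contrapT => H; apply: no; exists m0 => m mm u u0 u1; rewrite leNgt; apply/negP => L.
  apply: H; exists m => //.
  have oku : ok m u by [].
  have [neg|pos] := ltP (ph (fun x => u (X m x))) 0.
    exists (fun a => -1 * u a).
      by split; [rewrite avgZ u0 mulr0|move=> A lA; rewrite mulN1r normrN u1].
    rewrite (phZ (-1) (fun x => u (X m x)) (Zok _ _ oku)) mulN1r.
    by apply: lt_le_trans L _; rewrite ltr0_norm.
  by exists u => //; apply: lt_le_trans L _; rewrite ger0_norm.
(* Blocks without an offending function get the function 0, so that the sums over all blocks see
   exactly the offending ones. *)
have ex m : exists u : nat -> R, [/\ avg m u = 0, forall A, (A < 2 ^ m)%N -> `|u A| <= (`[< bad m >])%:R &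
    e * (`[< bad m >])%:R <= ph (fun x => u (X m x))].
  case: asboolP => [[u [u0 u1] eu]|_]; first by exists u; split => //; rewrite mulr1 ltW.
  exists (fun=> 0); split; [exact: avg_cst|by move=> A _; rewrite normr0|].
  have := phZ 0 (fun=> 0) (Zspan0 HX p1); rewrite mul0r mulr0 => E.
  by rewrite E mul0r.
have [w Hw] := choice ex.
pose K N : R := \sum_(n < N) (`[< bad n >])%:R.
have w0 n : avg n (w n) = 0 by case: (Hw n).
have Kunb (k : nat) : exists N, k%:R <= K N.
  elim: k => [|k [N IH]]; first by exists 0%N; rewrite /K big_ord0.
  have [m Nm bm] := badi N; exists m.+1; rewrite /K big_ord_recr /= asboolT// -natr1 lerD2r.
  apply: le_trans IH _; rewrite /K -(subnKC Nm) big_split_ord /= lerDl; exact: sumr_ge0.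
pose r := Num.min p 2.
have r1 : 1 < r by rewrite lt_min p1 ltr1n.
have rp : r <= p by rewrite ge_min lexx.
have main N : e * K N <= C * nrm p (Ssum X w N).
  apply: (@le_trans _ _ (ph (Ssum X w N))); last first.
    by apply: le_trans (ler_norm _) (Ex_T_bound my y1 (Ssum_Zspan N HX p1 w0)).
  have ZF (n : 'I_N) : Zspan p X (fun x => w n (X n x)) := label_Zspan HX p1 (w0 n).
  have := Ex_T_sum (index_enum 'I_N) (fun=> 1) my y1 ZF.
  rewrite (_ : (fun x => \sum_(i <- index_enum 'I_N) 1 * w i (X i x)) = Ssum X w N); last first.
    by apply/funext => x; apply: eq_bigr => i _; rewrite mul1r.
  rewrite /ph => ->; rewrite /K mulr_sumr; apply: ler_sum => n _; rewrite mul1r; by case: (Hw n).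
pose D := C `^ p * Kp r.
have D0 : 0 <= D by rewrite mulr_ge0 ?powR_ge0//; apply/ltW/Kp_gt0; lra.
have key N : 1 <= K N -> e `^ p * K N `^ (r - 1) <= D.
  move=> K1; have K0 : 0 < K N by lra.
  have H : (e * K N) `^ p <= C `^ p * (K N `^ (p - r) * (Kp r * K N)).
    have wb n A : (A < 2 ^ n)%N -> `|w n A| <= (`[< bad n >])%:R by case: (Hw n) => _ + _; apply.
    apply: le_trans (ler_wpM2l (powR_ge0 _ _) (Ssum_pow_bound N w0 wb)).
    rewrite -(nrm_powR _ p_gt0) -powRM ?nrm_ge0// ge0_ler_powR ?nnegrE ?(ltW p_gt0)//.
      by rewrite mulr_ge0 ?ltW.
    by rewrite mulr_ge0 ?nrm_ge0.
  have E : K N `^ p = K N `^ (r - 1) * (K N `^ (p - r) * K N).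
    rewrite -{4}(powRr1 (ltW K0)) -!powRD; try by rewrite (gt_eqF K0) implybT.
    by congr powR; lra.
  have P : 0 < K N `^ (p - r) * K N by rewrite mulr_gt0 ?powR_gt0.
  rewrite -(ler_pM2r P); move: H; rewrite powRM ?(ltW e0) ?(ltW K0)// E /D.
  move=> H; rewrite -mulrA; apply: le_trans H _; rewrite le_eqVlt; apply/orP; left; apply/eqP; ring.
have ep : 0 < e `^ p by rewrite powR_gt0.
have s0 : 0 < r - 1 by rewrite subr_gt0.
(* A value of [K N] that violates [key]: [Z ^ (r - 1)] is larger than [D / e ^ p]. *)
pose Z := ((D / e `^ p + 1) `^ (r - 1)^-1).
have Dq : 0 <= D / e `^ p by rewrite divr_ge0// ltW.
have [N HN] := Kunb (Num.bound (Z + 1)).+1.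
have Z0 : 0 <= Z by exact: powR_ge0.
have ZK : Z <= K N.
  apply: le_trans HN; rewrite -natr1.
  have := archi_boundP (_ : 0 <= Z + 1); move=> /(_ ltac:(lra)); lra.
have K1 : 1 <= K N by apply: le_trans HN; rewrite -natr1; have := ler0n R (Num.bound (Z + 1)); lra.
have := key N K1; apply/negP; rewrite -ltNge mulrC -ltr_pdivrMr//.
apply: (@lt_le_trans _ _ (Z `^ (r - 1))).
  rewrite /Z -powRrM mulVf ?gt_eqF// powRr1; lra.
by rewrite ge0_ler_powR ?nnegrE ?(ltW s0)//; lra.
Qed.

End Operator.

(** * Diagonal blocks *)

Section Blocks.
Context {R : realType}.
Implicit Types (F u : nat -> R).

Lemma sum_blocks n l F : \sum_(A < n * l) F A = \sum_(g < n) \sum_(a < l) F (g * l + a)%N.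
Proof.
elim: n => [|n IH]; first by rewrite mul0n !big_ord0.
by rewrite mulSnr big_split_ord big_ord_recr /= IH.
Qed.

Lemma sum_block k N F :
  \sum_(A < 2 ^ (k + N)) F A = \sum_(g < 2 ^ k) \sum_(a < 2 ^ N) F (g * 2 ^ N + a)%N.
Proof. by rewrite expnD sum_blocks. Qed.

Lemma blockD N (g : nat) (a : 'I_(2 ^ N)) : ((g * 2 ^ N + a) %/ 2 ^ N)%N = g.
Proof. by rewrite divnMDl ?expn_gt0// divn_small ?addn0. Qed.

Lemma blockM N (g : nat) (a : 'I_(2 ^ N)) : ((g * 2 ^ N + a) %% 2 ^ N)%N = a.
Proof. by rewrite modnMDl modn_small. Qed.

Lemma avg_block k N i : (i < 2 ^ k)%N ->
  avg (k + N) (fun A => (A %/ 2 ^ N == i)%N%:R) = (2 ^ k)%:R^-1 :> R.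
Proof.
move=> ik; rewrite /avg (sum_block k N (fun A => (A %/ 2 ^ N == i)%N%:R)).
under eq_bigr => g _ do under eq_bigr => a _ do rewrite blockD.
rewrite (bigD1 (Ordinal ik))//= [X in _ + X]big1 => [|g gi]; last first.
  by apply: big1 => a _; rewrite -val_eqE /= in gi; rewrite (negbTE gi).
rewrite addr0 eqxx sumr_const card_ord expnD natrM invfM -mulrA mulVf ?mulr1//.
Qed.

Lemma avg_div n N u : (n <= N)%N -> avg N (fun a => u (a %/ 2 ^ (N - n))%N) = avg n u.
Proof.
move=> nN; have E : avg (n + (N - n)) (fun a => u (a %/ 2 ^ (N - n))%N) = avg n u.
  rewrite /avg (sum_block n (N - n) (fun a => u (a %/ 2 ^ (N - n))%N)).
  under eq_bigr => g _ do under eq_bigr => a _ do rewrite blockD.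
  under eq_bigr => g _ do rewrite sumr_const card_ord -mulr_natl.
  rewrite -mulr_sumr expnD natrM invfM -mulrA mulKf//; exact: two_pow_neq0.
by move: E; rewrite subnKC.
Qed.

(** Centred indicators generate all mean zero functions of a label, so finitely many estimates per
    block suffice. *)
Definition cind n (al a : nat) : R := (a == al)%:R - (2 ^ n)%:R^-1.

Lemma avg_cind n al : (al < 2 ^ n)%N -> avg n (cind n al) = 0.
Proof. by move=> l; rewrite /cind avgB avg_delta// avg_cst subrr. Qed.

Lemma cind_norm n al a : `|cind n al a| <= 1.
Proof.
rewrite /cind ler_norml; have h0 : 0 <= (2 ^ n)%:R^-1 :> R by rewrite invr_ge0.
have h1 : (2 ^ n)%:R^-1 <= 1 :> R by rewrite invf_le1 ?two_pow_gt0// ler1n expn_gt0.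
by case: eqP => _ /=; apply/andP; split; lra.
Qed.

Lemma cind_expand n u a : avg n u = 0 -> (a < 2 ^ n)%N ->
  u a = \sum_(b < 2 ^ n) u b * cind n b a.
Proof.
move=> u0 an; under eq_bigr do rewrite /cind mulrBr.
rewrite sumrB -mulr_suml [X in _ - X]mulrC -/(avg n u) u0 subr0.
rewrite (bigD1 (Ordinal an))//= eqxx mulr1 big1 ?addr0// => b ba.
by rewrite -val_eqE /= eq_sym in ba; rewrite (negbTE ba) mulr0.
Qed.

Lemma hv_block n k i a : (k < n)%N -> `|hv n k i a : R| <= (a %/ 2 ^ (n - k) == i)%N%:R.
Proof.
move=> kn; rewrite /hv.
have -> : (a %/ 2 ^ (n - k) = (a %/ 2 ^ (n - k.+1))./2)%N.
  by rewrite -divn2 -divnMA -expnSr -subSn.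
set b := (_ %/ _)%N; case: eqP => [->|_].
  by rewrite doubleK eqxx normr1.
case: eqP => [->|_]; last by rewrite normr0.
by rewrite -[_.*2.+1]/(true + i.*2)%N half_bit_double eqxx normrN1.
Qed.

(** [A = g * 2 ^ N + a] is position [a] of group [g]; the permuted position loses its last [N - n]
    binary digits. The value 0 is reached by default only for [A] outside the block. *)
Definition perm_lab k N n (th : {ffun 'I_(2 ^ k) -> {perm 'I_(2 ^ N)}}) (A : nat) : nat :=
  if (insub (A %/ 2 ^ N)%N : option 'I_(2 ^ k), insub (A %% 2 ^ N)%N : option 'I_(2 ^ N))
     is (Some g, Some a) then (th g a %/ 2 ^ (N - n))%N else 0%N.

Lemma perm_labE k N n th (g : 'I_(2 ^ k)) (a : 'I_(2 ^ N)) :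
  perm_lab n th (g * 2 ^ N + a) = (th g a %/ 2 ^ (N - n))%N.
Proof. by rewrite /perm_lab blockD blockM !valK. Qed.

Lemma perm_lab_balanced k N n (th : {ffun 'I_(2 ^ k) -> {perm 'I_(2 ^ N)}}) : (n <= N)%N ->
  @balanced R (k + N) n (perm_lab n th).
Proof.
move=> nN; split.
  move=> A _; rewrite /perm_lab; case: (insub _ : option 'I_(2 ^ k)) => [g|]; last by rewrite expn_gt0.
  case: (insub _ : option 'I_(2 ^ N)) => [a|]; last by rewrite expn_gt0.
  by rewrite ltn_divLR ?expn_gt0// -expnD subnKC// ltn_ord.
move=> u; rewrite -(avg_div u nN) /avg (sum_block k N (fun A => u (perm_lab n th A))).
have E (g : 'I_(2 ^ k)) : \sum_(a < 2 ^ N) u (perm_lab n th (g * 2 ^ N + a)) =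
    \sum_(a < 2 ^ N) u (a %/ 2 ^ (N - n))%N.
  under eq_bigr do rewrite perm_labE.
  exact: (sum_perm (fun a : 'I_(2 ^ N) => u (a %/ 2 ^ (N - n))%N) (th g)).
rewrite (eq_bigr _ (fun g _ => E g)) sumr_const card_ord -[X in _ * X = _]mulr_natl.
by rewrite expnD natrM invfM mulrAC -!mulrA mulKf ?two_pow_neq0// mulrC.
Qed.

End Blocks.

(** * The bilinear form of [T] within one block *)

Section Form.
Context {R : realType}.
Implicit Types (f g y : R -> R) (r : R) (u v : nat -> R).
Variables (X : nat -> R -> nat) (p : R) (T : (R -> R) -> (R -> R)) (C : R).
Hypothesis HX : labels X.
Hypothesis p1 : 1 < p.
Hypothesis TZ : forall f, Zspan p X f -> Zspan p X (T f).
Hypothesis Tlin : linear_on (Zspan p X) T.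
Hypothesis C0 : 0 <= C.
Hypothesis TC : forall f, Zspan p X f -> nrm p (T f) <= C * nrm p f.
Local Notation q := (p / (p - 1)).

Definition Bf m u v : R := Ex (fun x => u (X m x) * T (fun x => v (X m x)) x).
(** Only the argument of [T] is centred, since [T] is controlled on mean zero functions only; the
    test function may be any function of the label. *)
Definition Mx m (A B : nat) : R :=
  Ex (fun x => (X m x == A)%:R * T (fun x => cind m B (X m x)) x).

Lemma label_bd m u x : `|u (X m x)| <= \sum_(a < 2 ^ m) `|u a|.
Proof.
rewrite (bigD1 (Ordinal (lab_lt HX m x)))//= lerDl; exact: sumr_ge0.
Qed.

Lemma Bf_mat m u v : avg m v = 0 ->
  Bf m u v = \sum_(A < 2 ^ m) \sum_(B < 2 ^ m) u A * v B * Mx m A B.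
Proof.
move=> v0.
have ZF (B : 'I_(2 ^ m)) : Zspan p X (fun x => cind m B (X m x)).
  exact: (label_Zspan HX p1 (avg_cind (ltn_ord B))).
have -> : Bf m u v = \sum_(B < 2 ^ m) v B * Ex (fun x => u (X m x) * T (fun x => cind m B (X m x)) x).
  rewrite -(Ex_T_sum HX p1 TZ Tlin TC (index_enum 'I_(2 ^ m)) (fun B => v B) (label_meas HX m u)
     (fun x _ => label_bd m u x) ZF).
  rewrite /Bf; congr (Ex (fun x => _ * T _ x)).
  by apply/funext => z; apply/funext => x; rewrite (cind_expand v0 (lab_lt HX m x)).
rewrite exchange_big; apply: eq_bigr => B _ /=.
under [in LHS]eq_fun do rewrite mulrC.
rewrite (Ex_mul_label HX m u (T_L1 p1 TZ (ZF B))) mulr_sumr; apply: eq_bigr => A _.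
rewrite mulrCA mulrA; congr (_ * _); rewrite /Mx; congr Ex; apply/funext => x; exact: mulrC.
Qed.

Lemma label_inLp m u r : 0 <= r -> inLp r (fun x => u (X m x)).
Proof.
move=> r0; apply: (@inLp_bounded _ _ _ (\sum_(a < 2 ^ m) `|u a|)) => //.
  exact: (label_meas HX m u).
by move=> x _; exact: label_bd.
Qed.

Lemma nrm_label m u r (P : nat -> bool) (ka : R) : 0 < r -> 0 <= ka ->
  (forall A, (A < 2 ^ m)%N -> `|u A| <= (P A)%:R) -> avg m (fun A => (P A)%:R) <= ka ->
  nrm r (fun x => u (X m x)) <= ka `^ r^-1.
Proof.
move=> r0 k0 uP Pk; apply: nrm_le_of_pow => //; first exact: powR_ge0.
rewrite -powRrM mulVf ?gt_eqF// powRr1//; apply: le_trans Pk.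
rewrite (Ex_label HX m (fun A => `|u A| `^ r)); apply: le_avg => A lA.
have := uP A lA; case: (P A) => /= H.
  have E1 : 1 `^ r = 1 by rewrite powR1.
  by rewrite -[leRHS]E1 ge0_ler_powR ?nnegrE// ltW.
have -> : `|u A| = 0 by apply/eqP; rewrite eq_le H normr_ge0.
by rewrite powR0// gt_eqF.
Qed.

Lemma Bf_bound m u v (P P' : nat -> bool) (k k' : R) : avg m v = 0 -> 0 <= k -> 0 <= k' ->
  (forall A, (A < 2 ^ m)%N -> `|u A| <= (P A)%:R) -> avg m (fun A => (P A)%:R) <= k ->
  (forall A, (A < 2 ^ m)%N -> `|v A| <= (P' A)%:R) -> avg m (fun A => (P' A)%:R) <= k' ->
  `|Bf m u v| <= C * (k' `^ p^-1 * k `^ q^-1).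
Proof.
move=> v0 k0 k'0 uP Pk vP Pk'.
have p0 : 0 < p by exact: lt_trans ltr01 p1.
have q0 : 0 < q by rewrite divr_gt0// subr_gt0.
have Zv := label_Zspan HX p1 v0.
have [L H] := hoelderE p0 q0 (conj_exp p1) (Zspan_inLp (TZ Zv)) (label_inLp m u (ltW q0)).
have -> : Bf m u v = Ex (fun x => T (fun x => v (X m x)) x * u (X m x)).
  by congr Ex; apply/funext => x; exact: mulrC.
apply: le_trans (le_norm_Ex L) _; apply: le_trans H _.
rewrite mulrA; apply: ler_pM; rewrite ?nrm_ge0//; last exact: (nrm_label q0 k0 uP Pk).
apply: le_trans (TC Zv) _; apply: ler_wpM2l => //; exact: (nrm_label p0 k'0 vP Pk').
Qed.

(** Both functions live on a group of measure [2 ^ - k], and the exponents [1 / p] and [1 / q] of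
    the two norms add up to 1. In [Bf_block1] only the argument of [T] is so confined, which leaves
    [2 ^ (- k / p)]. *)
Lemma Bf_block k N i j u v : (i < 2 ^ k)%N -> (j < 2 ^ k)%N -> avg (k + N) v = 0 ->
  (forall A, `|u A| <= (A %/ 2 ^ N == i)%N%:R) ->
  (forall A, `|v A| <= (A %/ 2 ^ N == j)%N%:R) -> `|Bf (k + N) u v| <= C * (2 ^ k)%:R^-1.
Proof.
move=> ik jk v0 ui vj; have k0 : 0 <= (2 ^ k)%:R^-1 :> R by rewrite invr_ge0.
have := @Bf_bound (k + N) u v (fun A => A %/ 2 ^ N == i)%N (fun A => A %/ 2 ^ N == j)%N _ _ v0 k0 k0
  (fun A _ => ui A) _ (fun A _ => vj A) _.
rewrite !avg_block// => /(_ (lexx _) (lexx _)) H; apply: le_trans H _.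
by rewrite -powRD ?conj_exp// ?powRr1//; apply/implyP => _; rewrite gt_eqF// invr_gt0 two_pow_gt0.
Qed.

Lemma Bf_block1 k N j u v : (j < 2 ^ k)%N -> avg (k + N) v = 0 -> (forall A, `|u A| <= 1) ->
  (forall A, `|v A| <= (A %/ 2 ^ N == j)%N%:R) ->
  `|Bf (k + N) u v| <= C * (2 ^ k)%:R^-1 `^ p^-1.
Proof.
move=> jk v0 u1 vj; have k0 : 0 <= (2 ^ k)%:R^-1 :> R by rewrite invr_ge0.
have := @Bf_bound (k + N) u v xpredT (fun A => A %/ 2 ^ N == j)%N 1 _ v0 ler01 k0
  (fun A _ => u1 A) _ (fun A _ => vj A) _.
by rewrite avg_block// avg_cst powR1 /= mulr1; apply.
Qed.

Definition dgB m l i : R := (2 ^ l)%:R * Bf m (hv m l i) (hv m l i).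

Lemma dgB_bound m l i : (l < m)%N -> (i < 2 ^ l)%N -> `|dgB m l i| <= C.
Proof.
move=> lm il; have Em : (l + (m - l) = m)%N by rewrite subnKC// ltnW.
have H : `|Bf m (hv m l i) (hv m l i)| <= C * (2 ^ l)%:R^-1.
  have hb A : `|hv m l i A : R| <= (A %/ 2 ^ (m - l) == i)%N%:R by exact: hv_block.
  have h0 : avg (l + (m - l)) (hv m l i) = 0 :> R by rewrite Em avg_hv.
  by have := Bf_block il il h0 hb hb; rewrite Em.
rewrite /dgB normrM ger0_norm// mulrC -ler_pdivlMr ?two_pow_gt0//.
Qed.

(* The average of the diagonal entries of the top [N] levels of block [k + N]. *)
Definition lamB k N : R := ((2 ^ k)%:R * ((2 ^ N)%:R - 1))^-1 *
  \sum_(k <= l < k + N) \sum_(i < 2 ^ l) dgB (k + N) l i.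

Lemma sum_pow2 k N : \sum_(k <= l < k + N) \sum_(i < 2 ^ l) 1 = (2 ^ k)%:R * ((2 ^ N)%:R - 1) :> R.
Proof.
elim: N => [|N IH]; first by rewrite addn0 big_geq// expn0 subrr mulr0.
rewrite addnS big_nat_recr ?leq_addr//= IH sumr_const card_ord expnD expnS !natrM; ring.
Qed.

Lemma pow2_minus1_gt0 N : (0 < N)%N -> 0 < (2 ^ N)%:R - 1 :> R.
Proof. by move=> N0; rewrite subr_gt0 ltr1n -{1}(expn0 2) ltn_exp2l. Qed.

Lemma lamB_bound k N : (0 < N)%N -> `|lamB k N| <= C.
Proof.
move=> N0; have D0 : 0 < (2 ^ k)%:R * ((2 ^ N)%:R - 1) :> R.
  by rewrite mulr_gt0 ?two_pow_gt0 ?pow2_minus1_gt0.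
rewrite /lamB normrM ger0_norm ?invr_ge0 ?(ltW D0)// mulrC ler_pdivrMr//.
rewrite -sum_pow2 mulr_sumr; apply: le_trans (ler_norm_sum _ _ _) _.
rewrite big_nat_cond [leRHS]big_nat_cond; apply: ler_sum => l /andP[/andP[kl lN] _].
apply: le_trans (ler_norm_sum _ _ _) _; rewrite mulr_sumr; apply: ler_sum => i _.
by rewrite mulr1 dgB_bound.
Qed.

Section Diag.
Variables (k N : nat).
Local Notation m := (k + N)%N.
Local Notation G := 'I_(2 ^ k).
Local Notation L := 'I_(2 ^ N).

Definition Mb (g : G) (a : L) (g' : G) (b : L) : R := Mx m (g * 2 ^ N + a) (g' * 2 ^ N + b).

(** By [hv_kernel_tail], the Haar functions inside the groups have as kernel a multiple of the
    identity minus a multiple of the relation of lying in the same group, hence the traces and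
    totals of the diagonal group blocks. *)
Lemma lamB_tr : lamB k N = ((2 ^ N)%:R - 1)^-1 *
  \sum_(g : G) ((2 ^ N)%:R * tr Mb g - tot Mb g).
Proof.
have E : \sum_(k <= l < k + N) \sum_(i < 2 ^ l) dgB (k + N) l i =
   \sum_(A < 2 ^ m) \sum_(B < 2 ^ m)
     ((2 ^ m)%:R * (A == B :> nat)%:R - (2 ^ k)%:R * (A %/ 2 ^ N == B %/ 2 ^ N)%N%:R) * Mx m A B.
  transitivity (\sum_(k <= l < k + N) \sum_(i < 2 ^ l) \sum_(A < 2 ^ m) \sum_(B < 2 ^ m)
      ((2 ^ l)%:R * (hv m l i A * hv m l i B)) * Mx m A B).
    rewrite big_nat_cond [RHS]big_nat_cond; apply: eq_bigr => l /andP[/andP[kl lN] _].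
    apply: eq_bigr => i _; rewrite /dgB Bf_mat ?avg_hv// mulr_sumr; apply: eq_bigr => A _.
    by rewrite mulr_sumr; apply: eq_bigr => B _; rewrite mulrA.
  under eq_bigr => l _ do rewrite exchange_big /=.
  rewrite exchange_big /=; apply: eq_bigr => A _.
  under eq_bigr => l _ do rewrite exchange_big /=.
  rewrite exchange_big /=; apply: eq_bigr => B _.
  rewrite -(hv_kernel_tail _ _) // mulr_suml; apply: eq_bigr => l _.
  by rewrite mulr_suml.
have E1 : \sum_(A < 2 ^ m) \sum_(B < 2 ^ m) (2 ^ m)%:R * (A == B :> nat)%:R * Mx m A B =
    (2 ^ m)%:R * \sum_(g : G) tr Mb g.
  rewrite -(sum_block k N (fun A => Mx m A A)) mulr_sumr; apply: eq_bigr => A _.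
  rewrite (bigD1 A)//= eqxx mulr1 big1 ?addr0// => B BA.
  by rewrite -val_eqE /= eq_sym in BA; rewrite (negbTE BA) mulr0 mul0r.
have E2 : \sum_(A < 2 ^ m) \sum_(B < 2 ^ m) (2 ^ k)%:R * (A %/ 2 ^ N == B %/ 2 ^ N)%N%:R * Mx m A B =
    (2 ^ k)%:R * \sum_(g : G) tot Mb g.
  rewrite (sum_block k N (fun A => \sum_(B < 2 ^ m) (2 ^ k)%:R * (A %/ 2 ^ N == B %/ 2 ^ N)%N%:R * Mx m A B)).
  rewrite mulr_sumr; apply: eq_bigr => g _; rewrite /tot mulr_sumr; apply: eq_bigr => a _.
  rewrite (sum_block k N (fun B => (2 ^ k)%:R * ((g * 2 ^ N + a) %/ 2 ^ N == B %/ 2 ^ N)%N%:R * Mx m (g * 2 ^ N + a) B)).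
  under eq_bigr => g' _ do under eq_bigr => b _ do rewrite !blockD.
  rewrite (bigD1 g)//= [X in _ + X]big1 => [|g' gg']; last first.
    by apply: big1 => b _; rewrite -val_eqE /= eq_sym in gg'; rewrite (negbTE gg') mulr0 mul0r.
  by rewrite addr0 mulr_sumr; apply: eq_bigr => b _; rewrite eqxx mulr1.
rewrite /lamB E.
under eq_bigr => A _ do under eq_bigr => B _ do rewrite mulrBl.
under eq_bigr => A _ do rewrite sumrB.
rewrite sumrB E1 E2 sumrB -mulr_sumr expnD natrM invfM.
have := two_pow_neq0 (R := R) k; set a := (2 ^ k)%:R => a0.
set b := (_ - 1)^-1; set s := \sum_g tr _ _; set t := \sum_g tot _ _; set c := (2 ^ N)%:R.
have -> : a * c * s - a * t = a * (c * s - t) by ring.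
by rewrite mulrACA mulrA mulVf// mul1r.
Qed.

Variable n : nat.
Hypothesis nN : (n <= N)%N.
Hypothesis N0 : (0 < N)%N.

Definition xal (al : 'I_(2 ^ n)) (a : L) : R := cind n al (a %/ 2 ^ (N - n)).

Lemma sum_avg N' (F : nat -> R) : \sum_(a < 2 ^ N') F a = (2 ^ N')%:R * avg N' F.
Proof. by rewrite /avg mulVKf// two_pow_neq0. Qed.

Lemma xal_sum0 al : \sum_a xal al a = 0.
Proof.
rewrite /xal (sum_avg N (fun a => cind n al (a %/ 2 ^ (N - n)))) (avg_div (cind n al) nN).
by rewrite avg_cind// mulr0.
Qed.

Lemma sxy_xal al be : sxy (xal al) (xal be) = (2 ^ N)%:R * avg n (fun a => cind n al a * cind n be a).
Proof.
rewrite /sxy /xal -(avg_div (fun a => cind n al a * cind n be a) nN) -sum_avg.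
by [].
Qed.

(** The mean over random permutations and the average of diagonal entries are the same combination
    of traces and totals; the remaining factor is the inner product of the two label functions. *)
Lemma mug_sum al be : \sum_(g : G) mug Mb (xal al) (xal be) g =
  avg n (fun a => cind n al a * cind n be a) * lamB k N.
Proof.
rewrite lamB_tr /mug sxy_xal card_ord -mulr_sumr.
have -> : \sum_(g : G) (tr Mb g - tot Mb g / (2 ^ N)%:R) =
   (2 ^ N)%:R^-1 * \sum_(g : G) ((2 ^ N)%:R * tr Mb g - tot Mb g).
  rewrite mulr_sumr; apply: eq_bigr => g _; rewrite mulrBr mulKf ?two_pow_neq0//.
  by rewrite [_^-1 * _]mulrC.
have := two_pow_neq0 (R := R) N; set a := (2 ^ N)%:R => a0.
have := gt_eqF (pow2_minus1_gt0 N0); rewrite -/a => /negbT a1.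
by field; rewrite a0 a1.
Qed.

Variable th : {ffun G -> {perm L}}.

Lemma weighted_avg0 (e : nat -> R) (be : 'I_(2 ^ n)) :
  avg m (fun A => e (A %/ 2 ^ N)%N * cind n be (perm_lab n th A)) = 0.
Proof.
rewrite /avg (sum_block k N (fun A => e (A %/ 2 ^ N)%N * cind n be (perm_lab n th A))).
rewrite big1 ?mulr0// => g _; under eq_bigr => b _ do rewrite blockD perm_labE.
by rewrite -mulr_sumr (sum_perm (xal be) (th g)) xal_sum0 mulr0.
Qed.

Local Notation Q al be g g' := (Qf Mb (xal al) (xal be) g g' (th g) (th g')).

(** Weights that are constant on groups separate the terms: indicators isolate a single one in
    [Q_bound], signs produce absolute values in [Q_col], and the weight 1 gives the full form. *)
Lemma Bf_weighted (e e' : nat -> R) (al be : 'I_(2 ^ n)) :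
  Bf m (fun A => e (A %/ 2 ^ N)%N * cind n al (perm_lab n th A))
       (fun A => e' (A %/ 2 ^ N)%N * cind n be (perm_lab n th A)) =
  \sum_(g : G) \sum_(g' : G) e g * e' g' * Q al be g g'.
Proof.
rewrite Bf_mat ?weighted_avg0//.
pose u A := e (A %/ 2 ^ N)%N * cind n al (perm_lab n th A).
pose v A := e' (A %/ 2 ^ N)%N * cind n be (perm_lab n th A).
have uE (g : G) (a : L) : u (g * 2 ^ N + a)%N = e g * xal al (th g a) by rewrite /u blockD perm_labE.
have vE (g : G) (a : L) : v (g * 2 ^ N + a)%N = e' g * xal be (th g a) by rewrite /v blockD perm_labE.
rewrite (sum_block k N (fun A => \sum_(B < 2 ^ m) u A * v B * Mx m A B)).
apply: eq_bigr => g _.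
transitivity (\sum_(a : L) \sum_(g' : G) \sum_(b : L)
   (e g * xal al (th g a)) * (e' g' * xal be (th g' b)) * Mb g a g' b).
  apply: eq_bigr => a _.
  rewrite (sum_block k N (fun B => u (g * 2 ^ N + a)%N * v B * Mx m (g * 2 ^ N + a) B)).
  by apply: eq_bigr => g' _; apply: eq_bigr => b _; rewrite uE vE.
rewrite exchange_big /=; apply: eq_bigr => g' _; rewrite /Qf mulr_sumr; apply: eq_bigr => a _.
rewrite mulr_sumr; apply: eq_bigr => b _; rewrite -!mulrA; congr (_ * _).
by rewrite mulrCA; congr (_ * _); rewrite mulrA.
Qed.

Lemma weight_norm (e : nat -> R) al A : `|e (A %/ 2 ^ N)%N * cind n al (perm_lab n th A)| <=
  `|e (A %/ 2 ^ N)%N|.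
Proof. by rewrite normrM ler_piMr// cind_norm. Qed.

Lemma Q_bound al be (g g' : G) : `|Q al be g g'| <= C * (2 ^ k)%:R^-1.
Proof.
pose e (h : G) (i : nat) : R := (i == h)%:R.
have H := @Bf_weighted (e g) (e g') al be.
rewrite (bigD1 g)//= [X in _ = _ + X]big1 in H; last first.
  move=> h hg; apply: big1 => h' _; rewrite /e.
  by rewrite -val_eqE /= in hg; rewrite (negbTE hg) !mul0r.
rewrite (bigD1 g')//= [X in _ = _ + X + _]big1 in H; last first.
  move=> h hg; rewrite /e.
  by rewrite -val_eqE /= in hg; rewrite (negbTE hg) mulr0 !mul0r.
rewrite !addr0 {3 4}/e !eqxx !mul1r in H; rewrite -H.
apply: (Bf_block (ltn_ord g) (ltn_ord g')).
- exact: weighted_avg0.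
- by move=> A; apply: le_trans (weight_norm _ _ _) _; rewrite /e normr_nat.
- by move=> A; apply: le_trans (weight_norm _ _ _) _; rewrite /e normr_nat.
Qed.

(* Signs turn the sum of absolute values into one value of the bilinear form. *)
Lemma Q_col al be (g' : G) : \sum_(g : G) `|Q al be g g'| <= C * (2 ^ k)%:R^-1 `^ p^-1.
Proof.
pose e (i : nat) : R := if insub i is Some g then Num.sg (Q al be g g') else 0.
pose e' (i : nat) : R := (i == g')%:R.
have eE (g : G) : e g = Num.sg (Q al be g g') by rewrite /e valK.
have -> : \sum_(g : G) `|Q al be g g'| =
    Bf m (fun A => e (A %/ 2 ^ N)%N * cind n al (perm_lab n th A))
       (fun A => e' (A %/ 2 ^ N)%N * cind n be (perm_lab n th A)).
  rewrite Bf_weighted; apply: eq_bigr => g _; rewrite (bigD1 g')//= big1 => [|h hg].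
    by rewrite addr0 eE /e' eqxx mulr1 normrEsg.
  by rewrite /e'; rewrite -val_eqE /= in hg; rewrite (negbTE hg) mulr0 !mul0r.
apply: le_trans (ler_norm _) _; apply: (Bf_block1 (ltn_ord g')).
- exact: weighted_avg0.
- move=> A; apply: le_trans (weight_norm _ _ _) _; rewrite /e; case: insub => [g|]; last by rewrite normr0.
  by rewrite normr_sg; case: (_ != _).
- by move=> A; apply: le_trans (weight_norm _ _ _) _; rewrite /e' normr_nat.
Qed.

(** Largest entry times column sum, over [2 ^ k] columns: the factor [2 ^ k] cancels the [2 ^ - k]
    of [Q_bound]. *)
Lemma Q_var al be : \sum_(g : G) \sum_(g' : G) Q al be g g' ^+ 2 <=
  C ^+ 2 * (2 ^ k)%:R^-1 `^ p^-1.
Proof.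
rewrite exchange_big /=.
have H (g' : G) : \sum_(g : G) Q al be g g' ^+ 2 <=
    C * (2 ^ k)%:R^-1 * (C * (2 ^ k)%:R^-1 `^ p^-1).
  apply: (@le_trans _ _ (\sum_(g : G) C * (2 ^ k)%:R^-1 * `|Q al be g g'|)).
    apply: ler_sum => g _; rewrite -real_normK ?num_real// expr2.
    by rewrite ler_wpM2r// Q_bound.
  rewrite -mulr_sumr ler_wpM2l ?Q_col// mulr_ge0// invr_ge0//.
apply: (@le_trans _ _ (\sum_(g' : G) C * (2 ^ k)%:R^-1 * (C * (2 ^ k)%:R^-1 `^ p^-1))).
  by apply: ler_sum => g' _; exact: H.
rewrite sumr_const card_ord -[_ *+ _]mulr_natl.
have := two_pow_neq0 (R := R) k; set a := (2 ^ k)%:R => a0; set b := a^-1 `^ _.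
by rewrite le_eqVlt; apply/orP; left; apply/eqP; field.
Qed.

End Diag.

Lemma diag_block n N k : (n <= N)%N -> (0 < N)%N -> exists pi, @balanced R (k + N) n pi /\
  forall al be, (al < 2 ^ n)%N -> (be < 2 ^ n)%N ->
  (Bf (k + N) (fun A => cind n al (pi A)) (fun A => cind n be (pi A)) -
    avg n (fun a => cind n al a * cind n be a) * lamB k N) ^+ 2 <=
  2 * (2 ^ n * 2 ^ n)%:R * (C ^+ 2 * (2 ^ k)%:R^-1 `^ p^-1).
Proof.
move=> nN N0.
have L1 : (1 < #|'I_(2 ^ N)|)%N by rewrite card_ord -{1}(expn0 2) ltn_exp2l.
have [th H] := exists_perm L1 (@xal_sum0 N n nN) (fun th al be => @Q_var k N n nN th al be).
exists (perm_lab n th); split; first exact: perm_lab_balanced.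
move=> al be lal lbe; have := H (Ordinal lal) (Ordinal lbe).
rewrite (mug_sum k nN N0) !card_ord /=; congr (_ <= _); congr ((_ - _) ^+ 2).
have := @Bf_weighted k N n nN th (fun=> 1) (fun=> 1) (Ordinal lal) (Ordinal lbe).
rewrite /Wf; under [X in _ = X -> _]eq_bigr => g _ do under eq_bigr => g' _ do rewrite !mul1r.
move=> <-; congr Bf; apply/funext => A /=; by rewrite mul1r.
Qed.
End Form.

(** * Choice of the relabelled system *)

Section Choice.
Context {R : realType}.

(** The limit superior: [A] collects the numbers that [u] reaches or exceeds infinitely often. *)
Lemma bounded_cluster (u : nat -> R) (C : R) : (forall n, `|u n| <= C) ->
  exists l, forall d : R, 0 < d -> forall n0, exists2 n, (n0 <= n)%N & `|u n - l| < d.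
Proof.
move=> uC; pose A := [set x : R | forall n0, exists2 n, (n0 <= n)%N & x <= u n].
have hs : has_sup A.
  split; first by exists (- C) => n0; exists n0 => //; have := uC n0; rewrite ler_norml => /andP[].
  exists C => x /(_ 0%N)[n _ xu]; apply: le_trans xu _.
  by have := uC n; rewrite ler_norml => /andP[].
exists (sup A) => d d0 n0.
have nA : ~ A (sup A + d / 2).
  move=> H; have := sup_upper_bound hs H; apply/negP; rewrite -ltNge; lra.
have [n1 Hn1] : exists n1, forall n, (n1 <= n)%N -> u n < sup A + d / 2.
  apply: contrapT => H; apply: nA => n1; apply: contrapT => H'; apply: H; exists n1 => n nn.
  by rewrite ltNge; apply/negP => L; apply: H'; exists n.
have [a Aa la] := sup_adherent d0 hs; have [n nn an] := Aa (maxn n0 n1).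
rewrite geq_max in nn; case/andP: nn => n0n n1n; exists n => //.
have := Hn1 n n1n; rewrite ltr_norml => H; apply/andP; split; lra.
Qed.

Lemma history_choice (S : Type) (good : seq S -> S -> Prop) : (forall h, exists s, good h s) ->
  exists u : nat -> S, forall n, good (mkseq u n) (u n).
Proof.
move=> /choice[f Hf]; pose h n := iter n (fun s => rcons s (f s)) [::].
exists (fun n => f (h n)) => n.
suff -> : mkseq (fun n => f (h n)) n = h n by exact: Hf.
by elim: n => //= n IH; rewrite mkseqS IH.
Qed.

Lemma uniform_threshold (I : finType) (P : I -> nat -> Prop) :
  (forall i, exists m0, forall m, (m0 <= m)%N -> P i m) ->
  exists m0, forall m, (m0 <= m)%N -> forall i, P i m.
Proof.
move=> /choice[f Hf]; exists (\max_i f i) => m mm i; apply: Hf; apply: leq_trans mm.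
exact: leq_bigmax.
Qed.

Lemma pow2_root_small (p c e : R) : 0 < p -> 0 <= c -> 0 < e ->
  exists k1, forall k, (k1 <= k)%N -> c * (2 ^ k)%:R^-1 `^ p^-1 <= e.
Proof.
move=> p0 c0 e0; have x0 : 0 < e / (c + 1) by rewrite divr_gt0//; lra.
have [l Hl] : exists l, 1 / (2 ^ l.+1)%:R <= (e / (c + 1)) `^ p by apply: pow2_small; exact: powR_gt0.
exists l.+1 => k lk.
have H : (2 ^ k)%:R^-1 `^ p^-1 <= e / (c + 1).
  have -> : e / (c + 1) = ((e / (c + 1)) `^ p) `^ p^-1.
    by rewrite -powRrM mulfV ?gt_eqF// powRr1// ltW.
  apply: ge0_ler_powR; rewrite ?nnegrE ?invr_ge0 ?powR_ge0 ?(ltW p0)//.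
  apply: le_trans Hl; rewrite div1r lef_pV2 ?posrE ?two_pow_gt0// ler_nat leq_exp2l//.
apply: le_trans (ler_wpM2l c0 H) _; rewrite mulrCA ler_piMr ?(ltW e0)// ler_pdivrMr; lra.
Qed.

End Choice.

Section System.
Context {R : realType}.
Local Notation I01 := (@I01 R).
Implicit Types (f g y : R -> R) (r : R) (u v : nat -> R).
Variables (X : nat -> R -> nat) (p : R) (T : (R -> R) -> (R -> R)) (C : R).
Hypothesis HX : labels X.
Hypothesis p1 : 1 < p.
Hypothesis TZ : forall f, Zspan p X f -> Zspan p X (T f).
Hypothesis Tlin : linear_on (Zspan p X) T.
Hypothesis C0 : 0 <= C.
Hypothesis TC : forall f, Zspan p X f -> nrm p (T f) <= C * nrm p f.
Local Notation lamB := (lamB X T).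

(* [N] is fixed before [k] tends to infinity: the variance of the random relabelling
   of block [k + N] is small only for [k] large. *)
Lemma iterated_cluster : exists mu : R, forall d : R, 0 < d -> forall n0,
  exists N, [/\ (n0 <= N)%N, (0 < N)%N &
    forall k0, exists2 k, (k0 <= k)%N & `|lamB k N - mu| < d].
Proof.
have ex N : exists l, forall d : R, 0 < d -> forall k0, exists2 k, (k0 <= k)%N & `|lamB k N.+1 - l| < d.
  by apply: (@bounded_cluster _ _ C) => k; exact: (lamB_bound HX p1 TZ C0 TC).
have [l Hl] := choice ex.
have lC N : `|l N| <= C + 1.
  have [k _ H] := Hl N 1 ltr01 0%N.
  have := lamB_bound HX p1 TZ C0 TC k (ltn0Sn N).
  move: H; rewrite ltr_norml !ler_norml => /andP[h1 h2] /andP[h3 h4]; apply/andP; split; lra.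
have [mu Hmu] := bounded_cluster lC.
exists mu => d d0 n0; have d20 : 0 < d / 2 by rewrite divr_gt0.
have [N nN HN] := Hmu _ d20 n0; exists N.+1; split => //; first exact: leqW.
move=> k0; have [k kk Hk] := Hl N _ d20 k0; exists k => //.
rewrite [d]splitr -(subrKA (l N)); exact: le_lt_trans (ler_normD _ _) (ltrD Hk HN).
Qed.

Variables (mu : R) (e : nat -> nat -> R).
Hypothesis Hmu : forall d : R, 0 < d -> forall n0,
  exists N, [/\ (n0 <= N)%N, (0 < N)%N & forall k0, exists2 k, (k0 <= k)%N & `|lamB k N - mu| < d].
Hypothesis e0 : forall i j, 0 < e i j.

Definition Fs n (s : nat * (nat -> nat)) a x : R := cind n a (s.2 (X s.1 x)).

(* [t] lists the relabellings chosen so far; the conditions are void for those entries of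
   [t] that are not balanced, so that a next step always exists. *)
Definition good_step (t : seq (nat * (nat -> nat))) (s : nat * (nat -> nat)) : Prop :=
  let n := size t in let ti i := nth (0%N, id) t i in
  [/\ @balanced R s.1 n s.2, forall i, (i < n)%N -> ((ti i).1 < s.1)%N,
    forall i a b, (i < n)%N -> @balanced R (ti i).1 i (ti i).2 -> (a < 2 ^ i)%N -> (b < 2 ^ n)%N ->
      `|Ex (fun x => Fs i (ti i) a x * T (Fs n s b) x)| <= e i n /\
      `|Ex (fun x => Fs n s b x * T (Fs i (ti i) a) x)| <= e n i &
    forall a b, (a < 2 ^ n)%N -> (b < 2 ^ n)%N ->
      `|Ex (fun x => Fs n s a x * T (Fs n s b) x) - mu * avg n (fun c => cind n a c * cind n b c)| <= e n n].

Lemma Fs_meas n s a : measurable_fun I01 (Fs n s a).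
Proof. exact: (label_meas HX s.1 (fun A => cind n a (s.2 A))). Qed.

Lemma Fs_Zspan n s a : @balanced R s.1 n s.2 -> (a < 2 ^ n)%N -> Zspan p X (Fs n s a).
Proof.
move=> [_ bal] an; apply: (@label_Zspan _ p X s.1 (fun A => cind n a (s.2 A)) HX p1).
by rewrite bal avg_cind.
Qed.

Lemma off_threshold (i n a : nat) (s : nat * (nat -> nat)) : exists m0, forall m, (m0 <= m)%N ->
  @balanced R s.1 i s.2 -> (a < 2 ^ i)%N ->
  forall u : nat -> R, avg m u = 0 -> (forall A, (A < 2 ^ m)%N -> `|u A| <= 1) ->
  `|Ex (fun x => Fs i s a x * T (fun x => u (X m x)) x)| <= e i n /\
  `|Ex (fun x => u (X m x) * T (Fs i s a) x)| <= e n i.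
Proof.
have [bal|nb] := pselect (@balanced R s.1 i s.2); last by exists 0%N => m _ /nb.
have [al|na] := pselect (a < 2 ^ i)%N; last by exists 0%N => m _ _ /na.
have ZF := Fs_Zspan bal al.
have F1 x : I01 x -> `|Fs i s a x| <= 1 by move=> _; exact: cind_norm.
have [m1 H1] := off2 HX p1 TZ Tlin C0 TC (Fs_meas i s a) F1 (e0 i n).
have [m2 H2] := off1 HX p1 (TZ ZF) (e0 n i).
exists (maxn m1 m2) => m; rewrite geq_max => /andP[mm1 mm2] _ _ u u0 u1.
by split; [exact: H1|exact: H2].
Qed.

Lemma avg_cind_norm n a b : `|avg n (fun c => cind n a c * cind n b c)| <= 1 :> R.
Proof.
have H c : `|cind n a c * cind n b c| <= 1 :> R by rewrite normrM mulr_ile1 ?cind_norm.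
rewrite ler_norml; apply/andP; split; [rewrite -[leLHS](avg_cst n)|rewrite -[leRHS](avg_cst n)];
  apply: le_avg => c _; by have := H c; rewrite ler_norml => /andP[].
Qed.

Lemma good_step_exists t : exists s, good_step t s.
Proof.
pose n := size t; pose ti i := nth (0%N, id) t i.
(* [a] runs through [2 ^ n] values for every [i], to have one finite index type; the proper range
   [a < 2 ^ i] is a hypothesis inside [off_threshold]. *)
have [m0 Hm0] := uniform_threshold (fun ia : 'I_n * 'I_(2 ^ n) => off_threshold ia.1 n ia.2 (ti ia.1)).
have en : 0 < e n n / 2 by rewrite divr_gt0.
have [N [nN N0 HN]] := Hmu en n.
have p0 : 0 < p by exact: lt_trans ltr01 p1.
have c0 : 0 <= 2 * (2 ^ n * 2 ^ n)%:R * C ^+ 2 :> R by rewrite !mulr_ge0 ?sqr_ge0.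
(* From [k1] on, the bound of [diag_block] is at most [(e n n / 2) ^ 2]; the other half of [e n n]
   pays for replacing [lamB k N] by [mu]. *)
have [k1 Hk1] := pow2_root_small p0 c0 (exprn_gt0 2 en).
have [k kk Hk] := HN (maxn k1 (maxn m0 (\max_(i < n) (ti i).1).+1)).
move: kk; rewrite !geq_max => /and3P[kk1 km0 kt].
have [pi [bal Hpi]] := diag_block HX p1 TZ Tlin C0 TC k nN N0.
have u0 b : (b < 2 ^ n)%N -> avg (k + N) (fun A => cind n b (pi A)) = 0 :> R.
  by move=> bn; rewrite bal.2 avg_cind.
have u1 b A : `|cind n b (pi A)| <= 1 :> R by exact: cind_norm.
exists (k + N, pi)%N; split => //=.
- move=> i lin; apply: leq_trans (leq_addr N k); apply: leq_trans kt; rewrite ltnS.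
  exact: (leq_bigmax (F := fun i : 'I_n => (ti i).1) (Ordinal lin)).
- move=> i a b lin bi ai bn.
  have an : (a < 2 ^ n)%N by apply: leq_trans ai _; rewrite leq_exp2l// ltnW.
  have := Hm0 (k + N)%N (leq_trans km0 (leq_addr _ _)) (Ordinal lin, Ordinal an) bi ai _ (u0 b bn) (fun A _ => u1 b A).
  exact.
- move=> a b an bn; set av := avg n _; have := Hpi a b an bn; rewrite -/av.
  set Bv := Bf _ _ _ _ _ => HB.
  have HB2 : `|Bv - av * lamB k N| <= e n n / 2.
    rewrite -(@ler_pXn2r _ 2) ?nnegrE ?(ltW en)// real_normK ?num_real//.
    by apply: le_trans HB _; rewrite mulrA; exact: Hk1.
  rewrite -[X in `|X - _|]/Bv [leRHS]splitr.
  have -> : Bv - mu * av = (Bv - av * lamB k N) + av * (lamB k N - mu) by ring.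
  apply: le_trans (ler_normD _ _) _; apply: lerD => //; rewrite normrM.
  apply: le_trans (ltW Hk); rewrite ler_piMl//; exact: avg_cind_norm.
Qed.

Lemma good_system : exists m pi, [/\ forall i j, (i < j)%N -> (m i < m j)%N,
  forall n, @balanced R (m n) n (pi n) &
  forall n n' a b, (a < 2 ^ n)%N -> (b < 2 ^ n')%N ->
    `|Ex (fun x => cind n a (relabel X m pi n x) * T (fun x => cind n' b (relabel X m pi n' x)) x) -
      mu * Ex (fun x => cind n a (relabel X m pi n x) * cind n' b (relabel X m pi n' x))| <= e n n'].
Proof.
have [u Hu] := history_choice good_step_exists.
have nthu i n : (i < n)%N -> nth (0%N, id) (mkseq u n) i = u i by exact: nth_mkseq.
have bal n : @balanced R (u n).1 n (u n).2 by case: (Hu n); rewrite size_mkseq.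
have inc i j : (i < j)%N -> ((u i).1 < (u j).1)%N.
  by move=> ij; case: (Hu j); rewrite size_mkseq => _ /(_ i ij) + _ _; rewrite nthu.
exists (fun n => (u n).1), (fun n => (u n).2); split => // n n' a b an bn'.
have cross : n != n' -> Ex (fun x => Fs n (u n) a x * Fs n' (u n') b x) = 0.
  move=> nn; rewrite (@Ex_label2 _ _ HX (u n).1 (u n').1 (fun A => cind n a ((u n).2 A)) (fun A => cind n' b ((u n').2 A))).
    by rewrite (bal n).2 avg_cind// mul0r.
  by rewrite (inj_eq (incr_inj inc)).
rewrite -[X in X <= _]/(`|Ex (fun x => Fs n (u n) a x * T (Fs n' (u n') b) x) -
   mu * Ex (fun x => Fs n (u n) a x * Fs n' (u n') b x)|).
case: (ltngtP n n') => nn.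
- rewrite cross ?ltn_eqF// mulr0 subr0.
  case: (Hu n') => _ _ + _; rewrite size_mkseq => /(_ n a b nn).
  by rewrite nthu// => /(_ (bal n) an bn')[].
- rewrite cross ?gtn_eqF// mulr0 subr0.
  case: (Hu n) => _ _ + _; rewrite size_mkseq => /(_ n' b a nn).
  by rewrite nthu// => /(_ (bal n') bn' an)[].
subst n'; case: (Hu n) => _ _ _; rewrite size_mkseq => /(_ a b an bn').
congr (`| _ - _ * _ | <= _).
rewrite -((bal n).2 (fun c => cind n a c * cind n b c)).
by rewrite -(Ex_label HX (u n).1 (fun A => cind n a ((u n).2 A) * cind n b ((u n).2 A))).
Qed.

End System.

(** * The factorization *)

Section SmallBlocks.
Context {R : realType}.
Local Notation I01 := (@I01 R).
Implicit Types (f g y z : R -> R).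
Variables (X Y : nat -> R -> nat) (p : R) (S : (R -> R) -> (R -> R)) (C d : R).
Hypothesis HX : labels X.
Hypothesis HY : labels Y.
Hypothesis p1 : 1 < p.
Hypothesis YX : forall f, Zspan p Y f -> Zspan p X f.
Hypothesis SZ : forall f, Zspan p X f -> Zspan p X (S f).
Hypothesis Slin : linear_on (Zspan p X) S.
Hypothesis C0 : 0 <= C.
Hypothesis SC : forall f, Zspan p X f -> nrm p (S f) <= C * nrm p f.
Hypothesis d0 : 0 <= d.
Local Notation t n := ((2 ^ n)%:R^-1 : R).
Hypothesis He : forall n n' a b, (a < 2 ^ n)%N -> (b < 2 ^ n')%N ->
  `|Ex (fun x => cind n a (Y n x) * S (fun x => cind n' b (Y n' x)) x)| <= d * t n ^+ 3 * t n' ^+ 3.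

Lemma geo_sum N : \sum_(n < N) t n <= 2.
Proof.
have H : \sum_(n < N) t n = 2 - 2 * t N.
  elim: N => [|N IH]; first by rewrite big_ord0 expn0 invr1 mulr1 subrr.
  by rewrite big_ord_recr /= IH expnS natrM invfM; field; rewrite two_pow_neq0.
by rewrite H gerBl mulr_ge0// invr_ge0.
Qed.

Lemma T_dist f g : Zspan p X f -> Zspan p X g ->
  nrm p (fun x => S f x - S g x) <= C * nrm p (fun x => f x - g x).
Proof.
move=> Zf Zg; have Zd := Zspan_lin (-1) HX p1 Zg Zf.
have -> : nrm p (fun x => f x - g x) = nrm p (fun x => -1 * g x + f x).
  by apply: eq_nrm => x _; rewrite mulN1r addrC.
apply: le_trans (SC Zd); rewrite le_eqVlt; apply/orP; left; apply/eqP; apply: ae_nrm.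
- exact: (inLp_meas (inLpB (ltW p1) (Zspan_inLp (SZ Zf)) (Zspan_inLp (SZ Zg))).1).
- exact: inLp_meas (Zspan_inLp (SZ Zd)).
- apply: ae01_sym; apply: ae01_trans (Slin (-1) Zg Zf) _.
  by apply: ae_imp (ae01_refl (S f)) => x _ _; rewrite mulN1r addrC.
Qed.

Lemma dcoef_cind n a f : L1 f ->
  dcoef Y n f a = (2 ^ n)%:R * Ex (fun x => cind n a (Y n x) * f x).
Proof.
move=> Lf; have -> : Ex (fun x => cind n a (Y n x) * f x) =
    Ex (fun x => f x * (Y n x == a)%:R - t n * f x).
  by congr Ex; apply/funext => x; rewrite /cind mulrBl mulrC.
rewrite (ExB (L1_ind HY n a Lf) (L1Z _ Lf)) (ExZ _ Lf) mulrBr mulVKf//.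
Qed.

Lemma UN_Zspan N z : inLp p z -> Zspan p Y (UN Y Y N z).
Proof.
move=> Lz; rewrite UN_Ssum; apply: (Ssum_Zspan N HY p1) => n.
exact: (avg_dcoef HY n (inL1 (ltW p1) Lz)).
Qed.

Lemma Ex_UN_small N z n a : inLp p z -> (a < 2 ^ n)%N ->
  `|Ex (fun x => cind n a (Y n x) * S (UN Y Y N z) x)| <= 4 * d * nrm p z * t n ^+ 3.
Proof.
move=> Lz an; have Lz1 := inL1 (ltW p1) Lz.
have my := label_meas HY n (cind n a).
have y1 x : I01 x -> `|cind n a (Y n x)| <= 1 :> R by move=> _; exact: cind_norm.
have Zb n' (b : 'I_(2 ^ n')) : Zspan p X (fun x => cind n' b (Y n' x)).
  by apply: YX; exact: (label_Zspan HY p1 (avg_cind (ltn_ord b))).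
have Zn (n' : 'I_N) : Zspan p X (fun x => dcoef Y n' z (Y n' x)).
  by apply: YX; exact: (label_Zspan HY p1 (avg_dcoef HY n' Lz1)).
have blk (n' : nat) : `|Ex (fun x => cind n a (Y n x) * S (fun x => dcoef Y n' z (Y n' x)) x)| <=
    2 * d * nrm p z * t n ^+ 3 * t n'.
  have := Ex_T_sum HX p1 SZ Slin SC (index_enum 'I_(2 ^ n')) (fun b => dcoef Y n' z b) my y1 (@Zb n').
  rewrite (_ : (fun x => \sum_(b <- index_enum 'I_(2 ^ n')) dcoef Y n' z b * cind n' b (Y n' x)) =
     (fun x => dcoef Y n' z (Y n' x))); last first.
    apply/funext => x; rewrite -(@cind_expand _ n' (dcoef Y n' z))//; [exact: avg_dcoef|exact: lab_lt].
  move=> ->; apply: le_trans (ler_norm_sum _ _ _) _.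
  (* The coefficient bound and the number of labels cost [2 ^ n'] each; the third power in [He]
     leaves the summable factor [t n']. *)
  apply: (@le_trans _ _ (\sum_(b < 2 ^ n') (2 * (2 ^ n')%:R * nrm p z) * (d * t n ^+ 3 * t n' ^+ 3))).
    apply: ler_sum => b _; rewrite normrM; apply: ler_pM => //; last exact: He.
    apply: le_trans (dcoef_bound HY n' b Lz1) _.
    by apply: ler_wpM2l; [rewrite mulr_ge0|exact: (Ex_le_nrm (ltW p1) Lz)].
  rewrite sumr_const card_ord -[_ *+ _]mulr_natl le_eqVlt; apply/orP; left; apply/eqP.
  have := two_pow_neq0 (R := R) n'; set s := (2 ^ n')%:R => s0.
  have := two_pow_neq0 (R := R) n; set r := (2 ^ n)%:R => r0.
  by field; rewrite s0 r0.
have := Ex_T_sum HX p1 SZ Slin SC (index_enum 'I_N) (fun=> 1) my y1 Zn.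
rewrite (_ : (fun x => \sum_(i <- index_enum 'I_N) 1 * dcoef Y i z (Y i x)) = UN Y Y N z); last first.
  by apply/funext => x; apply: eq_bigr => i _; rewrite mul1r.
move=> ->; apply: le_trans (ler_norm_sum _ _ _) _.
apply: (@le_trans _ _ (\sum_(n' < N) 2 * d * nrm p z * t n ^+ 3 * t n')).
  by apply: ler_sum => n' _; rewrite mul1r; exact: blk.
rewrite -mulr_sumr; set c := _ * t n ^+ 3.
have c0 : 0 <= c by rewrite !mulr_ge0 ?nrm_ge0// exprn_ge0// invr_ge0.
apply: le_trans (ler_wpM2l c0 (geo_sum N)) _.
by rewrite le_eqVlt; apply/orP; left; apply/eqP; rewrite /c; ring.
Qed.

(** [Ex_UN_small] is uniform in the number of blocks, so it survives the limit by continuity of [S].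
    Passing to [dcoef] costs a factor [2 ^ n], which [t n ^+ 3] more than covers. *)
Lemma dcoef_small z n a : Zspan p Y z -> (a < 2 ^ n)%N ->
  `|dcoef Y n (S z) a| <= 4 * d * nrm p z * t n.
Proof.
move=> Zz an; have Lz := Zspan_inLp Zz.
have [LU cU] := Ulim_spec HY HY p1 Lz.
apply: (@le_of_eps _ _ _ (2 * (2 ^ n)%:R * C)); first by rewrite !mulr_ge0.
move=> e e0; have [N HN] := cU e e0.
have ZU := UN_Zspan N Lz; have LS := Zspan_inLp (SZ (YX Zz)).
have LSU := Zspan_inLp (SZ (YX ZU)).
have D := dcoef_dist n a HY (ltW p1) LS LSU.
have D2 : nrm p (fun x => S z x - S (UN Y Y N z) x) <= C * e.
  apply: le_trans (T_dist (YX Zz) (YX ZU)) _; apply: ler_wpM2l => //.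
  rewrite nrmC; apply: le_trans (HN N (leqnn N)); rewrite le_eqVlt; apply/orP; left; apply/eqP.
  apply: ae_nrm.
  - exact: (inLp_meas (inLpB (ltW p1) (Zspan_inLp ZU) Lz).1).
  - exact: (inLp_meas (inLpB (ltW p1) (Zspan_inLp ZU) LU).1).
  - exact: (ae01_comp (fun x v => UN Y Y N z x - v) (ae01_sym (Zspan_Ulim_id HY p1 Zz))).
have B : `|dcoef Y n (S (UN Y Y N z)) a| <= 4 * d * nrm p z * t n.
  rewrite (dcoef_cind n a (inL1 (ltW p1) LSU)) normrM ger0_norm//.
  have H := Ex_UN_small N Lz an.
  apply: le_trans (ler_wpM2l (ler0n _ _) H) _.
  have := two_pow_gt0 (R := R) n; have : 1 <= (2 ^ n)%:R :> R by rewrite ler1n expn_gt0.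
  set s := (2 ^ n)%:R => s1 s0; set c := 4 * d * nrm p z.
  have c0 : 0 <= c by rewrite !mulr_ge0 ?nrm_ge0.
  have -> : s * (c * s^-1 ^+ 3) = c * s^-1 * s^-1 by field; rewrite gt_eqF.
  by apply: ler_piMr; [rewrite mulr_ge0// invr_ge0 ltW|rewrite invf_le1].
have -> : dcoef Y n (S z) a = dcoef Y n (S (UN Y Y N z)) a + (dcoef Y n (S z) a - dcoef Y n (S (UN Y Y N z)) a).
  by rewrite addrC subrK.
apply: le_trans (ler_normD _ _) _; apply: lerD => //; apply: le_trans D _.
by rewrite -[leRHS]mulrA; apply: ler_wpM2l; [rewrite mulr_ge0|exact: D2].
Qed.

(** The coefficients decay geometrically, so the partial sums are small even uniformly, and no
    cancellation between blocks is needed. *)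
Lemma Ulim_small z : Zspan p Y z -> nrm p (Ulim Y Y (S z)) <= 8 * d * nrm p z.
Proof.
move=> Zz; have LS := Zspan_inLp (SZ (YX Zz)).
have [LU cU] := Ulim_spec HY HY p1 LS.
apply: (@le_of_eps _ _ _ 1) => // e e0; rewrite mul1r; have [N HN] := cU e e0.
have LN := UN_inLp Y N (S z) HY (ltW (lt_trans ltr01 p1)).
apply: le_trans (nrm_le_dist (ltW p1) LU LN) _; apply: lerD; last by rewrite nrmC; exact: HN.
apply: nrm_bounded.
- exact: lt_trans ltr01 p1.
- exact: inLp_meas LN.
- move=> x _; rewrite /UN; apply: le_trans (ler_norm_sum _ _ _) _.
  apply: (@le_trans _ _ (\sum_(n < N) 4 * d * nrm p z * t n)).
    by apply: ler_sum => n _; apply: (dcoef_small Zz); exact: lab_lt.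
  have c0 : 0 <= 4 * d * nrm p z by rewrite !mulr_ge0 ?nrm_ge0.
  rewrite -mulr_sumr; apply: le_trans (ler_wpM2l c0 (geo_sum N)) _; lra.
- by rewrite !mulr_ge0 ?nrm_ge0.
Qed.

End SmallBlocks.

(** * Orthogonal factors from label systems *)

Section Factor.
Context {R : realType}.
Implicit Types (f g y z : R -> R) (p : R) (X Y : nat -> R -> nat).

Lemma image_ae_Ulim p X Y : labels X -> labels Y -> 1 < p ->
  image_ae p (Ulim X Y) (Zspan p X) = Zspan p Y.
Proof.
move=> HX HY p1; have p0 := ltW (lt_trans ltr01 p1); apply/seteqP; split => z.
  move=> [Lz [y [Zy yz]]].
  exact: (Zspan_ae HY p0 (inLp_meas Lz) yz (Ulim_Zspan HX HY p1 (Zspan_inLp Zy))).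
move=> Zz; have Lz := Zspan_inLp Zz; split; first exact: Lz.
exists (Ulim Y X z); split; first exact: (Ulim_Zspan HY HX p1 Lz).
by rewrite (Ulim_comp HY HX HY p1 Lz); exact: (Zspan_Ulim_id HY p1 Zz).
Qed.

Lemma orth_proj_Ulim Y : labels Y -> orth_proj (Ulim Y Y : (R -> R) -> R -> R).
Proof.
move=> HY; have p1 : 1 < 2 :> R by rewrite ltr1n.
split.
- by move=> f Lf; exact: (Ulim_spec HY HY p1 Lf).1.
- by move=> c f g Lf Lg; exact: (Ulim_lin c HY HY p1 Lf Lg).
- by move=> f Lf; rewrite (Ulim_comp HY HY HY p1 Lf); exact: ae01_refl.
- by move=> f g Lf Lg; rewrite !ipE; exact: (Ulim_selfadj HY p1 p1 half_conj Lf Lg).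
Qed.

Lemma orth_compl_Ulim p Y (C : R) : labels Y -> 1 < p ->
  (forall f, inLp p f -> nrm p (Ulim Y Y f) <= C * nrm p f) ->
  orth_compl_by p C (Ulim Y Y) (Zspan p Y).
Proof.
move=> HY p1 HC; have p0 := lt_trans ltr01 p1; split; first exact: orth_proj_Ulim.
  move=> f _ Lf; have LU := (Ulim_spec HY HY p1 Lf).1; split; first exact: LU.
  by rewrite (pnormE LU) (pnormE Lf) -EFinM lee_fin; exact: HC.
apply/seteqP; split => f.
  move=> [Lf Hf]; split; first exact: Lf.
  move=> e e0; have e2 : 0 < e / 2 by rewrite divr_gt0.
  have [N [u [u0 H]]] := Hf _ e2; exists (Ssum Y u N).
  have LS := Ssum_inLp HY u N (ltW p0).
  have LU := (Ulim_spec HY HY p1 LS).1.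
  split; [exact: Ssum_inLp|exact: LS|].
  rewrite (pnormE (inLpB (ltW p1) Lf LU).1) lte_fin.
  apply: (@le_lt_trans _ _ (e / 2)); last lra.
  rewrite -(@ae_nrm _ p (fun x => f x - Ssum Y u N x)); first exact: H.
  - exact: (inLp_meas (inLpB (ltW p1) Lf LS).1).
  - exact: (inLp_meas (inLpB (ltW p1) Lf LU).1).
  - exact: (ae01_comp (fun x v => f x - v) (ae01_sym (Zspan_Ulim_id HY p1 (Ssum_Zspan N HY p1 u0)))).
move=> [Lf Hf]; apply: (Zspan_closed HY p1 Lf) => e e0.
have [g [_ Lg H]] := Hf e e0; exists (Ulim Y Y g); first exact: (Ulim_Zspan HY HY p1 Lg).
have LU := (Ulim_spec HY HY p1 Lg).1.
by move: H; rewrite (pnormE (inLpB (ltW p1) Lf LU).1) lte_fin => /ltW.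
Qed.

Lemma proj_ext_Ulim p Y (C : R) : labels Y -> 1 < p ->
  (forall f, inLp p f -> nrm p (Ulim Y Y f) <= C * nrm p f) ->
  proj_ext p C (Ulim Y Y) (Ulim Y Y).
Proof.
move=> HY p1 HC; split.
- by move=> f Lf; exact: (Ulim_spec HY HY p1 Lf).1.
- by move=> c f g Lf Lg; exact: (Ulim_lin c HY HY p1 Lf Lg).
- move=> f Lf; rewrite (pnormE (Ulim_spec HY HY p1 Lf).1) (pnormE Lf) -EFinM lee_fin; exact: HC.
- by move=> g _ _; exact: ae01_refl.
Qed.

Lemma Ulim_id_iso p X Y y : labels X -> labels Y -> 1 < p -> Zspan p X y ->
  nrm p (Ulim X Y y) = nrm p y.
Proof.
move=> HX HY p1 Zy; have Ly := Zspan_inLp Zy.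
rewrite (Ulim_iso HX HY HX p1 Ly); apply: ae_nrm.
- exact: inLp_meas (Ulim_spec HX HX p1 Ly).1.
- exact: inLp_meas Ly.
- exact: (Zspan_Ulim_id HX p1 Zy).
Qed.

(** Embedding [Ulim X Y], projection [Ulim Y Y], inverse [Ulim Y X]. Inverse after projection
    collapses to [Ulim Y X], which has the same norms as [Ulim Y Y], so the error can be measured on
    the span of [Y]. *)
Lemma orth_factor_Ulim p X Y (T : (R -> R) -> R -> R) (l0 c e : R) : labels X -> labels Y -> 1 < p ->
  (forall f, Zspan p Y f -> Zspan p X f) -> (forall f, Zspan p X f -> Zspan p X (T f)) ->
  c < e ->
  (forall z, Zspan p Y z -> nrm p (Ulim Y Y (fun x => T z x - l0 * z x)) <= c * nrm p z) ->
  orth_factor p (Zspan p X) (Zspan p X) T (fun y x => l0 * y x) e.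
Proof.
move=> HX HY p1 YX TZ ce Hc; exists (Ulim X Y); split.
  split.
  - by move=> y Zy; apply: YX; exact: (Ulim_Zspan HX HY p1 (Zspan_inLp Zy)).
  - by move=> a f g Zf Zg; exact: (Ulim_lin a HX HY p1 (Zspan_inLp Zf) (Zspan_inLp Zg)).
  - by move=> y Zy; exact: (equidist_Ulim HX HY p1 Zy).
have [C [C0 HC]] := Ulim_bound HY p1.
have HC' f : inLp p f -> nrm p (Ulim Y Y f) <= C * nrm p f by exact: HC.
exists (Ulim Y Y), C, (Ulim Y Y), (Ulim Y X); split.
- by rewrite (image_ae_Ulim HX HY p1); exact: orth_compl_Ulim.
- exact: proj_ext_Ulim.
- rewrite /inv_on (image_ae_Ulim HX HY p1) => z Zz; have Lz := Zspan_inLp Zz; split.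
    exact: (Ulim_Zspan HY HX p1 Lz).
  by rewrite (Ulim_comp HY HX HY p1 Lz); exact: (Zspan_Ulim_id HY p1 Zz).
exists c; split => // y Zy; have Ly := Zspan_inLp Zy.
set z := Ulim X Y y.
have Zz : Zspan p Y z := Ulim_Zspan HX HY p1 Ly.
have Lz := Zspan_inLp Zz; have LT := Zspan_inLp (TZ _ (YX _ Zz)).
rewrite (Ulim_comp HY HY HX p1 LT).
have LUT := (Ulim_spec HY HX p1 LT).1.
have Lly : inLp p (fun x => l0 * y x) := inLpZ l0 Ly.
have LD := (inLpB (ltW p1) LUT Lly).1.
rewrite (pnormE LD) (pnormE Ly) -EFinM lee_fin -(Ulim_id_iso HX HY p1 Zy) -/z.
have Lw : inLp p (fun x => T z x - l0 * z x) := (inLpB (ltW p1) LT (inLpZ l0 Lz)).1.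
apply: le_trans (Hc _ Zz); rewrite (Ulim_iso HY HY HX p1 Lw).
rewrite le_eqVlt; apply/orP; left; apply/eqP; apply: ae_nrm.
- exact: inLp_meas LD.
- exact: inLp_meas (Ulim_spec HY HX p1 Lw).1.
have -> : (fun x => T z x - l0 * z x) = (fun x => (- l0) * z x + T z x).
  by apply/funext => x; rewrite mulNr addrC.
apply: ae01_sym; apply: ae01_trans (Ulim_lin (- l0) HY HX p1 Lz LT) _.
have yz : ae01 (Ulim Y X z) y.
  by rewrite /z (Ulim_comp HX HY HX p1 Ly); exact: (Zspan_Ulim_id HX p1 Zy).
by apply: ae_imp yz => x E Ix; rewrite E// mulNr addrC.
Qed.

End Factor.

(** * The scalar in the convex hull and the final estimate *)

Section Main.
Context {R : realType}.
Local Notation I01 := (@I01 R).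
Implicit Types (f g z : R -> R).

(** The weights sit on the single block [k + N] and there on the levels from [k] on, as in
    [lamB]. *)
Lemma conv_sum (k N : nat) (c : R) (G : nat -> nat -> nat -> R) :
  \sum_(n < (k + N).+1) \sum_(l < n) \sum_(i < 2 ^ l)
     (if (n == k + N :> nat) && (k <= l)%N then c else 0) * G n l i =
  c * \sum_(k <= l < k + N) \sum_(i < 2 ^ l) G (k + N)%N l i.
Proof.
rewrite big_ord_recr /= big1 ?add0r => [|n _]; last first.
  by apply: big1 => l _; apply: big1 => i _; rewrite ltn_eqF ?mul0r.
rewrite -(big_mkord xpredT (fun l => \sum_(i < 2 ^ l)
   (if (k + N == k + N)%N && (k <= l)%N then c else 0) * G (k + N)%N l i)).
rewrite (big_cat_nat (leq0n k) (leq_addr N k)) /= big_nat_cond big1 ?add0r => [|l]; last first.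
  by rewrite andbT => /andP[_ lk]; apply: big1 => i _; rewrite eqxx leqNgt lk /= mul0r.
rewrite mulr_sumr big_nat_cond [RHS]big_nat_cond; apply: eq_bigr => l /andP[/andP[kl _] _].
by rewrite mulr_sumr; apply: eq_bigr => i _; rewrite eqxx kl.
Qed.

Variables (p : R) (h : nat -> nat -> nat -> R -> R) (T : (R -> R) -> (R -> R)) (C : R).
Hypothesis p1 : 1 < p.
Hypothesis mh : forall n k i, measurable_fun I01 (h n k i).
Hypothesis lawh : forall n, (0 < n)%N -> same_joint_law n (h n) haar.
Hypothesis indh : blocks_independent h.
Local Notation X := (XL h).
Hypothesis TZ : forall f, Zspan p X f -> Zspan p X (T f).
Hypothesis Tlin : linear_on (Zspan p X) T.
Hypothesis C0 : 0 <= C.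
Hypothesis TC : forall f, Zspan p X f -> nrm p (T f) <= C * nrm p f.

Lemma dgB_diagT m l i : (l < m)%N -> (i < 2 ^ l)%N -> dgB X T m l i = diagT h T m l i.
Proof.
move=> lm il; have HX := labels_XL mh lawh indh.
have hX := h_ae mh lawh lm il.
have Zv : Zspan p X (fun x => hv m l i (X m x)) := label_Zspan HX p1 (avg_hv i lm).
have Zh : Zspan p X (h m l i).
  exact: (Zspan_ae HX (ltW (lt_trans ltr01 p1)) (mh m l i) (ae01_sym hX) Zv).
rewrite /dgB /diagT ipE /Bf; congr (_ * _); apply: ae_Ex.
- exact: (measurable_funM (label_meas HX m (hv m l i)) (inLp_meas (Zspan_inLp (TZ Zv)))).
- exact: (measurable_funM (mh m l i) (inLp_meas (Zspan_inLp (TZ Zh)))).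
- exact: (ae01_comp2 (fun _ a b => a * b) (ae01_sym hX) (T_ae HX p1 TZ Tlin TC Zv Zh (ae01_sym hX))).
Qed.

Lemma lamB_conv k N : (0 < N)%N -> in_conv_diag h T (lamB X T k N).
Proof.
move=> N0; pose D : R := (2 ^ k)%:R * ((2 ^ N)%:R - 1).
have D0 : 0 < D by rewrite mulr_gt0 ?two_pow_gt0 ?pow2_minus1_gt0.
exists (k + N).+1, (fun n l _ => if (n == k + N)%N && (k <= l)%N then D^-1 else 0); split.
- by move=> n l i; case: ifP => // _; rewrite invr_ge0 ltW.
- transitivity (D^-1 * \sum_(k <= l < k + N) \sum_(i < 2 ^ l) 1).
    rewrite -(conv_sum k N D^-1 (fun _ _ _ => 1)).
    by apply: eq_bigr => n _; apply: eq_bigr => l _; apply: eq_bigr => i _; rewrite mulr1.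
  by rewrite sum_pow2 mulVf// gt_eqF.
rewrite (conv_sum k N D^-1 (diagT h T)) /lamB -/D; congr (_ * _).
rewrite big_nat_cond [RHS]big_nat_cond; apply: eq_bigr => l /andP[/andP[kl lN] _].
by apply: eq_bigr => i _; rewrite dgB_diagT.
Qed.

Lemma factor_main (eps : R) : 0 < eps -> exists lam0 : R, in_conv_diag h T lam0 /\
  orth_factor p (Zspan p X) (Zspan p X) T (fun y x => lam0 * y x) eps.
Proof.
move=> eps0; have HX := labels_XL mh lawh indh.
have [mu Hmu] := iterated_cluster HX p1 TZ C0 TC.
have e40 : 0 < eps / 4 by rewrite divr_gt0.
have [N [_ N0 /(_ 0%N)[k _ Hk]]] := Hmu _ e40 0%N.
(* The system is built for [mu], but the scalar of the theorem is this nearby average, which visibly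
   lies in the convex hull. *)
set l0 := lamB X T k N in Hk.
(* [Ulim_small] loses a factor 8, so the compression of [T - mu] contributes [eps / 4]; the distance
   from [mu] to [l0] contributes as much, and [eps / 2] is strictly below [eps]. *)
pose d := eps / 32; have d0 : 0 < d by rewrite divr_gt0.
pose t n : R := (2 ^ n)%:R^-1.
pose e i j := d * t i ^+ 3 * t j ^+ 3.
have t0 n : 0 < t n by rewrite invr_gt0 two_pow_gt0.
have e0 i j : 0 < e i j by rewrite !mulr_gt0 ?exprn_gt0.
have [m [pi [inc bal He]]] := good_system HX p1 TZ Tlin C0 TC Hmu e0.
set Y := relabel X m pi in He.
have HY : labels Y := labels_relabel HX inc bal.
have YX f : Zspan p Y f -> Zspan p X f := relabel_Zspan HX inc bal p1.
exists l0; split; first exact: lamB_conv.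
pose S f x := T f x - mu * f x.
have SE f : S f = (fun x => (- mu) * f x + T f x).
  by apply/funext => x; rewrite /S mulNr addrC.
have SZ f : Zspan p X f -> Zspan p X (S f).
  by move=> Zf; rewrite SE; exact: (Zspan_lin (- mu) HX p1 Zf (TZ Zf)).
have Slin : linear_on (Zspan p X) S.
  move=> a f g Zf Zg; apply: ae_imp (Tlin a Zf Zg) => x E Ix.
  rewrite /S E//; ring.
have SC f : Zspan p X f -> nrm p (S f) <= (C + `|mu|) * nrm p f.
  move=> Zf; have Lf := Zspan_inLp Zf; have LT := Zspan_inLp (TZ Zf).
  apply: le_trans (inLpB (ltW p1) LT (inLpZ mu Lf)).2 _.
  by rewrite (nrmZ mu (lt_trans ltr01 p1) Lf) mulrDl lerD2r TC.
have C'0 : 0 <= C + `|mu| by rewrite addr_ge0.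
have HeS n n' a b : (a < 2 ^ n)%N -> (b < 2 ^ n')%N ->
    `|Ex (fun x => cind n a (Y n x) * S (fun x => cind n' b (Y n' x)) x)| <= d * t n ^+ 3 * t n' ^+ 3.
  move=> an bn; apply: le_trans (He n n' a b an bn); rewrite le_eqVlt; apply/orP; left; apply/eqP.
  have my := label_meas HY n (cind n a).
  have y1 x : I01 x -> `|cind n a (Y n x)| <= 1 :> R by move=> _; exact: cind_norm.
  have Zb : Zspan p X (fun x => cind n' b (Y n' x)).
    by apply: YX; exact: (label_Zspan HY p1 (avg_cind bn)).
  have L1T := L1_mul_bounded my y1 (T_L1 p1 TZ Zb).
  have L1b := L1_mul_bounded my y1 (label_L1 HY n' (cind n' b)).
  rewrite -(ExZ mu L1b) -(ExB L1T (L1Z mu L1b)); congr (`| Ex _ |); apply/funext => x.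
  by rewrite /S mulrBr mulrCA.
have small := Ulim_small HX HY p1 YX SZ Slin C'0 SC (ltW d0) HeS.
apply: (@orth_factor_Ulim _ p X Y T l0 (eps / 2) eps HX HY p1 YX TZ); first by lra.
move=> z Zz; have Lz := Zspan_inLp Zz; have LS := Zspan_inLp (SZ _ (YX _ Zz)).
have -> : (fun x => T z x - l0 * z x) = (fun x => (mu - l0) * z x + S z x).
  by apply/funext => x; rewrite /S; ring.
have [LUz _] := Ulim_spec HY HY p1 Lz; have [LUS _] := Ulim_spec HY HY p1 LS.
have Lw := (inLpD (ltW p1) (inLpZ (mu - l0) Lz) LS).1.
rewrite (ae_nrm p (inLp_meas (Ulim_spec HY HY p1 Lw).1) _ (Ulim_lin (mu - l0) HY HY p1 Lz LS)); last first.
  exact: (inLp_meas (inLpD (ltW p1) (inLpZ (mu - l0) LUz) LUS).1).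
apply: le_trans (inLpD (ltW p1) (inLpZ (mu - l0) LUz) LUS).2 _.
rewrite (nrmZ _ (lt_trans ltr01 p1) LUz) (Ulim_id_iso HY HY p1 Zz).
have H1 := small z Zz; have H2 := nrm_ge0 p z.
have H3 : `|mu - l0| * nrm p z <= eps / 4 * nrm p z by rewrite ler_wpM2r// distrC ltW.
have H4 : 8 * d * nrm p z = eps / 4 * nrm p z by rewrite /d; field.
rewrite H4 in H1; apply: le_trans (lerD H3 H1) _; lra.
Qed.

End Main.

Theorem mainTheorem13 (R : realType) (p : R) (h : nat -> nat -> nat -> R -> R)
  (T : (R -> R) -> (R -> R)) (eps : R) :
  1 < p ->
  (forall n k i, measurable_fun I01 (h n k i)) ->
  (forall n, (0 < n)%N -> same_joint_law n (h n) haar) ->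
  blocks_independent h ->
  bounded_op p (RX p h) T ->
  0 < eps ->
  exists lam0 : R, in_conv_diag h T lam0 /\
    orth_factor p (RX p h) (RX p h) T (fun y x => lam0 * y x) eps.
Proof.
move=> p1 mh lawh indh; rewrite (RXE mh lawh indh p1) => -[TZ Tlin [C HC]] eps0.
apply: (@factor_main _ p h T (Num.max C 0) p1 mh lawh indh TZ Tlin) => //.
  by rewrite le_max lexx orbT.
move=> f Zf; have := HC f Zf.
rewrite (pnormE (Zspan_inLp Zf)) (pnormE (Zspan_inLp (TZ _ Zf))) -EFinM lee_fin => H.
by apply: le_trans H _; rewrite ler_wpM2r ?nrm_ge0// le_max lexx.
Qed.
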